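(* Assume that $F_t$ is locally injective for every $t\ge0$; that for every compact subset $K\subset\mathbb{R}^p$ there exists $\varphi\in L^1_{\rm loc}(\mathbb{R}_+,\mathbb{R}_+)$ such that $\sup_{\xi\in K}\|f(t,\xi)\|\le\varphi(t)$ for all $t\ge0$; and that, for all compact sets $T\subset\mathbb{R}_+$, there exist $\rho>0$ and $c>0$ such that $c\|D\|<1$ and $$\sup_{\|\xi\|\ge\rho}\frac{\|f(t,\xi)\|}{\|\xi\|}\le c\quad\text{for a.e. } t\in T.$$ Then $\tilde{\mathcal B}(S^f,t_0)=\mathcal B(S^f,t_0)$ for every $t_0\ge0$ (that is, (L) is forward complete). Moreover, for all $v\in L^\infty_{\rm loc}(\mathbb{R}_+,\mathbb{R}^{m_{\rm e}})$, $t_0\ge0$ and $x^0\in\mathbb{R}^n$, there exists $(v,x,y)\in\mathcal B(S^f,t_0)$ such that $x(t_0)=x^0$.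
   Context: Setting. $\mathbb{R}_+=[0,\infty)$; norms on $\mathbb{R}^k$ are Euclidean and matrix norms are the induced operator norms. Let $n,m,m_{\rm e},p$ be positive integers, $A\in\mathbb{R}^{n\times n}$, $B\in\mathbb{R}^{n\times m}$, $B_{\rm e}\in\mathbb{R}^{n\times m_{\rm e}}$, $C\in\mathbb{R}^{p\times n}$, $D\in\mathbb{R}^{p\times m}$, $D_{\rm e}\in\mathbb{R}^{p\times m_{\rm e}}$, and let $f:\mathbb{R}_+\times\mathbb{R}^p\to\mathbb{R}^m$ be a Caratheodory function, i.e. $f(t,\cdot)$ is continuous for every $t\ge0$ and $f(\cdot,\xi)$ is measurable for every $\xi\in\mathbb{R}^p$. The Lur'e system $S^f$, also called (L), is $$\dot x(t)=Ax(t)+Bf(t,y(t))+B_{\rm e}v(t),\qquad y(t)=Cx(t)+Df(t,y(t))+D_{\rm e}v(t).$$ Write $(f\circ y)(t):=f(t,y(t))$ and $F_t(\xi):=\xi-Df(t,\xi)$ for $t\ge0$, $\xi\in\mathbb{R}^p$. $F_t$ is locally injective if every point of $\mathbb{R}^p$ has a neighbourhood on which $F_t$ is injective. Trajectories. For $0\le t_0<\tau\le\infty$, a pre-trajectory of (L) on $[t_0,\tau)$ is a triple $(v,x,y)\in L^\infty_{\rm loc}(\mathbb{R}_+,\mathbb{R}^{m_{\rm e}})\times W^{1,1}_{\rm loc}([t_0,\tau),\mathbb{R}^n)\times L^1_{\rm loc}([t_0,\tau),\mathbb{R}^p)$ such that $f\circ y\in L^1_{\rm loc}([t_0,\tau),\mathbb{R}^m)$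 and both equations of (L) hold for a.e. $t\in[t_0,\tau)$ (''loc'' refers to compact subintervals of $[t_0,\tau)$; elements of $W^{1,1}_{\rm loc}$ are identified with locally absolutely continuous functions). It is maximally defined if there is no pre-trajectory $(v,\tilde x,\tilde y)$ on some $[t_0,\tilde\tau)$ with $\tilde\tau>\tau$ and $(\tilde x,\tilde y)|_{[t_0,\tau)}=(x,y)$. $\tilde{\mathcal B}(S^f,t_0)$ denotes the set of all maximally defined pre-trajectories with initial time $t_0$; $\mathcal B(S^f,t_0)$ denotes the set of all trajectories on $[t_0,\infty)$, i.e. pre-trajectories on $[t_0,\tau)$ with $\tau=\infty$. (L) is forward complete if $\tilde{\mathcal B}(S^f,t_0)=\mathcal B(S^f,t_0)$ for every $t_0\ge0$. *)

(* Defs.v *)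
From HB Require Import structures.
From mathcomp Require Import all_boot all_order all_algebra.
From mathcomp Require Import all_classical all_reals all_analysis.

Set Implicit Arguments.
Unset Strict Implicit.
Unset Printing Implicit Defensive.

Import Order.TTheory GRing.Theory Num.Theory.
Import numFieldNormedType.Exports.

Local Open Scope classical_set_scope.
Local Open Scope ring_scope.

(* The norm of the library on 'cV[R]_k is the sup norm; it is used here only
   through the topology (continuity, compactness, derivatives), which is the
   Euclidean one. *)
Definition enorm {R : realType} {k : nat} (u : 'cV[R]_k) : R :=
  Num.sqrt (\sum_i (u i 0) ^+ 2).

Definition opnorm {R : realType} {k l : nat} (M : 'M[R]_(k, l)) : R :=
  sup [set enorm (M *m u) | u in [set u : 'cV[R]_l | enorm u <= 1]].

Section function_spaces.
Context {R : realType}.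
Implicit Types (J : set R) (k : nat).

(* Measurability is Lebesgue (not Borel) measurability: the real line carries
   the sigma-algebra of [completed_lebesgue_measure], and elements of the
   spaces below are represented by everywhere defined functions on R, of which
   only the values on J matter. *)
Local Notation mu := (@completed_lebesgue_measure R).
Local Notation lebR := (caratheodory_type (@wlength R idfun)^*%mu).

Definition ae_on J (P : R -> Prop) : Prop :=
  {ae mu, forall t, J t -> P t}.

Definition lmeasurable J k (g : R -> 'cV[R]_k) : Prop :=
  forall i, measurable_fun (J : set lebR) (fun t : lebR => g t i 0).

Definition L1_loc J (g : R -> R) : Prop :=
  forall a b : R, `[a, b] `<=` J -> mu.-integrable `[a, b] (EFin \o g).

Definition vL1_loc J k (g : R -> 'cV[R]_k) : Prop :=
  forall i, L1_loc J (fun t => g t i 0).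

Definition vLinfty_loc J k (g : R -> 'cV[R]_k) : Prop :=
  forall a b : R, `[a, b] `<=` J ->
    lmeasurable `[a, b] g /\
    exists M : R, ae_on `[a, b] (fun t => enorm (g t) <= M).

Definition abs_continuous (a b : R) k (x : R -> 'cV[R]_k) : Prop :=
  forall e : R, 0 < e -> exists2 d : R, 0 < d &
    forall (N : nat) (s r : 'I_N -> R),
      (forall i, [/\ a <= s i, s i <= r i & r i <= b]) ->
      trivIset [set: 'I_N] (fun i => `]s i, r i[%classic) ->
      \sum_i (r i - s i) < d -> \sum_i enorm (x (r i) - x (s i)) < e.

Definition W11_loc J k (x : R -> 'cV[R]_k) : Prop :=
  forall a b : R, a <= b -> `[a, b] `<=` J -> abs_continuous a b x.

End function_spaces.

Definition nonneg {R : realType} : set R := `[0, +oo[.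

Definition locally_injective (T : topologicalType) (U : Type) (F : T -> U) :=
  forall xi : T, exists2 V : set T, nbhs xi V & set_inj V F.

Record lure (R : realType) (n m me p : nat) := Lure {
  matA : 'M[R]_(n, n);
  matB : 'M[R]_(n, m);
  matBe : 'M[R]_(n, me);
  matC : 'M[R]_(p, n);
  matD : 'M[R]_(p, m);
  matDe : 'M[R]_(p, me);
  nonlin : R -> 'cV[R]_p -> 'cV[R]_m   (* only its values at t >= 0 matter *)
}.

(* A quadruple of a final time tau in ]t0, +oo] and representatives of (v, x, y)
   on R; the values of x and y outside [t0, tau[ are irrelevant. *)
Record signal (R : realType) (n me p : nat) := Signal {
  horizon : \bar R;
  input : R -> 'cV[R]_me;
  state : R -> 'cV[R]_n;
  output : R -> 'cV[R]_p
}.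

Section lure_systems.
Context {R : realType} {n m me p : nat}.
Implicit Types (sys : lure R n m me p) (w : signal R n me p).

Definition caratheodory (f : R -> 'cV[R]_p -> 'cV[R]_m) : Prop :=
  (forall t : R, 0 <= t -> continuous (f t)) /\
  (forall xi, lmeasurable nonneg (fun t => f t xi)).

Definition Fmap sys (t : R) (xi : 'cV[R]_p) : 'cV[R]_p :=
  xi - matD sys *m nonlin sys t xi.

Definition horizon_itv (t0 : R) (tau : \bar R) : set R :=
  [set t | t0 <= t /\ (t%:E < tau)%E].

Definition pretrajectory sys (t0 : R) w : Prop :=
  let v := input w in let x := state w in let y := output w in
  let fy := fun t => nonlin sys t (y t) in
  let J := horizon_itv t0 (horizon w) in
  [/\ (t0%:E < horizon w)%E,
      [/\ vLinfty_loc nonneg v, W11_loc J x, vL1_loc J y & vL1_loc J fy],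
      ae_on J (fun t => is_derive t 1 x
        (matA sys *m x t + matB sys *m fy t + matBe sys *m v t)) &
      ae_on J (fun t =>
        y t = matC sys *m x t + matD sys *m fy t + matDe sys *m v t)].

(* Outputs are elements of L^1_loc, so their restrictions are compared almost
   everywhere. *)
Definition extends (t0 : R) w w' : Prop :=
  let J := horizon_itv t0 (horizon w) in
  [/\ (horizon w < horizon w')%E,
      input w' = input w,
      (forall t, J t -> state w' t = state w t) &
      ae_on J (fun t => output w' t = output w t)].

Definition maximal_pretrajectories sys (t0 : R) : set (signal R n me p) :=
  [set w | pretrajectory sys t0 w /\
           ~ exists2 w', pretrajectory sys t0 w' & extends t0 w w'].

Definition trajectories sys (t0 : R) : set (signal R n me p) :=
  [set w | pretrajectory sys t0 w /\ horizon w = +oo%E].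

Definition forward_complete sys : Prop :=
  forall t0 : R, 0 <= t0 -> maximal_pretrajectories sys t0 = trajectories sys t0.

End lure_systems.

(* Main.v *)
Require Import Defs.
From mathcomp Require Import all_boot all_order all_algebra all_fingroup.
From mathcomp Require Import all_classical all_reals all_analysis.
From mathcomp Require Import measurable_realfun.
From mathcomp Require Import zify ring lra.

(** Why the theorem is true.

    Fix a time [t] at which the growth bound holds.  As [c * opnorm D < 1], the
    output map [F_t] is coercive: [|xi| <= A + B * |F_t xi|].  A continuous,
    locally injective, coercive self-map of a finite dimensional space is a
    homeomorphism.  Invariance of domain makes it open; coercivity then lets
    segments, and contractions of loops, be lifted step by step, which gives
    surjectivity and injectivity ([coercive_onto], [coercive_injective]).
    Hence the output equation [F_t y = C x + De v t] determines
    [y = F_t^-1 (C x + De v t)], and the system becomes an ordinary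
    differential equation [x' = h t x] with [h] continuous in [x], measurable
    in [t] ([measurable_inverse_selection]), and of linear growth
    [|h t x| <= alpha t * (1 + |x|)] with [alpha] locally integrable
    ([rhs_growth]).

    By Caratheodory's theorem such an equation has a global solution from
    every initial value ([caratheodory_existence]); putting the output back
    gives a trajectory on the whole half-line ([integral_equation_solvable],
    [pretrajectory_of_integral_equation]).  That is the existence part.

    For forward completeness, let a pre-trajectory live on [[t0, tau[] with
    [tau] finite.  Linear growth bounds its state ([pre_bounded]), so its
    right-hand side is integrable up to [tau], the state has a limit at
    [tau], and concatenation with a global solution that starts from this
    limit is a strict extension ([pretrajectory_extension]).  So a
    maximally defined pre-trajectory is a trajectory.

    Two classical theorems are proved on the way.

    - Invariance of domain ([invariance_of_domain]).  The topological input
      is a combinatorial lemma of Kuhn, obtained from the fact that the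
      signed volume of the image of a triangulated cube depends only on the
      boundary ([kuhn]); it yields the no-retraction theorem.  If an
      injective continuous [F] missed values arbitrarily close to [F a], a
      Lipschitz approximation of an extension of its inverse, composed with
      a radial push away from such a missed value, would be a perturbation
      of the identity that omits a point near [a].

    - The fundamental theorem of calculus for absolutely continuous functions
      ([ftc_abs_cont]), which is needed because the state of a pre-trajectory
      is only known through its almost everywhere derivative.  It rests on
      Lebesgue differentiation and on the constancy of absolutely continuous
      functions with vanishing derivative ([abs_cont_constant]). *)

Set Implicit Arguments.
Unset Strict Implicit.
Unset Printing Implicit Defensive.

Import Order.TTheory GRing.Theory Num.Theory.
Import numFieldNormedType.Exports.

Local Open Scope classical_set_scope.
Local Open Scope ring_scope.

(** * Kuhn's lemma from a signed volume *)

Section signed_volume.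
Variables (R : numDomainType) (n' M' : nat).
Local Notation n := n'.+1.
Local Notation M := M'.+1.
Local Notation point := {ffun 'I_n -> nat}.
Local Notation simplex := ({ffun 'I_n -> 'I_M} * 'S_n)%type.
Implicit Types (s : simplex) (g h : 'I_n -> point -> R).

(** The cube [0, M]^n is cut into unit cells indexed by their lowest corner
    [s.1], and each cell into the n! simplices of the Freudenthal-Kuhn
    triangulation: a permutation prescribes the order in which the coordinates
    are raised by one. *)
Definition vertex s (k : nat) : point := [ffun i => (s.1 i + (s.2 i < k))%N].

Definition simplex_mx g s : 'M[R]_n.+1 :=
  \matrix_(k, c) if unlift ord0 c is Some j then g j (vertex s k) else 1.

Definition facet_mx g s (k : 'I_n.+1) : 'M[R]_n :=
  \matrix_(r, j) g j (vertex s (lift k r)).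

(** This is n! times the sum of the oriented volumes of the simplices spanned
    by the images under [g] of the vertices of each cell simplex. *)
Definition signed_volume g : R := \sum_s (-1) ^+ odd_perm s.2 * \det (simplex_mx g s).

Definition grid_boundary (x : point) : bool :=
  [exists i, (x i == 0)%N || (x i == M)%N].

Definition facet_volume g s (k : 'I_n.+1) : R :=
  (-1) ^+ odd_perm s.2 * ((-1) ^+ k * \det (facet_mx g s k)).

Lemma signed_volumeE g :
  signed_volume g = \sum_k \sum_s facet_volume g s k.
Proof.
rewrite exchange_big; apply: eq_bigr => s _.
rewrite (expand_det_col _ ord0) mulr_sumr; apply: eq_bigr => k _.
rewrite mxE unlift_none mul1r /cofactor addn0 /facet_volume.
congr (_ * (_ * \det _)); apply/matrixP => r j.
by rewrite !mxE liftK.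
Qed.

(** A facet lying in a face of the cube has volume zero as soon as one
    component of [g] vanishes on the boundary, because that component is a
    column of its determinant. *)
Lemma facet_volume0 g i0 s (k : 'I_n.+1) :
  (forall x, grid_boundary x -> g i0 x = 0) ->
  (exists i, forall r : 'I_n, (vertex s (lift k r) i == 0)%N) \/
  (exists i, forall r : 'I_n, (vertex s (lift k r) i == M)%N) ->
  facet_volume g s k = 0.
Proof.
move=> g0 bd; rewrite /facet_volume (_ : \det _ = 0) ?mulr0//.
rewrite (expand_det_col _ i0) big1// => r _; rewrite mxE g0 ?mul0r//.
by apply/existsP; case: bd => -[i /(_ r) E]; exists i; rewrite E ?orbT.
Qed.

Lemma addrr_eq0 (x : R) : x + x = 0 -> x = 0.
Proof. by move/eqP; rewrite -mulr2n mulrn_eq0 => /eqP. Qed.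

(** Facets opposite to a vertex that is neither first nor last are shared by
    the two simplices of the same cell whose permutations differ by the
    transposition of two consecutive steps; these have opposite signs, so the
    total cancels against itself. *)
Lemma sum_interior_facets g (k : 'I_n.+1) : k != ord0 -> k != ord_max ->
  \sum_s facet_volume g s k = 0.
Proof.
move=> k0 kn.
have k_gt0 : (0 < k)%N by rewrite lt0n.
have ltkn : (k < n)%N by rewrite ltn_neqAle -[(k <= n)%N]ltnS ltn_ord andbT.
have ltk1n : (k.-1 < n)%N by exact: leq_ltn_trans (leq_pred _) ltkn.
pose t := tperm (Ordinal ltk1n) (Ordinal ltkn).
pose f s : simplex := (s.1, (s.2 * t)%g).
have finj : injective f by move=> [q u] [q' u'] [-> /mulIg ->].
apply: addrr_eq0; rewrite {2}(reindex_inj finj) -big_split/=; apply: big1 => s _.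
rewrite /facet_volume.
(* the transposed steps differ only at vertex k, which the facet omits *)
have -> : facet_mx g (f s) k = facet_mx g s k.
  apply/matrixP => r j; rewrite !mxE; congr (g j _); apply/ffunP => i.
  rewrite !ffunE/= permM; congr (_ + nat_of_bool _)%N.
  have := neq_lift k r; rewrite -val_eqE/=; set l := bump _ _ => kl.
  case: tpermP => [->|->|//]/=; move: kl k_gt0; lia.
rewrite /= odd_permM odd_tperm -val_eqE/= (_ : k.-1 != k); last by lia.
by rewrite signr_addb/= expr1 mulrN1 mulNr subrr.
Qed.

(** The simplex on the other side of the facet opposite to the first vertex:
    the coordinate that was raised first moves to the end, and the cell is
    translated along it.  Wrapping around modulo [M] only concerns facets of
    the boundary and makes the shift a bijection. *)
Definition shift_simplex s : simplex :=
  let i0 := (s.2^-1)%g ord0 in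
  ([ffun i => if i == i0 then ordS (s.1 i) else s.1 i],
   (s.2 * lift_perm ord0 ord_max 1)%g).

Lemma shift_simplex_inj : injective shift_simplex.
Proof.
move=> [q u] [q' u'] [/ffunP E /mulIg E']; subst u'.
congr (_, _); apply/ffunP => i; have := E i; rewrite !ffunE.
by case: ifP => // _; exact: (can_inj (@ordSK _)).
Qed.

(** The facet opposite to vertex 0 of a simplex is the facet opposite to the
    last vertex of the shifted simplex.  The orientation changes by
    [(-1) ^ n'] from the cyclic permutation and by [(-1) ^ n] from the Laplace
    expansion. *)
Lemma facet_volume_shift g i0 s :
  (forall x, grid_boundary x -> g i0 x = 0) ->
  facet_volume g (shift_simplex s) ord_max = - facet_volume g s ord0.
Proof.
move=> g0; set j := (s.2^-1)%g ord0.
have sj : s.2 j = ord0 by rewrite permKV.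
have shj : (shift_simplex s).2 j = ord_max by rewrite permM sj lift_perm_id.
(* in the last layer of cells both facets lie in opposite faces of the cube *)
have [wrap|nwrap] := eqVneq (s.1 j : nat) M'.
  rewrite !(facet_volume0 g0) ?oppr0//.
    by right; exists j => r; rewrite ffunE sj/= wrap addn1.
  left; exists j => r; rewrite ffunE shj/= /shift_simplex/= ffunE eqxx/=.
  rewrite wrap modnn add0n /bump/=; have := ltn_ord r; lia.
rewrite /facet_volume.
have -> : facet_mx g (shift_simplex s) ord_max = facet_mx g s ord0.
  apply/matrixP => r c; rewrite !mxE; congr (g c _); apply/ffunP => i.
  have rn := ltn_ord r.
  have bumpn : bump n r = r :> nat by rewrite /bump; lia.
  rewrite !ffunE -/j; have [->|ij] := eqVneq i j.
    rewrite sj shj/= bumpn modn_small; last by have := ltn_ord (s.1 j); lia.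
    by rewrite /bump; lia.
  rewrite /= bumpn; congr (_ + _)%N.
  have ne : ord0 != s.2 i.
    by apply: contra ij => /eqP E; rewrite /j E permK.
  rewrite permM; have [t ->|E] := unliftP ord0 (s.2 i); last by rewrite E eqxx in ne.
  rewrite lift_perm_lift perm1/= /bump/=; have := ltn_ord t; lia.
rewrite /= odd_permM odd_lift_perm odd_perm1/= addbF.
rewrite signr_addb signr_odd exprS expr0 mul1r.
rewrite mulN1r !mulNr mulrN; congr (- _).
by rewrite -!mulrA (signrMK n').
Qed.

(** Discrete Stokes formula: expand the determinants along the column of
    ones; all facets cancel in pairs except those in the boundary, which have
    no volume. *)
Lemma signed_volume0 g i0 :
  (forall x, grid_boundary x -> g i0 x = 0) -> signed_volume g = 0.
Proof.
move=> g0; rewrite signed_volumeE big_ord_recl big_ord_recr/=.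
rewrite [X in _ + (X + _)]big1 => [|k _]; last first.
  by apply: sum_interior_facets; rewrite -val_eqE//= /bump; have := ltn_ord k; lia.
rewrite add0r (_ : lift _ _ = ord_max); last by apply: val_inj.
rewrite [X in _ + X](reindex_inj shift_simplex_inj) -big_split/=; apply: big1 => s _.
by rewrite (facet_volume_shift _ g0) addrN.
Qed.

(** Multilinearity of the determinant in the component [i0]. *)
Lemma signed_volumeD i0 g h d :
  (forall x, g i0 x = h i0 x + d i0 x) ->
  (forall j x, j != i0 -> h j x = g j x) ->
  (forall j x, j != i0 -> d j x = g j x) ->
  signed_volume g = signed_volume h + signed_volume d.
Proof.
move=> ghd hg dg; rewrite -big_split/=; apply: eq_bigr => s _.
rewrite -mulrDr -(det_tr (simplex_mx g s)) -(det_tr (simplex_mx h s)).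
rewrite -(det_tr (simplex_mx d s)).
rewrite (@determinant_multilinear _ _ _ (simplex_mx h s)^T (simplex_mx d s)^T
  (lift ord0 i0) 1 1) ?mul1r//.
- by apply/rowP => k; rewrite !mxE !mul1r liftK ghd.
- apply/matrixP => c k; rewrite !mxE; case: unliftP => [j E|//].
  by apply: hg; apply: contraTneq (neq_lift (lift ord0 i0) c) => ji; rewrite E ji eqxx.
- apply/matrixP => c k; rewrite !mxE; case: unliftP => [j E|//].
  by apply: dg; apply: contraTneq (neq_lift (lift ord0 i0) c) => ji; rewrite E ji eqxx.
Qed.

(** Only the boundary values matter: replace the components of [g] by those
    of [h] one at a time; each replacement changes the volume by that of a map
    with one component vanishing on the boundary. *)
Lemma eq_signed_volume g h :
  (forall j x, grid_boundary x -> g j x = h j x) ->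
  signed_volume g = signed_volume h.
Proof.
move=> gh; pose mix k (j : 'I_n) x := if (j < k)%N then h j x else g j x.
suff mixE k : (k <= n)%N -> signed_volume g = signed_volume (mix k).
  rewrite (mixE n)//; apply: eq_bigr => s _; congr (_ * \det _).
  by apply/matrixP => k c; rewrite !mxE; case: unlift => // j; rewrite /mix ltn_ord.
elim: k => [_|k IH kn].
  by apply: eq_bigr => s _; congr (_ * \det _).
rewrite IH 1?ltnW//; pose i0 := Ordinal kn.
pose d (j : 'I_n) x := if j == i0 then g j x - h j x else mix k j x.
rewrite (@signed_volumeD i0 (mix k) (mix k.+1) d).
- rewrite (@signed_volume0 d i0) ?addr0// => x bx.
  by rewrite /d eqxx gh// subrr.
- by move=> x; rewrite /mix /d/= ltnn ltnSn eqxx; ring.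
- move=> j x ji0; rewrite /mix ltnS leq_eqVlt -(val_eqE j i0) in ji0 *.
  by rewrite /= in ji0; rewrite (negbTE ji0).
- by move=> j x ji0; rewrite /d (negbTE ji0).
Qed.

Lemma det_simplex_const g s i0 (b : bool) :
  (forall k : 'I_n.+1, g i0 (vertex s k) = b%:R) -> \det (simplex_mx g s) = 0.
Proof.
case: b => gb; rewrite -det_tr.
  apply: (@determinant_alternate _ _ _ ord0 (lift ord0 i0)) => // k.
  by rewrite !mxE unlift_none liftK gb.
rewrite (expand_det_row _ (lift ord0 i0)) big1// => k _.
by rewrite !mxE liftK gb mul0r.
Qed.

Definition threshold (m : 'I_M) : 'I_n -> point -> R :=
  fun i x => (m < x i)%N%:R.

(** For the labelling by [m < x i], only the simplices of the diagonal cell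
    [(m, ..., m)] have nonconstant components.  There the matrix is unitriangular
    up to a permutation of its columns, so each of its n! simplices
    contributes 1. *)
Lemma signed_volume_threshold m : signed_volume (threshold m) = (n`!)%:R.
Proof.
pose T : 'M[R]_n.+1 := \matrix_(k, c) (c <= k)%N%:R.
have detT : \det T = 1.
  rewrite det_trig; last first.
    by apply/is_trig_mxP => i j ij; rewrite mxE leqNgt ij.
  by rewrite big1// => i _; rewrite mxE leqnn.
pose q0 : {ffun 'I_n -> 'I_M} := [ffun=> m].
have E0 (u : 'S_n) : (-1) ^+ odd_perm u * \det (simplex_mx (threshold m) (q0, u)) = 1.
  suff -> : simplex_mx (threshold m) (q0, u) = col_perm (lift_perm ord0 ord0 u) T.
    by rewrite col_permE det_mulmx detT mul1r det_perm odd_permV odd_lift_perm/= -expr2 sqrr_sign.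
  apply/matrixP => k c; rewrite !mxE; have [j ->|->] := unliftP ord0 c.
    rewrite lift_perm_lift /threshold !ffunE/= /bump/=.
    by congr (nat_of_bool _)%:R; lia.
  by rewrite lift_perm_id.
have {}E0 (q : {ffun 'I_n -> 'I_M}) (u : 'S_n) :
    (-1) ^+ odd_perm u * \det (simplex_mx (threshold m) (q, u)) = (q == q0)%:R.
  have [->|] := eqVneq q q0; first exact: E0.
  move/eqP => qq0; have /existsP[j qj] : [exists j, q j != m].
    apply/existsPn => /= qm; apply: qq0; apply/ffunP => j; rewrite ffunE.
    by apply/eqP; rewrite -[_ == _]negbK qm.
  rewrite (@det_simplex_const _ _ j (m < q j)%N) ?mulr0// => k.
  rewrite /threshold ffunE/=; congr (nat_of_bool _)%:R.
  by move: qj; rewrite -val_eqE/=; lia.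
rewrite /signed_volume -(pair_big predT predT
  (fun q (u : 'S_n) => (-1) ^+ odd_perm u * \det (simplex_mx (threshold m) (q, u))))/=.
under eq_bigr do under eq_bigr do rewrite E0.
rewrite (bigD1 q0)//= [X in _ + X]big1 ?addr0 => [|q /negbTE->]; last first.
  by rewrite big1.
by rewrite eqxx sumr_const card_Sn.
Qed.

(** A labelling that agrees on the boundary with the threshold labelling has
    nonzero signed volume; some simplex is therefore not degenerate, and then
    none of its labels is constant. *)
Lemma kuhn (l : 'I_n -> point -> bool) (m : 'I_M) :
  (forall i x, grid_boundary x -> l i x = (m < x i)%N) ->
  exists s, forall i, exists a b : 'I_n.+1, l i (vertex s a) /\ ~~ l i (vertex s b).
Proof.
move=> lbd.
have vol : signed_volume (fun i x => (l i x)%:R) != 0.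
  rewrite (eq_signed_volume (h := threshold m)) => [|j x bx]; last by rewrite lbd.
  by rewrite signed_volume_threshold pnatr_eq0 -lt0n fact_gt0.
have /existsP[s /forallP ls] : [exists s : simplex, forall i,
    [exists a : 'I_n.+1, l i (vertex s a)] && [exists b : 'I_n.+1, ~~ l i (vertex s b)]].
  apply: contraNT vol => /existsPn/= no; apply/eqP/big1 => s _.
  have /forallPn[i] := no s; rewrite negb_and => /orP[|].
    move=> /existsPn/= li; rewrite (@det_simplex_const _ _ i false) ?mulr0// => k.
    by rewrite (negbTE (li k)).
  move=> /existsPn/= li; rewrite (@det_simplex_const _ _ i true) ?mulr0// => k.
  by move: (li k); rewrite negbK => ->.
exists s => i; have /andP[/existsP[a la] /existsP[b lb]] := ls i.
by exists a, b.
Qed.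

End signed_volume.

(** * Column vectors and the no-retraction theorem *)

Section column_vectors.
Context {R : realType}.

Lemma coord_le_norm n (x : 'cV[R]_n) i : `|x i 0| <= `|x|.
Proof.
rewrite [leRHS]mx_normrE.
exact: (le_bigmax _ (fun ij : 'I_n * 'I_1 => `|x ij.1 ij.2|) (i, 0)).
Qed.

Lemma norm_le_coord n (x : 'cV[R]_n) (e : R) : 0 <= e ->
  (forall i, `|x i 0| <= e) -> `|x| <= e.
Proof.
move=> e0 xe; rewrite [leLHS]mx_normrE; apply: bigmax_le => // -[i j] _ /=.
by rewrite (ord1 j).
Qed.

Lemma norm_lt_coord n (x : 'cV[R]_n) (e : R) : 0 < e ->
  (forall i, `|x i 0| < e) -> `|x| < e.
Proof.
move=> e0 xe; rewrite [ltLHS]mx_normrE; apply: bigmax_lt => // -[i j] _ /=.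
by rewrite (ord1 j).
Qed.

Lemma norm_attained n (x : 'cV[R]_n.+1) : exists i, `|x| = `|x i 0|.
Proof.
have [i ->] : exists i : 'I_n.+1 * 'I_1, `|x| = `|x i.1 i.2|.
  have [x0|x0] := eqVneq `|x| 0; last exact: mx_norm_neq0.
  exists (0, 0); rewrite x0; apply/eqP; rewrite eq_le normr_ge0/= -x0.
  exact: coord_le_norm.
by exists i.1; rewrite (ord1 i.2).
Qed.

(** Specialized to column vectors, so that the distances in one system of
    linear inequalities agree syntactically. *)
Lemma cdist_triangle n (y x z : 'cV[R]_n) : `|x - z| <= `|x - y| + `|y - z|.
Proof. exact: ler_distD. Qed.

Lemma cdistC n (x y : 'cV[R]_n) : `|x - y| = `|y - x|.
Proof. exact: distrC. Qed.

Lemma cballP n (x y : 'cV[R]_n) (e : R) : ball x e y <-> `|x - y| < e.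
Proof. by rewrite mx_norm_ball. Qed.

Lemma cnbhsP n (x : 'cV[R]_n) (A : set 'cV[R]_n) :
  nbhs x A <-> exists2 e : R, 0 < e & forall y, `|x - y| < e -> A y.
Proof.
split => [/nbhs_ballP[e e0 eA]|[e e0 eA]].
  by exists e => // y /cballP; exact: eA.
by apply/nbhs_ballP; exists e => // y /cballP; exact: eA.
Qed.

Lemma ccontinuousP n m (F : 'cV[R]_n -> 'cV[R]_m) (x : 'cV[R]_n) :
  {for x, continuous F} <->
  forall e : R, 0 < e -> exists2 d : R, 0 < d & forall y, `|x - y| < d -> `|F x - F y| < e.
Proof.
split => [/cvgrPdist_lt cF e /cF /cnbhsP[d d0 dP]|cF].
  by exists d.
apply/cvgrPdist_lt; first exact: nbhs_filter.
move=> e /cF[d d0 dP].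
by apply/cnbhsP; exists d.
Qed.

Definition recip (k : nat) : R := k.+1%:R^-1.

Lemma recip_gt0 k : 0 < recip k.
Proof. by rewrite invr_gt0. Qed.

Lemma recip_lt (e : R) : 0 < e ->
  exists N : nat, forall k, (N <= k)%N -> recip k < e.
Proof.
by move=> e0; have [N _ NP] := near_infty_natSinv_lt (PosNum e0); exists N => k /NP.
Qed.

Lemma cnorm_sub n (x y : 'cV[R]_n) : `|x| <= `|x - y| + `|y|.
Proof. by rewrite -{1}(subrK y x) ler_normD. Qed.

Section continuous_maps.
Context {T : topologicalType} {n : nat}.
Implicit Types (f g : T -> 'cV[R]_n) (t : T).

Lemma ccontinuousD f g t : {for t, continuous f} -> {for t, continuous g} ->
  {for t, continuous (fun x => f x + g x)}.
Proof. exact: (@continuousD R 'cV[R]_n). Qed.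

Lemma ccontinuousB f g t : {for t, continuous f} -> {for t, continuous g} ->
  {for t, continuous (fun x => f x - g x)}.
Proof. exact: (@continuousB R 'cV[R]_n). Qed.

Lemma ccontinuousZ (s : T -> R) f t : {for t, continuous s} -> {for t, continuous f} ->
  {for t, continuous (fun x => s x *: f x)}.
Proof. exact: (@continuousZ R 'cV[R]_n). Qed.

Lemma ccontinuous_norm f t :
  {for t, continuous f} -> {for t, continuous (fun x => `|f x|)}.
Proof. by move=> cf; apply: continuous_comp => //; exact: norm_continuous. Qed.

Lemma ccontinuous_coord f t :
  (forall i, {for t, continuous (fun x => f x i 0)}) -> {for t, continuous f}.
Proof.
move=> cf; apply/cvgrPdist_lt => e e0.
have : \forall x \near t, forall i, `|f t i 0 - f x i 0| < e.
  by apply: filter_forall => i; have /cvgrPdist_lt := cf i; exact.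
apply: filterS => x h; apply: norm_lt_coord => // i; rewrite !mxE; exact: h.
Qed.

End continuous_maps.

Lemma mulmx_bounded m n (M : 'M[R]_(m, n)) :
  exists2 C : R, 0 < C & forall x : 'cV[R]_n, `|M *m x| <= C * `|x|.
Proof.
have S0 : 0 <= \sum_i \sum_j `|M i j| by apply: sumr_ge0 => i _; apply: sumr_ge0.
exists (1 + \sum_i \sum_j `|M i j|) => [|x]; first by rewrite ltr_wpDr.
apply: norm_le_coord => [|i]; first by rewrite mulr_ge0// addr_ge0.
rewrite mxE (le_trans (ler_norm_sum _ _ _))//.
apply: (@le_trans _ _ ((\sum_j `|M i j|) * `|x|)).
  rewrite mulr_suml; apply: ler_sum => j _; rewrite normrM ler_wpM2l//.
  exact: coord_le_norm.
rewrite ler_wpM2r// (bigD1 i)//= addrA addrAC ler_wpDl//.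
by rewrite addr_ge0//; apply: sumr_ge0 => k _; apply: sumr_ge0.
Qed.

Lemma mulmx_continuous m n (M : 'M[R]_(m, n)) :
  continuous (fun x : 'cV[R]_n => M *m x).
Proof.
move=> x; apply/ccontinuousP => e e0; have [C C0 MC] := mulmx_bounded M.
exists (e / C) => [|y xy]; first exact: divr_gt0.
rewrite -mulmxBr (le_lt_trans (MC _))// mulrC -ltr_pdivlMr//.
Qed.

(** Tychonoff's theorem for rows, carried over to columns by transposition. *)
Lemma closed_ball_compact_cV n (r : R) : compact [set u : 'cV[R]_n | `|u| <= r].
Proof.
pose A (i : 'I_n) := `[- r, r]%classic : set R.
have cA : compact [set v : 'rV[R]_n | forall i, A i (v ord0 i)].
  by apply: rV_compact => i; exact: segment_compact.
have [r0|r0] := leP 0 r; last first.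
  rewrite (_ : [set u | _] = set0); first exact: compact0.
  by apply/seteqP; split => // u /=; rewrite leNgt (lt_le_trans r0).
rewrite (_ : [set u | _] = trmx @` [set v : 'rV[R]_n | forall i, A i (v ord0 i)]).
  apply: continuous_compact cA; apply: continuous_subspaceT => v.
  apply: ccontinuous_coord => i.
  rewrite (_ : (fun _ => _) = fun v : 'rV[R]_n => v 0 i); last by apply/funext => w; rewrite mxE.
  exact: coord_continuous.
apply/seteqP; split => [u /= ur|_ /= [v Av <-]].
  exists u^T; last by rewrite trmxK.
  move=> i; rewrite /A/= mxE in_itv/= -ler_norml; exact: le_trans (coord_le_norm _ _) ur.
apply: norm_le_coord => // i; rewrite mxE ler_norml; have := Av i; by rewrite /A/= in_itv.
Qed.

(** The form of the Bolzano-Weierstrass theorem on which the compactness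
    arguments below rest. *)
Lemma bounded_cluster n (u : nat -> 'cV[R]_n) B : (forall k, `|u k| <= B) ->
  exists l, `|l| <= B /\ forall e : R, 0 < e -> forall N, exists2 k, (N <= k)%N & `|u k - l| < e.
Proof.
move=> uB; pose F : set_system 'cV[R]_n := u @ \oo.
have FB : F [set v | `|v| <= B] by exists 0%N => // k _; exact: uB.
have [l [lB lF]] := closed_ball_compact_cV (fmap_proper_filter _ _) FB.
exists l; split => // e e0 N.
have [| |v [[k /= Nk <-] /cballP lv]] := lF [set u k | k in [set k | (N <= k)%N]] (ball l e).
- by exists N => // k /= Nk; exists k.
- exact: nbhsx_ballx.
by exists k => //; rewrite cdistC.
Qed.

Lemma uniformly_continuous_bounded n m (F : 'cV[R]_n -> 'cV[R]_m) B :
  continuous F -> forall e : R, 0 < e -> exists2 d : R, 0 < d &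
  forall x y, `|x| <= B -> `|x - y| < d -> `|F x - F y| < e.
Proof.
move=> cF e e0; apply: contrapT => no.
have bad k : exists xy : 'cV[R]_n * 'cV[R]_n,
    [/\ `|xy.1| <= B, `|xy.1 - xy.2| < recip k & e <= `|F xy.1 - F xy.2|].
  apply: contrapT => nok; apply: no; exists (recip k); first exact: recip_gt0.
  move=> x y xB xy; rewrite ltNge; apply/negP => le; apply: nok.
  by exists (x, y).
pose u k := sval (cid (bad k)).
have uP k : [/\ `|(u k).1| <= B, `|(u k).1 - (u k).2| < recip k
    & e <= `|F (u k).1 - F (u k).2|] by rewrite /u; case: cid.
have [l [_ lP]] := @bounded_cluster _ (fun k => (u k).1) B (fun k => let: And3 a _ _ := uP k in a).
have e20 : 0 < e / 2 by lra.
have /ccontinuousP/(_ _ e20)[d d0 dP] := cF l.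
have d20 : 0 < d / 2 by lra.
have [N Nd] := recip_lt d20.
have [k Nk uk] := lP (d / 2) d20 N.
have [_ u12 Fu] := uP k.
rewrite cdistC in uk.
have b1 : `|F l - F (u k).1| < e / 2 by apply: dP; lra.
have b2 : `|F l - F (u k).2| < e / 2.
  apply: dP; have h1 := cdist_triangle (u k).1 l (u k).2.
  have h2 := Nd k Nk; lra.
have := cdist_triangle (F l) (F (u k).1) (F (u k).2).
rewrite cdistC in b1 => h; lra.
Qed.

(** Label the grid points of the cube [[-1, 1]^n] by the signs of the
    components of [g].  On the boundary [g] is the identity, so the labels are
    those of a threshold, and Kuhn's lemma provides a small simplex on which
    every component of [g] takes both signs; by uniform continuity [g] is
    small on that simplex. *)
Lemma approx_zero_of_identity_boundary n (g : 'cV[R]_n.+1 -> 'cV[R]_n.+1) :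
  continuous g -> (forall x, `|x| = 1 -> g x = x) ->
  forall e : R, 0 < e -> exists2 x, `|x| <= 1 & `|g x| < e.
Proof.
move=> cg gid e e0.
have [d d0 gd] := uniformly_continuous_bounded 1 cg e0.
have d20 : 0 < d / 2 by lra.
have [k /(_ k (leqnn k)) kd] := recip_lt d20.
(* an odd number of cells, so that the threshold k is the middle one *)
pose M' := (2 * k)%N; pose M := M'.+1.
have M0 : 0 < M%:R :> R by rewrite ltr0n.
have MV : M%:R * M%:R^-1 = 1 :> R by rewrite divff// lt0r_neq0.
have MV0 : 0 < M%:R^-1 :> R by rewrite invr_gt0.
have Mk : M%:R^-1 <= recip k.
  by rewrite /recip lef_pV2 ?posrE ?ltr0n// ler_nat /M /M'; lia.
pose pt (z : {ffun 'I_n.+1 -> nat}) : 'cV[R]_n.+1 :=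
  \col_i (-1 + 2 * ((minn (z i) M)%:R * M%:R^-1)).
have ptle z : `|pt z| <= 1.
  apply: norm_le_coord => // i; rewrite mxE ler_norml.
  have : (minn (z i) M)%:R <= M%:R :> R by rewrite ler_nat geq_minr.
  have : 0 <= (minn (z i) M)%:R :> R by [].
  move: (minn _ _)%:R => a a0 aM; apply/andP; split; nra.
have ltkM : (k < M)%N by rewrite /M /M'; lia.
pose l i z := 0 < g (pt z) i 0.
have [i z|s ls] := @kuhn R n M' l (Ordinal ltkM).
  move=> /existsP[j bj]; rewrite /l gid; last first.
    apply/eqP; rewrite eq_le ptle/= (le_trans _ (coord_le_norm _ j))//= mxE.
    case/orP: bj => /eqP ->; first by rewrite min0n mul0r mulr0 addr0 normrN1.
    by rewrite minnn MV mulr1 (_ : -1 + 2 = 1 :> R) ?normr1//; lra.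
  rewrite mxE/=; have [kz|zk] := ltnP k (z i).
    have : (k.+1%:R : R) <= (minn (z i) M)%:R by rewrite ler_nat leq_min kz ltkM.
    have : (2 * k.+1%:R : R) = M%:R + 1 by rewrite /M /M' -natrM natr1; congr _%:R; lia.
    move: (minn _ _)%:R k.+1%:R => a b ba ab; nra.
  apply/negbTE; rewrite -leNgt.
  have : (minn (z i) M)%:R <= k%:R :> R by rewrite ler_nat geq_min zk.
  have : (2 * k%:R : R) = M%:R - 1.
    by rewrite /M -(natr1 M') addrK /M' natrM.
  move: (minn _ _)%:R k%:R => a b ba ab; nra.
(* the vertices of a simplex are at distance at most 2 / M <= 2 * recip k *)
have near0 j : (j <= n.+1)%N -> `|pt (vertex s 0) - pt (vertex s j)| < d.
  move=> jn; apply: norm_lt_coord => // i; rewrite !mxE !ffunE ltn0 addn0.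
  have sM := ltn_ord (s.1 i); rewrite -/M in sM.
  rewrite (minn_idPl (ltnW sM)) (minn_idPl _); last first.
    by apply: leq_trans sM; rewrite -[leqRHS]addn1 leq_add2l leq_b1.
  rewrite natrD; move: (nat_of_ord (s.1 i))%:R (M%:R^-1) MV0 Mk => q w w0 wk.
  rewrite (_ : _ - _ = - (2 * ((s.2 i < j)%N%:R * w))); last by ring.
  rewrite normrN; case: (s.2 i < j)%N; last by rewrite mul0r mulr0 normr0.
  rewrite mul1r ger0_norm; nra.
exists (pt (vertex s 0)) => //; apply: norm_lt_coord => // i.
have [a [b]] := ls i; rewrite /l -leNgt => -[la lb].
have ga := gd _ _ (ptle _) (near0 a (ltn_ord a)).
have gb := gd _ _ (ptle _) (near0 b (ltn_ord b)).
have := le_lt_trans (coord_le_norm _ i) ga.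
have := le_lt_trans (coord_le_norm _ i) gb.
rewrite !mxE !ltr_norml => /andP[b1 b2] /andP[a1 a2]; lra.
Qed.

(** The no-retraction theorem for the unit ball of the sup norm: a
    continuous extension of the identity of the sphere to the ball must vanish
    somewhere. *)
Lemma zero_of_identity_boundary n (g : 'cV[R]_n.+1 -> 'cV[R]_n.+1) :
  continuous g -> (forall x, `|x| = 1 -> g x = x) ->
  exists2 x, `|x| <= 1 & g x = 0.
Proof.
move=> cg gid.
have ex k : exists x, `|x| <= 1 /\ `|g x| < recip k.
  have [x x1 gx] := approx_zero_of_identity_boundary cg gid (recip_gt0 k).
  by exists x.
pose u k := sval (cid (ex k)).
have uP k : `|u k| <= 1 /\ `|g (u k)| < recip k by rewrite /u; case: cid.
have [l [l1 lP]] := bounded_cluster (fun k => (uP k).1).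
exists l => //; apply/eqP; rewrite -normr_le0 leNgt; apply/negP => gl.
have g20 : 0 < `|g l| / 2 by lra.
have /ccontinuousP/(_ _ g20)[d d0 dP] := cg l.
have [N NP] := recip_lt g20.
have [k Nk uk] := lP d d0 N.
have h1 := dP (u k); rewrite cdistC in uk; have {}h1 := h1 uk.
have h2 := cnorm_sub (g l) (g (u k)).
have h3 := NP k Nk; have h4 := (uP k).2; lra.
Qed.

End column_vectors.

(** * Invariance of domain *)

Section lipschitz_approximations.
Context {R : realType}.

Definition approximable n (S : set 'cV[R]_n) (l : 'cV[R]_n) : Prop :=
  forall e : R, 0 < e -> exists2 x, S x & `|l - x| < e.

Lemma approximable_ball n (a : 'cV[R]_n) r l :
  approximable [set x | `|x - a| <= r] l -> `|l - a| <= r.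
Proof.
move=> la; rewrite leNgt; apply/negP => ral.
have d0 : 0 < `|l - a| - r by lra.
have [x /= xr lx] := la _ d0.
have h := cdist_triangle x l a; lra.
Qed.

Lemma approximable_far n (a : 'cV[R]_n) r l :
  approximable [set x | r <= `|a - x|] l -> r <= `|a - l|.
Proof.
move=> la; rewrite leNgt; apply/negP => ral.
have d0 : 0 < r - `|a - l| by lra.
have [x /= xr lx] := la _ d0.
have h := cdist_triangle l a x; lra.
Qed.

Lemma approximableS n (S S' : set 'cV[R]_n) l :
  S `<=` S' -> approximable S l -> approximable S' l.
Proof. by move=> SS' Sl e /Sl[x /SS' Sx xe]; exists x. Qed.

(** A cluster point of almost-preimages is a preimage; so the image of a
    bounded closed set under a continuous map is closed. *)
Lemma attained n m (F : 'cV[R]_n -> 'cV[R]_m) (S : set 'cV[R]_n) (B : R) y :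
  continuous F -> (forall x, S x -> `|x| <= B) -> (forall l, approximable S l -> S l) ->
  approximable [set F x | x in S] y -> exists2 x, S x & F x = y.
Proof.
move=> cF SB Scl ex.
have {}ex k : exists x, S x /\ `|y - F x| < recip k.
  by have [_ [x Sx <-] Fx] := ex _ (recip_gt0 k); exists x.
pose u k := sval (cid (ex k)).
have uP k : S (u k) /\ `|y - F (u k)| < recip k by rewrite /u; case: cid.
have [l [_ lP]] := bounded_cluster (fun k => SB _ (uP k).1).
exists l.
  apply: Scl => e e0; have [k _ uk] := lP e e0 0%N.
  by exists (u k); [exact: (uP k).1|rewrite cdistC].
apply/eqP; rewrite -subr_eq0 -normr_le0 leNgt; apply/negP => gl.
have g20 : 0 < `|F l - y| / 2 by lra.
have /ccontinuousP/(_ _ g20)[d d0 dP] := cF l.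
have [N NP] := recip_lt g20.
have [k Nk uk] := lP d d0 N; rewrite cdistC in uk.
have h1 := dP _ uk.
have h2 := cdist_triangle (F (u k)) (F l) y.
rewrite (cdistC (F (u k)) y) in h2.
have h3 := NP k Nk; have h4 := (uP k).2; lra.
Qed.

Lemma cnorm_le_dist n (a x : 'cV[R]_n) r : `|x - a| <= r -> `|x| <= r + `|a|.
Proof. by move=> xa; have := cnorm_sub x a => *; lra. Qed.

Lemma bounded_ball_image n m (F : 'cV[R]_n -> 'cV[R]_m) B : continuous F ->
  exists2 C : R, 0 < C & forall x, `|x| <= B -> `|F x| <= C.
Proof.
move=> cF; apply: contrapT => no.
have ex k : exists x, `|x| <= B /\ (recip k)^-1 < `|F x|.
  apply: contrapT => nok; apply: no; exists (recip k)^-1.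
    by rewrite invr_gt0 recip_gt0.
  by move=> x xB; rewrite leNgt; apply/negP => h; apply: nok; exists x.
pose u k := sval (cid (ex k)).
have uP k : `|u k| <= B /\ (recip k)^-1 < `|F (u k)| by rewrite /u; case: cid.
have [l [lr lP]] := bounded_cluster (fun k => (uP k).1).
have /ccontinuousP/(_ _ ltr01)[d d0 dP] := cF l.
have Fl0 : 0 < (`|F l| + 1)^-1 by rewrite invr_gt0 ltr_wpDl.
have [N NP] := recip_lt Fl0.
have [k Nk uk] := lP d d0 N.
rewrite cdistC in uk; have h1 := dP _ uk.
have h2 := cnorm_sub (F (u k)) (F l); rewrite cdistC in h1.
have [_ h4] := uP k.
have h5 := NP k Nk.
rewrite -ltf_pV2 ?posrE ?recip_gt0// invrK in h5; lra.
Qed.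

(** The inf-convolution [inf_z (G z + L |y - z|)] of each component of [G] is
    [L]-Lipschitz.  With [L] large compared with the oscillation of [G], the
    points [z] far from [y] do not lower the infimum below [G y], and at the
    near ones [G z] is close to [G y]. *)
Lemma lipschitz_approximation n m (G : 'cV[R]_n -> 'cV[R]_m) B (e : R) :
  continuous G -> 0 <= B -> 0 < e -> exists2 P : 'cV[R]_n -> 'cV[R]_m,
    (exists2 L : R, 0 < L & forall x y, `|P x - P y| <= L * `|x - y|) &
    forall x, `|x| <= B -> `|P x - G x| <= e.
Proof.
move=> cG B0 e0.
have [C C0 GC] := bounded_ball_image B cG.
have [d d0 Gd] := uniformly_continuous_bounded B cG e0.
pose L := 2 * C / d; have L0 : 0 < L by rewrite /L divr_gt0//; lra.
have Ld : L * d = 2 * C by rewrite /L divfK// gt_eqF.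
(* the values whose infimum is the inf-convolution *)
pose S i y := [set G z i 0 + L * `|y - z| | z in [set z : 'cV[R]_n | `|z| <= B]].
have infS i y : has_inf (S i y).
  split.
    by exists (G 0 i 0 + L * `|y - 0|); exists 0 => //=; rewrite normr0.
  exists (- C) => _ [z /= zB <-].
  have h := le_trans (coord_le_norm _ i) (GC z zB).
  have : 0 <= L * `|y - z| by rewrite mulr_ge0// ltW.
  move: h; rewrite ler_norml => /andP[h _] *; lra.
pose P y := \col_i inf (S i y).
have Ple i y z : `|z| <= B -> P y i 0 <= G z i 0 + L * `|y - z|.
  by move=> zB; rewrite mxE; apply: ge_inf; [exact: (infS _ _).2|exists z].
have leP i y (t : R) : (forall z, `|z| <= B -> t <= G z i 0 + L * `|y - z|) -> t <= P y i 0.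
  move=> h; rewrite mxE; apply: lb_le_inf; first exact: (infS _ _).1.
  by move=> _ [z zB <-]; exact: h.
exists P.
  exists L => // x y; apply: norm_le_coord => [|i].
    by rewrite mulr_ge0// ltW.
  have half x' y' : P x' i 0 - L * `|x' - y'| <= P y' i 0.
    apply: leP => z zB; have h := Ple i x' z zB.
    have := cdist_triangle y' x' z => t.
    have : L * `|x' - z| <= L * (`|x' - y'| + `|y' - z|) by rewrite ler_pM2l.
    move=> *; lra.
  have h1 := half x y; have h2 := half y x; rewrite (cdistC y) in h2.
  rewrite !mxE in h1 h2 *; rewrite ler_norml; apply/andP; split; lra.
move=> x xB; apply: norm_le_coord => [|i]; first exact: ltW.
have h1 := Ple i x x xB; rewrite subrr normr0 mulr0 addr0 in h1.
have h2 : G x i 0 - e <= P x i 0.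
  apply: leP => z zB; have [xz|xz] := ltP `|x - z| d.
    have := le_lt_trans (coord_le_norm _ i) (Gd x z xB xz).
    rewrite !mxE ltr_norml => /andP[h3 h4].
    have : 0 <= L * `|x - z| by rewrite mulr_ge0// ltW.
    move=> *; lra.
  have : L * d <= L * `|x - z| by rewrite ler_pM2l.
  have := le_trans (coord_le_norm _ i) (GC x xB).
  have := le_trans (coord_le_norm _ i) (GC z zB).
  rewrite !ler_norml => /andP[? ?] /andP[? ?] ?; lra.
rewrite mxE [X in _ + X]mxE ler_norml; apply/andP; split; lra.
Qed.

(** Interpolate between [k] on the ball of radius 1/2 and the identity on the
    unit sphere; the zero given by the no-retraction theorem satisfies
    [|u| <= 1/2], where nothing was changed. *)
Lemma near_identity_zero n (k : 'cV[R]_n.+1 -> 'cV[R]_n.+1) :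
  continuous k -> (forall u, `|u| <= 1 -> `|k u - u| <= 1 / 2) ->
  exists2 u, `|u| <= 1 & k u = 0.
Proof.
move=> ck kid.
pose lam (u : 'cV[R]_n.+1) : R := Num.min 1 (2 * (1 - `|u|)).
pose g u := u + lam u *: (k u - u).
have clam : continuous lam.
  move=> u; apply: (@continuous_min _ _ (fun=> 1) (fun u : 'cV[R]_n.+1 => 2 * (1 - `|u|)) u).
    exact: cst_continuous.
  apply: continuousM; first exact: cst_continuous.
  by apply: continuousB; [exact: cst_continuous|exact: norm_continuous].
have cg : continuous g.
  move=> u; apply: (@ccontinuousD _ _ _ id (fun u => lam u *: (k u - u))); first exact: cvg_id.
  apply: (@ccontinuousZ _ _ _ lam (fun u => k u - u)); first exact: clam.
  by apply: (@ccontinuousB _ _ _ k id); [exact: ck|exact: cvg_id].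
have [|u u1 gu] := zero_of_identity_boundary cg.
  by move=> x x1; rewrite /g /lam x1 subrr mulr0 min_r ?ler01// scale0r addr0.
have lam0 : 0 <= lam u by rewrite le_min ler01/= mulr_ge0// subr_ge0.
have lam1 : lam u <= 1 by rewrite ge_min lexx.
have uE : `|u| = lam u * `|k u - u|.
  by move/eqP: gu; rewrite /g addr_eq0 => /eqP {1}->; rewrite normrN normrZ ger0_norm.
have u2 : `|u| <= 1 / 2.
  rewrite uE (le_trans _ (kid u u1))// ler_piMl//.
have lamE : lam u = 1 by rewrite /lam min_l//; lra.
by exists u => //; move: gu; rewrite /g lamE scale1r addrC subrK.
Qed.

End lipschitz_approximations.

Section sphere_images.
Context {R : realType}.

Lemma truncn_dist (s t : R) : 0 <= s -> 0 <= t -> Num.trunc s = Num.trunc t ->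
  `|s - t| < 1.
Proof.
move=> /truncn_itv/andP[s1 s2] /truncn_itv/andP[t1 t2] st.
rewrite st in s1 s2; rewrite -natr1 in s2 t2.
rewrite ltr_norml; apply/andP; split; lra.
Qed.

(** A sphere has dimension one less than the space, so its Lipschitz image
    has empty interior.  Pigeonhole: a cube of side [r / 2] contains [M ^ n.+1]
    grid points at mutual distance at least [r / (2 * M)].  If all of them had
    preimages on the sphere, these preimages would fall into
    [n.+1 * 2 * (N + 1) ^ n] boxes of side [2 * e / N] covering the faces of
    the sphere, and two points in the same box have images closer than the
    grid allows.  For [N] proportional to [M] and [M] large there are fewer
    boxes than points. *)
Lemma lipschitz_sphere_misses n (P : 'cV[R]_n.+1 -> 'cV[R]_n.+1) (L : R) c a (e : R) (r : R) :
  0 < L -> (forall x y, `|P x - P y| <= L * `|x - y|) -> 0 < e -> 0 < r ->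
  exists2 b, `|b - a| < r & forall y, `|y - c| = e -> P y <> b.
Proof.
move=> L0 PL e0 r0; apply: contrapT => no.
have {}no b : `|b - a| < r -> exists2 y, `|y - c| = e & P y = b.
  move=> br; apply: contrapT => nob; apply: no; exists b => // y ye Pb.
  by apply: nob; exists y.
pose s := (Num.trunc (4 * L * e / r)).+1.
have sP : 4 * L * e < s%:R * r.
  rewrite -ltr_pdivrMr//.
  by have /truncn_itv/andP[] : 0 <= 4 * L * e / r by rewrite divr_ge0 ?mulr_ge0// ltW.
pose M := (2 * n.+1 * (2 * s) ^ n).+1; pose N := (s * M)%N.
have M0 : 0 < M%:R :> R by rewrite ltr0n.
have N0 : 0 < N%:R :> R by rewrite ltr0n muln_gt0.
pose b (j : {ffun 'I_n.+1 -> 'I_M}) : 'cV[R]_n.+1 :=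
  a + \col_i (r / 2 * ((j i : nat)%:R / M%:R)).
have bP j : `|b j - a| < r.
  rewrite /b addrC addKr; apply: norm_lt_coord => // i; rewrite mxE.
  have h : (j i : nat)%:R / M%:R < 1 :> R by rewrite ltr_pdivrMr// mul1r ltr_nat.
  have h0 : 0 <= (j i : nat)%:R / M%:R :> R by rewrite divr_ge0.
  move: (_ / _) h h0 => t h h0; rewrite ger0_norm; nra.
have ex j : exists y, `|y - c| = e /\ P y = b j.
  by have [y ye Pb] := no _ (bP j); exists y.
pose y j := sval (cid (ex j)).
have yP j : `|y j - c| = e /\ P (y j) = b j by rewrite /y; case: cid.
have exf j : exists i, `|(y j - c) i 0| = e.
  by have [i E] := norm_attained (y j - c); exists i; rewrite -E (yP j).1.
pose f j := sval (cid (exf j)).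
have fP j : `|(y j - c) (f j) 0| = e by rewrite /f; case: cid.
pose t j i : R := ((y j - c) i 0 + e) / (2 * e) * N%:R.
have t0 j i : 0 <= t j i.
  have := coord_le_norm (y j - c) i; rewrite (yP j).1 ler_norml => /andP[h _].
  by rewrite /t !mulr_ge0 ?invr_ge0//; lra.
have tN j i : (Num.trunc (t j i) < N.+1)%N.
  rewrite ltnS truncn_le_nat.
  have := coord_le_norm (y j - c) i; rewrite (yP j).1 ler_norml => /andP[_ h].
  rewrite (@le_lt_trans _ _ N%:R)// ?ltr_nat//.
  by rewrite /t ler_piMl// ler_pdivrMr//; lra.
(* the face of the sphere, and the box in it, where the preimage of b j lies *)
pose code j : 'I_n.+1 * bool * {ffun 'I_n -> 'I_N.+1} :=
  (f j, 0 <= (y j - c) (f j) 0, [ffun k => Ordinal (tN j (lift (f j) k))]).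
have code_inj : injective code.
  move=> j j' [ff sgn /ffunP tt]; apply/eqP; apply: contraT => jj'.
  have yy : `|y j - y j'| < 2 * e / N%:R.
    apply: norm_lt_coord => [|i]; first by rewrite divr_gt0// mulr_gt0.
    rewrite (_ : _ i 0 = (y j - c) i 0 - (y j' - c) i 0); last first.
      by rewrite !mxE; ring.
    have [->|ifj] := eqVneq i (f j).
      have h1 := fP j; have h2 := fP j'; rewrite -ff in h2 sgn.
      have -> : (y j - c) (f j) 0 - (y j' - c) (f j) 0 = 0.
        move: sgn h1 h2; case: (lerP 0) => h; case: (lerP 0) => h' // _.
          by rewrite !ger0_norm// => -> ->; rewrite subrr.
        by rewrite !ltr0_norm// => h1 h2; apply/eqP; rewrite subr_eq0 -eqr_opp h1 h2.
      by rewrite normr0 divr_gt0// mulr_gt0.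
    have [k E|E] := unliftP (f j) i; last by rewrite E eqxx in ifj.
    have := tt k; rewrite !ffunE => -[]; rewrite -ff -E => /truncn_dist.
    move=> /(_ (t0 _ _) (t0 _ _)).
    rewrite /t -mulrBl -mulrBl opprD addrACA subrr addr0 !normrM.
    rewrite [`|N%:R|]ger0_norm ?ltW// [`|(2 * e)^-1|]gtr0_norm; last first.
      by rewrite invr_gt0 mulr_gt0.
    by rewrite -ltr_pdivlMr// mul1r ltr_pdivrMr ?mulr_gt0// mulrC.
  have {}yy : `|b j - b j'| < L * (2 * e / N%:R).
    rewrite -(yP j).2 -(yP j').2; apply: le_lt_trans (PL _ _) _.
    by rewrite ltr_pM2l.
  have /existsP[i ji] : [exists i, j i != j' i].
    apply: contraNT jj' => /existsPn h; apply/eqP/ffunP => i.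
    by apply/eqP; rewrite -[_ == _]negbK h.
  have := le_lt_trans (coord_le_norm _ i) yy.
  rewrite /b opprD addrACA subrr add0r !mxE -mulrBr -mulrBl !normrM.
  rewrite (ger0_norm (_ : 0 <= r)) ?ltW// !normfV.
  rewrite [`|2|]ger0_norm// [`|M%:R|]ger0_norm ?ltW//.
  have d1 : 1 <= `|(j i : nat)%:R - (j' i : nat)%:R| :> R.
    move: ji; rewrite -val_eqE/= neq_ltn => /orP[] h.
      rewrite distrC; have : (j i : nat)%:R + 1 <= (j' i : nat)%:R :> R by rewrite natr1 ler_nat.
      by rewrite ler_normr => *; apply/orP; left; lra.
    have : (j' i : nat)%:R + 1 <= (j i : nat)%:R :> R by rewrite natr1 ler_nat.
    by rewrite ler_normr => *; apply/orP; left; lra.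
  rewrite /N natrM invfM.
  have V0 : 0 < M%:R^-1 :> R by rewrite invr_gt0.
  have s0 : 0 < s%:R :> R by rewrite ltr0n.
  move=> yy'; exfalso; move: yy'; apply/negP; rewrite -leNgt.
  move: (`|_ - _|) d1 => q q1; rewrite !mulrA ler_pM2r//.
  rewrite ler_pdivrMr// ?ltr0n//.
  have s1 : 0 <= s%:R * r * (q - 1) by rewrite !mulr_ge0// ?subr_ge0// ltW.
  move: sP s1; move: (s%:R) => s' *; lra.
have := leq_card code code_inj.
rewrite !card_prod !card_ffun !card_ord card_bool /N.
(* the number of boxes is of order M ^ n with a constant that M exceeds by its definition *)
suff : (n.+1 * 2 * (s * M).+1 ^ n < M ^ n.+1)%N by lia.
have s1 : ((s * M).+1 ^ n <= (2 * s) ^ n * M ^ n)%N.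
  have [->|n0] := posnP n; first by rewrite !expn0.
  rewrite -expnMn leq_exp2r//; rewrite /M /s; lia.
have M1 : (0 < M ^ n)%N by rewrite expn_gt0.
have -> : (M ^ n.+1 = M ^ n + 2 * n.+1 * (2 * s) ^ n * M ^ n)%N by rewrite expnS mulSn.
rewrite -addn1 addnC leq_add//.
by rewrite (leq_trans (leq_mul (leqnn (n.+1 * 2)) s1))// mulnA (mulnC n.+1).
Qed.

End sphere_images.

Section inverse_extensions.
Context {R : realType}.

Section inverse.
Context {n m : nat} (F : 'cV[R]_n -> 'cV[R]_m) (a : 'cV[R]_n) (r : R).
Hypothesis cF : continuous F.
Hypothesis Finj : forall x x', `|x - a| <= r -> `|x' - a| <= r -> F x = F x' -> x = x'.

(** Compactness: points of the ball that stay away from [x] have images that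
    stay away from [F x]. *)
Lemma inverse_continuous_on_ball x e : `|x - a| <= r -> 0 < e ->
  exists2 d : R, 0 < d & forall x', `|x' - a| <= r -> `|F x - F x'| < d -> `|x - x'| < e.
Proof.
move=> xr e0; apply: contrapT => no.
pose S := [set x' | `|x' - a| <= r] `&` [set x' | e <= `|x - x'|].
have [|l Sl||z [/= zr xz] Fz] := @attained _ _ _ F S (r + `|a|) (F x) cF.
- by move=> z [/= /cnorm_le_dist].
- split; [apply: approximable_ball|apply: approximable_far]; apply: approximableS Sl.
    by move=> ? [].
  by move=> ? [].
- move=> d d0; apply: contrapT => nod; apply: no; exists d => // x' x'r Fx'.
  rewrite ltNge; apply/negP => ex'; apply: nod; exists (F x') => //; exists x' => //.
have := Finj xr zr (esym Fz) => E; rewrite E subrr normr0 in xz; lra.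
Qed.

(** The inverse is continuous on the compact image of the ball; Tietze's
    theorem extends each of its components. *)
Lemma exists_inverse_extension :
  exists2 G : 'cV[R]_m -> 'cV[R]_n, continuous G & forall x, `|x - a| <= r -> G (F x) = x.
Proof.
pose K := [set F x | x in [set x | `|x - a| <= r]].
pose inv y := if pselect (exists2 x, `|x - a| <= r & F x = y) is left h then s2val (cid2 h) else 0.
have invF x : `|x - a| <= r -> inv (F x) = x.
  move=> xr; rewrite /inv; case: pselect => [h|[]]; last by exists x.
  by case: cid2 => /= x' x'r /(Finj x'r xr).
have clK : closed K.
  move=> y /= clKy.
  have [|||z zr <-] := @attained _ _ _ F [set x | `|x - a| <= r] (r + `|a|) y cF.
  - by move=> z /cnorm_le_dist.
  - by move=> l; exact: approximable_ball.
  - move=> d d0; have [z [Kz yz]] := clKy (ball y d) (nbhsx_ballx _ _ d0).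
    by exists z => //; apply/cballP.
  - by exists z.
have extG i : exists g : 'cV[R]_m -> R, continuous g /\ forall x, `|x - a| <= r -> g (F x) = x i 0.
  have C0 : 0 < `|r| + `|a| + 1 by rewrite ltr_wpDl// addr_ge0.
  have [| |g [gE cg _]] := @continuous_bounded_extension _ _ (@pseudometric_normal R 'cV[R]_m) K clK (fun y => inv y i 0) _ C0.
  - apply/subspace_continuousP => _ [x /= xr <-].
    apply/cvgrPdist_lt => e e0; rewrite near_withinE.
    have [d d0 dP] := inverse_continuous_on_ball xr e0.
    apply/cnbhsP; exists d => // y Fxy [x' /= x'r yE].
    rewrite -yE in Fxy *; rewrite /from_subspace !invF//; move: Fxy => /(dP _ x'r) => /(le_lt_trans (coord_le_norm _ i)).
    by rewrite !mxE.
  - move=> _ [x /= xr <-]; rewrite invF// (le_trans (coord_le_norm _ _))//.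
    have := cnorm_le_dist xr; have := ler_norm r => *; lra.
  - exists g; split=> // x xr; rewrite -gE ?invF// inE; by exists x.
pose g i := sval (cid (extG i)).
have gP i : continuous (g i) /\ forall x, `|x - a| <= r -> g i (F x) = x i 0.
  by rewrite /g; case: cid.
exists (fun y => \col_i g i y).
  move=> y; apply: ccontinuous_coord => i.
  rewrite (_ : (fun _ => _) = g i); last by apply/funext => z; rewrite mxE.
  exact: (gP i).1.
move=> x xr; apply/colP => i; rewrite mxE; exact: (gP i).2.
Qed.

End inverse.

(** The radial retraction onto the complement of the open ball of radius
    [e] around [c]; it fixes that complement and sends every point of the ball
    other than [c] to the sphere. *)
Definition push_out n (c : 'cV[R]_n) (e : R) (y : 'cV[R]_n) : 'cV[R]_n :=
  c + Num.max 1 (e / `|y - c|) *: (y - c).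

Lemma push_out_id n (c : 'cV[R]_n) e y : 0 < e -> e <= `|y - c| -> push_out c e y = y.
Proof.
move=> e0 ey; rewrite /push_out max_l; first by rewrite scale1r addrC subrK.
have y0 : 0 < `|y - c| := lt_le_trans e0 ey.
by rewrite ler_pdivrMr// mul1r.
Qed.

Lemma push_out_sphere n (c : 'cV[R]_n) e y : y <> c -> 0 < e -> `|y - c| <= e ->
  `|push_out c e y - c| = e.
Proof.
move=> yc e0 ye; have yc0 : 0 < `|y - c| by rewrite normr_gt0 subr_eq0; exact/eqP.
rewrite /push_out addrC addKr normrZ max_r; last by rewrite ler_pdivlMr// mul1r.
by rewrite ger0_norm ?divfK ?divr_ge0 ?ltW// gt_eqF.
Qed.

Lemma push_out_continuous n (c : 'cV[R]_n) (e : R) y :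
  y <> c -> {for y, continuous (push_out c e)}.
Proof.
move=> yc; have yc0 : `|y - c| != 0 by rewrite normr_eq0 subr_eq0; exact/eqP.
apply: (@ccontinuousD _ _ _ (fun=> c)); first exact: cst_continuous.
have cyc : {for y, continuous (fun y : 'cV[R]_n => y - c)}.
  by apply: (@ccontinuousB _ _ _ id (fun=> c)); [exact: cvg_id|exact: cst_continuous].
apply: ccontinuousZ => //.
apply: (@continuous_max _ _ (fun=> 1) (fun y : 'cV[R]_n => e / `|y - c|) y).
  exact: cst_continuous.
apply: continuousM; first exact: cst_continuous.
by apply: continuousV => //; exact: ccontinuous_norm.
Qed.

Definition clamp n (u : 'cV[R]_n) : 'cV[R]_n :=
  \col_i Num.max (-1) (Num.min 1 (u i 0)).

Lemma clamp_le1 n (u : 'cV[R]_n) : `|clamp u| <= 1.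
Proof.
apply: norm_le_coord => // i; rewrite mxE ler_norml le_max lexx/= ge_max ge_min lexx.
by rewrite andbT; lra.
Qed.

Lemma clamp_id n (u : 'cV[R]_n) : `|u| <= 1 -> clamp u = u.
Proof.
move=> u1; apply/colP => i; rewrite mxE.
have := le_trans (coord_le_norm u i) u1; rewrite ler_norml => /andP[h1 h2].
by rewrite min_r// max_r.
Qed.

Lemma clamp_continuous n : continuous (@clamp n).
Proof.
move=> u; apply: ccontinuous_coord => i.
rewrite (_ : (fun _ => _) = fun u : 'cV[R]_n => Num.max (-1) (Num.min 1 (u i 0))); last first.
  by apply/funext => z; rewrite mxE.
apply: (@continuous_max _ _ (fun=> -1) (fun u : 'cV[R]_n => Num.min 1 (u i 0))).
  exact: cst_continuous.
apply: (@continuous_min _ _ (fun=> 1) (fun u : 'cV[R]_n => u i 0)).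
  exact: cst_continuous.
exact: coord_continuous.
Qed.

(** [f] need only be continuous on the ball, so it is precomposed with a
    retraction onto the ball before the zero of a near-identity map is
    taken. *)
Lemma perturbed_identity_onto n (f : 'cV[R]_n.+1 -> 'cV[R]_n.+1) a b (r : R) :
  0 < r -> (forall x, `|x - a| <= r -> {for x, continuous f}) ->
  (forall x, `|x - a| <= r -> `|f x - x| + `|b - a| <= r / 2) ->
  exists2 x, `|x - a| <= r & f x = b.
Proof.
move=> r0 cf fid.
pose q (u : 'cV[R]_n.+1) := a + r *: clamp u.
have qr u : `|q u - a| <= r.
  rewrite /q addrC addKr normrZ gtr0_norm// ler_piMr ?clamp_le1//.
  exact: ltW.
have cq u : {for u, continuous q}.
  apply: (@ccontinuousD _ _ _ (fun=> a)); first exact: cst_continuous.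
  apply: (@ccontinuousZ _ _ _ (fun=> r) (@clamp _)); first exact: cst_continuous.
  exact: clamp_continuous.
pose k u := r^-1 *: (f (q u) - b).
have ck : continuous k.
  move=> u; apply: (@ccontinuousZ _ _ _ (fun=> r^-1) (fun u => f (q u) - b)); first exact: cst_continuous.
  apply: (@ccontinuousB _ _ _ (f \o q) (fun=> b)); last exact: cst_continuous.
  by apply: continuous_comp; [exact: cq|exact: cf].
have [u u1|u u1 ku] := near_identity_zero ck.
  have ar : a + r *: u = q u by rewrite /q clamp_id.
  rewrite (_ : k u - u = r^-1 *: ((f (q u) - q u) - (b - a))); last first.
    have -> : f (q u) - q u - (b - a) = (f (q u) - b) - r *: u.
      by rewrite -{2}ar; apply/colP => i; rewrite !mxE; ring.
    by rewrite scalerBr scalerA mulVf ?gt_eqF// scale1r.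
  rewrite normrZ gtr0_norm ?invr_gt0// mulrC ler_pdivrMr//.
  have h := fid (q u) (qr u).
  have := ler_normB (f (q u) - q u) (b - a).
  move=> h'; apply: le_trans h' _; lra.
exists (q u) => //; apply/eqP; rewrite -subr_eq0.
by move/eqP: ku; rewrite /k scaler_eq0 invr_eq0 gt_eqF.
Qed.
End inverse_extensions.

Section domain_invariance.
Context {R : realType}.

(** Suppose that values [c] arbitrarily close to [F a] are not in the image
    of the ball.  Let [P] be a Lipschitz approximation of a continuous
    extension [G] of the inverse of [F].  Pushing [F x] out of a small ball
    around [c] is possible continuously since [F x <> c], and moves the value
    little; hence [x |-> P (push_out c e (F x))] is close to the identity and
    reaches every point [b] near [a].  But [b] can be chosen off the image
    under [P] of the sphere around [c].  So [b] is [P (F x)] with [F x] outside the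
    ball around [c], thus far from [F a]; then [x], and with it [P (F x)], is
    too far from [a] to be [b]. *)
Theorem invariance_of_domain n (F : 'cV[R]_n.+1 -> 'cV[R]_n.+1) a (r : R) :
  continuous F -> 0 < r ->
  (forall x x', `|x - a| <= r -> `|x' - a| <= r -> F x = F x' -> x = x') ->
  exists2 e : R, 0 < e & forall z, `|F a - z| < e -> exists2 x, `|x - a| <= r & F x = z.
Proof.
move=> cF r0 Finj; apply: contrapT => no.
have {}no e : 0 < e -> exists2 c, `|F a - c| < e & forall x, `|x - a| <= r -> F x <> c.
  move=> e0; apply: contrapT => noc; apply: no; exists e => // z zF.
  apply: contrapT => nox; apply: noc; exists z => // x xr Fx.
  by apply: nox; exists x.
have [G cG GF] := exists_inverse_extension cF Finj.
have GFa : G (F a) = a by apply: GF; rewrite subrr normr0 ltW.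
have r8 : 0 < r / 8 by lra.
have /ccontinuousP/(_ _ r8)[d d0 dP] := cG (F a); rewrite GFa in dP.
(* e keeps the pushed values within the modulus of continuity d of G at F a *)
pose e := d / 3; have e0 : 0 < e by rewrite /e; lra.
have [c ce Fc] := no e e0.
have ec0 : 0 < e - `|F a - c| by lra.
have /ccontinuousP/(_ _ ec0)[m m0 mP] := cF a.
have [C C0 FC] := bounded_ball_image (r + `|a|) cF.
(* a bound for all values of F and all pushed values, where P approximates G *)
pose B := C + `|c| + e.
have B0 : 0 <= B by rewrite /B; have := normr_ge0 c => *; lra.
pose eta := Num.min (m / 4) (r / 8).
have eta0 : 0 < eta by rewrite lt_min r8 andbT; lra.
have etam : eta <= m / 4 by rewrite ge_min lexx.
have etar : eta <= r / 8 by rewrite ge_min lexx orbT.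
have [P [L L0 PL] PG] := lipschitz_approximation cG B0 eta0.
(* m is the modulus within which F stays close to F a; b is chosen within s of a *)
pose s := Num.min (m / 2) (r / 8).
have s0 : 0 < s by rewrite lt_min r8 andbT; lra.
have sm : s <= m / 2 by rewrite ge_min lexx.
have sr : s <= r / 8 by rewrite ge_min lexx orbT.
have [b ba bP] := lipschitz_sphere_misses c a L0 PL e0 s0.
have FxB x : `|x - a| <= r -> `|F x| <= B.
  move=> /cnorm_le_dist/FC; rewrite /B; have := normr_ge0 c => *; lra.
(* values outside the ball around c: P inverts F, and x is far from a *)
have far x : `|x - a| <= r -> e <= `|F x - c| -> `|P (F x) - x| <= eta /\ m <= `|a - x|.
  move=> xr ex; split; first by rewrite -{2}(GF x xr); apply: PG; exact: FxB.
  rewrite leNgt; apply/negP => /mP h.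
  have := cdist_triangle (F a) (F x) c; rewrite (cdistC (F x) (F a)) => *; lra.
(* values inside the ball around c are moved to its sphere, all near F a *)
have close x : `|x - a| <= r -> `|F x - c| <= e ->
    `|P (push_out c e (F x)) - x| <= 3 * (r / 8) /\ P (push_out c e (F x)) <> b.
  move=> xr xe; have Fxc := Fc x xr.
  have se := push_out_sphere Fxc e0 xe; split; last exact: bP.
  have yB : `|push_out c e (F x)| <= B.
    have := cnorm_sub (push_out c e (F x)) c; rewrite se /B => *; lra.
  have h1 := PG _ yB; set y := push_out _ _ _ in se yB h1 *.
  have h2 : `|a - G y| < r / 8.
    apply: dP; have := cdist_triangle c (F a) y; rewrite (cdistC c y) se /e in ce *.
    move=> *; lra.
  have h3 : `|a - x| < r / 8.
    rewrite -(GF x xr); apply: dP; have := cdist_triangle c (F a) (F x).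
    rewrite (cdistC c (F x)) /e in ce xe * => *; lra.
  have h4 := cdist_triangle (G y) (P y) x.
  have h5 := cdist_triangle a (G y) x; rewrite (cdistC (G y) a) in h5; lra.
have [| |x xr] := @perturbed_identity_onto _ _ (fun x => P (push_out c e (F x))) a b r r0.
- move=> x xr; apply: (@continuous_comp _ _ _ F (fun y => P (push_out c e y))).
    exact: cF.
  apply: (@continuous_comp _ _ _ (push_out c e) P).
    by apply: push_out_continuous; exact: Fc.
  apply/ccontinuousP => e1 e10; exists (e1 / L) => [|y xy]; first exact: divr_gt0.
  by apply: le_lt_trans (PL _ _) _; rewrite mulrC -ltr_pdivlMr.
- move=> x xr /=; have [xe|ex] := leP `|F x - c| e.
    have [h _] := close x xr xe; lra.
  have [h _] := far x xr (ltW ex); rewrite push_out_id ?ltW//; lra.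
- have [xe|ex] := leP `|F x - c| e; first by have [_] := close x xr xe.
  have [h1 h2] := far x xr (ltW ex); rewrite push_out_id ?ltW// => h3.
  rewrite h3 in h1; have := cdist_triangle b a x; rewrite (cdistC a b) => *; lra.
Qed.

End domain_invariance.

(** * Coercive local homeomorphisms *)

Section global_homeomorphism.
Context {R : realType} {n : nat} (F : 'cV[R]_n.+1 -> 'cV[R]_n.+1).
Hypothesis cF : continuous F.
Hypothesis Floc : locally_injective F.

(** On a bounded set the radius of injectivity is bounded from below. *)
Lemma uniformly_locally_injective rho : exists2 d : R, 0 < d &
  forall x x', `|x| <= rho -> `|x - x'| < d -> F x = F x' -> x = x'.
Proof.
apply: contrapT => no.
have ex k : exists xx : 'cV[R]_n.+1 * 'cV[R]_n.+1, [/\ `|xx.1| <= rho,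
    `|xx.1 - xx.2| < recip k, F xx.1 = F xx.2 & xx.1 <> xx.2].
  apply: contrapT => nok; apply: no; exists (recip k); first exact: recip_gt0.
  move=> x x' xr xx' Fx; apply: contrapT => nx; apply: nok; by exists (x, x').
pose u k := sval (cid (ex k)).
have uP k : [/\ `|(u k).1| <= rho, `|(u k).1 - (u k).2| < recip k,
  F (u k).1 = F (u k).2 & (u k).1 <> (u k).2] by rewrite /u; case: cid.
have ur k : `|(u k).1| <= rho by case: (uP k).
have [l [_ lP]] := bounded_cluster ur.
have [V /cnbhsP[e e0 eV] Vinj] := Floc l.
have e20 : 0 < e / 2 by lra.
have [N NP] := recip_lt e20.
have [k Nk uk] := lP _ e20 N; rewrite cdistC in uk.
have [_ u12 Fu]:= uP k; apply; apply: Vinj => //; rewrite inE; apply: eV; first by lra.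
have := cdist_triangle (u k).1 l (u k).2; have := NP k Nk => *; lra.
Qed.

(** On a bounded set the radius up to which points have nearby preimages is
    bounded from below, by invariance of domain and compactness. *)
Lemma uniformly_open rho (d : R) : 0 < d -> exists2 e : R, 0 < e &
  forall x z, `|x| <= rho -> `|F x - z| < e -> exists2 x', `|x - x'| < d & F x' = z.
Proof.
move=> d0; apply: contrapT => no.
have ex k : exists xz : 'cV[R]_n.+1 * 'cV[R]_n.+1, [/\ `|xz.1| <= rho,
    `|F xz.1 - xz.2| < recip k & forall x', `|xz.1 - x'| < d -> F x' <> xz.2].
  apply: contrapT => nok; apply: no; exists (recip k); first exact: recip_gt0.
  move=> x z xr xz; apply: contrapT => nx; apply: nok; exists (x, z).
  by split=> // x' xx' Fx'; apply: nx; exists x'.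
pose u k := sval (cid (ex k)).
have uP k : [/\ `|(u k).1| <= rho, `|F (u k).1 - (u k).2| < recip k
  & forall x', `|(u k).1 - x'| < d -> F x' <> (u k).2] by rewrite /u; case: cid.
have ur k : `|(u k).1| <= rho by case: (uP k).
have [l [_ lP]] := bounded_cluster ur.
have [V /cnbhsP[e e0 eV] Vinj] := Floc l.
pose r := Num.min (e / 2) (d / 2).
have r0 : 0 < r by rewrite lt_min; apply/andP; split; lra.
have re : r <= e / 2 by rewrite ge_min lexx.
have rd : r <= d / 2 by rewrite ge_min lexx orbT.
have [|e1 e10 e1P] := invariance_of_domain (a := l) cF r0.
  move=> x x' xr x'r; rewrite cdistC in xr; rewrite cdistC in x'r.
  by apply: Vinj; rewrite inE; apply: eV; lra.
have e120 : 0 < e1 / 2 by lra.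
have /ccontinuousP/(_ _ e120)[d1 d10 d1P] := @cF l.
have [N NP] := recip_lt e120.
have m0 : 0 < Num.min d1 (d / 2) by rewrite lt_min d10; lra.
have [k Nk] := lP _ m0 N; rewrite cdistC lt_min => /andP[uk1 uk2].
have [_ Fu] := uP k.
have [|x' x'l Fx'] := e1P (u k).2.
  have := cdist_triangle (F (u k).1) (F l) (u k).2.
  have := d1P _ uk1; have := NP k Nk => *; lra.
move=> /(_ x'); apply => //.
rewrite cdistC in uk2; rewrite cdistC in x'l.
have := cdist_triangle l (u k).1 x' => *; lra.
Qed.

Hypothesis Fcoercive : exists A B : R, 0 <= B /\ forall x, `|x| <= A + B * `|F x|.

Lemma bounded_preimages (Z : R) : exists rho, forall x, `|F x| <= Z -> `|x| <= rho.
Proof.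
have [A [B [B0 AB]]] := Fcoercive; exists (A + B * Z) => x xZ.
by rewrite (le_trans (AB x))// lerD2l ler_wpM2l.
Qed.

Lemma convex_norm (x y : 'cV[R]_n.+1) (t : R) : 0 <= t <= 1 ->
  `|(1 - t) *: x + t *: y| <= `|x| + `|y|.
Proof.
move=> /andP[t0 t1]; rewrite (le_trans (ler_normD _ _))// !normrZ.
rewrite !ger0_norm ?subr_ge0//; apply: lerD; first by rewrite ler_piMl//; lra.
by rewrite ler_piMl.
Qed.

Lemma recip_frac N k : (k <= N.+1)%N -> 0 <= k%:R * @recip R N <= 1.
Proof.
move=> kN; rewrite mulr_ge0//=; last exact/ltW/recip_gt0.
rewrite /recip ler_pdivrMr ?ltr0n//.
by rewrite mul1r ler_nat.
Qed.

Lemma recip_full N : N.+1%:R * @recip R N = 1.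
Proof. by rewrite /recip divff// pnatr_eq0. Qed.

(** Lift the segment from [F 0] to [z] in small steps: along the segment the
    values are bounded, so by coercivity the lifted points stay in a bounded
    set, on which the admissible step is uniform. *)
Lemma coercive_onto z : exists x, F x = z.
Proof.
have [rho rhoP] := bounded_preimages (`|F 0| + `|z|).
have [e e0 eP] := uniformly_open rho ltr01.
have D0 : 0 < `|F 0 - z| + 1 by rewrite ltr_wpDl.
have eD : 0 < e / (`|F 0 - z| + 1) by rewrite divr_gt0.
have [N /(_ N (leqnn N)) Ne] := recip_lt eD; have w0 := @recip_gt0 R N.
rewrite ltr_pdivlMr// in Ne.
pose t k := k%:R * @recip R N.
have tS k : t k.+1 = t k + recip N by rewrite /t -natr1 mulrDl mul1r.
suff lift k : (k <= N.+1)%N -> exists x, F x = (1 - t k) *: F 0 + t k *: z.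
  have [//|x] := lift N.+1; rewrite /t recip_full subrr scale0r add0r scale1r.
  by exists x.
elim: k => [_|k IH kN]; first by exists 0; rewrite /t mul0r subr0 scale0r addr0 scale1r.
have [x Fx] := IH (ltnW kN).
have xr : `|x| <= rho.
  by apply: rhoP; rewrite Fx; apply: convex_norm; apply: recip_frac; exact: ltnW.
have [|x' _ Fx'] := eP x ((1 - t k.+1) *: F 0 + t k.+1 *: z) xr; last by exists x'.
rewrite Fx tS.
have -> : (1 - t k) *: F 0 + t k *: z - ((1 - (t k + recip N)) *: F 0 + (t k + recip N) *: z)
   = recip N *: (F 0 - z) by apply/colP => i; rewrite !mxE; ring.
rewrite normrZ gtr0_norm//; have := normr_ge0 (F 0 - z) => *; lra.
Qed.

(** If [F a = F b], the image under [F] of the segment from [a] to [b] is a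
    loop, contracted to [F a] by the linear homotopy [H].  The segment is a
    lift of the loop; lifting the homotopy row by row on a fine grid keeps the
    end points [a] and [b], and the last row lifts a constant, so it is itself
    constant by local injectivity. *)
Lemma coercive_injective : injective F.
Proof.
move=> a b Fab.
have [C C0 FC] := bounded_ball_image (`|a| + `|b|) cF.
have [rho rhoP] := bounded_preimages (C + `|F a|).
have [d d0 dP] := uniformly_locally_injective rho.
have d40 : 0 < d / 4 by lra.
have [e e0 eP] := uniformly_open rho d40.
have [d1 d10 d1P] := uniformly_continuous_bounded (`|a| + `|b|) cF e0.
have D0 : 0 < `|a - b| + C + `|F a| + 1.
  by have := normr_ge0 (a - b); have := normr_ge0 (F a) => *; lra.
pose q := Num.min e (Num.min (d / 4) d1) / (`|a - b| + C + `|F a| + 1).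
have q0 : 0 < q by rewrite divr_gt0// !lt_min e0 d40 d10.
have [N /(_ N (leqnn N))] := recip_lt q0; have w0 := @recip_gt0 R N.
rewrite ltr_pdivlMr// !lt_min => /and3P[we wd wd1].
set w := recip N in w0 we wd wd1.
pose t k : R := k%:R * w.
have tS k : t k.+1 = t k + w by rewrite /t -natr1 mulrDl mul1r.
have t01 k : (k <= N.+1)%N -> 0 <= t k <= 1 by exact: recip_frac.
pose gam j := (1 - t j) *: a + t j *: b.
have gamab j : (j <= N.+1)%N -> `|gam j| <= `|a| + `|b| by move=> /t01; exact: convex_norm.
have gamS j : `|gam j - gam j.+1| = w * `|a - b|.
  rewrite -(gtr0_norm w0) -normrZ; congr `|_|.
  by rewrite /gam tS; apply/colP => i; rewrite !mxE; ring.
have wab : w * `|a - b| <= w * (`|a - b| + C + `|F a| + 1).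
  by rewrite ler_pM2l//; have := normr_ge0 (F a) => *; lra.
pose H i j := (1 - t i) *: F (gam j) + t i *: F a.
have Hbd i j : (i <= N.+1)%N -> (j <= N.+1)%N -> `|H i j| <= C + `|F a|.
  move=> iN jN; apply: le_trans (convex_norm _ _ (t01 _ iN)) _.
  by rewrite lerD2r; apply: FC; exact: gamab.
have HSi i j : (j <= N.+1)%N -> `|H i j - H i.+1 j| < e.
  move=> jN; have -> : H i j - H i.+1 j = w *: (F (gam j) - F a).
    by rewrite /H tS; apply/colP => k; rewrite !mxE; ring.
  rewrite normrZ gtr0_norm//; apply: le_lt_trans we; rewrite ler_pM2l//.
  apply: le_trans (ler_normB _ _) _; have := FC _ (gamab _ jN).
  by have := normr_ge0 (a - b) => *; lra.
have HSj i j : (i <= N.+1)%N -> (j < N.+1)%N -> `|H i j - H i j.+1| < e.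
  move=> /t01/andP[i0 i1] jN.
  have -> : H i j - H i j.+1 = (1 - t i) *: (F (gam j) - F (gam j.+1)).
    by apply/colP => k; rewrite !mxE; ring.
  rewrite normrZ ger0_norm ?subr_ge0//.
  have : `|F (gam j) - F (gam j.+1)| < e.
    by apply: d1P; [exact: gamab (ltnW jN)|rewrite gamS; lra].
  have := normr_ge0 (F (gam j) - F (gam j.+1)).
  by move: `|_| => v *; nra.
have t0 : t 0%N = 0 by rewrite /t mul0r.
have tN : t N.+1 = 1 by exact: recip_full.
have H0 i : H i 0%N = F a.
  by rewrite /H /gam t0 subr0 scale1r scale0r addr0 -scalerDl subrK scale1r.
have HN i : H i N.+1 = F a.
  by rewrite /H /gam tN subrr scale1r scale0r add0r -Fab -scalerDl subrK scale1r.
have H1 j : H N.+1 j = F a by rewrite /H tN subrr scale1r scale0r add0r.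
(* row i of the grid: a lift of H i with small steps and fixed end points *)
suff lift i : (i <= N.+1)%N -> exists L : nat -> 'cV[R]_n.+1,
    [/\ forall j, (j <= N.+1)%N -> F (L j) = H i j,
        forall j, (j < N.+1)%N -> `|L j - L j.+1| < d / 4, L 0%N = a & L N.+1 = b].
  have [//|L [FL Ld L0 LN]] := lift N.+1.
  suff Lj j : (j <= N.+1)%N -> L j = a by rewrite -LN Lj.
  elim: j => [//|j IH jN]; rewrite -(IH (ltnW jN)); apply/esym; apply: dP.
  - by apply: rhoP; rewrite FL 1?ltnW// Hbd// ltnW.
  - by have := Ld j jN => *; lra.
  - by rewrite !FL// ?H1// ltnW.
elim: i => [_|i IH iN].
  exists gam; split.
  - by move=> j jN; rewrite /H t0 subr0 scale1r scale0r addr0.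
  - move=> j jN; rewrite gamS; lra.
  - by rewrite /gam t0 subr0 scale1r scale0r addr0.
  - by rewrite /gam tN subrr scale1r scale0r add0r.
have [L [FL Ld L0 LN]] := IH (ltnW iN).
have rhoH x j : (j <= N.+1)%N -> F x = H i.+1 j -> `|x| <= rho.
  by move=> jN Fx; apply: rhoP; rewrite Fx Hbd.
have ex j : exists x, (j <= N.+1)%N -> `|L j - x| < d / 4 /\ F x = H i.+1 j.
  have [jN|_] := leqP j N.+1; last by exists 0.
  have [||x Lx Fx] := eP (L j) (H i.+1 j); last by exists x.
    by apply: rhoP; rewrite FL// Hbd// ltnW.
  by rewrite FL// HSi.
pose L' j := sval (cid (ex j)).
have L'P j : (j <= N.+1)%N -> `|L j - L' j| < d / 4 /\ F (L' j) = H i.+1 j.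
  by rewrite /L'; case: cid.
exists L'; split.
- by move=> j /L'P[].
- move=> j jN; have [h1 F1] := L'P j (ltnW jN); have [h2 F2] := L'P j.+1 jN.
  have [||w' w'd Fw'] := eP (L' j) (H i.+1 j.+1).
  + exact: rhoH (ltnW jN) F1.
  + by rewrite F1 HSj.
  (* both are preimages of the same value near L' j, so they coincide *)
  suff <- : w' = L' j.+1 by [].
  apply: dP; [exact: rhoH jN Fw'| |by rewrite Fw' F2].
  have := Ld j jN.
  have := cdist_triangle (L' j) w' (L' j.+1); have := cdist_triangle (L j) (L' j) (L' j.+1).
  have := cdist_triangle (L j.+1) (L j) (L' j.+1).
  rewrite (cdistC w' (L' j)) (cdistC (L' j) (L j)) => *; lra.
- have [h1 F1] := L'P 0%N isT; apply/esym; apply: dP.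
  + by apply: rhoP; rewrite lerDr ltW.
  + by rewrite -{1}L0; lra.
  + by rewrite F1 H0.
- have [h1 F1] := L'P N.+1 (leqnn _); apply/esym; apply: dP.
  + by apply: rhoP; rewrite -Fab lerDr ltW.
  + by rewrite -{1}LN; lra.
  + by rewrite F1 HN.
Qed.

End global_homeomorphism.

(** * Lebesgue integrals over intervals *)

Section lebesgue_measure_on_R.
Context {R : realType}.
Local Notation mu := (@completed_lebesgue_measure R).
Local Notation lebR := (caratheodory_type (@wlength R idfun)^*%mu).

Lemma borel_measurable (A : set R) : measurable A -> measurable (A : set lebR).
Proof. exact: sub_caratheodory. Qed.

Lemma completed_borelE (A : set R) : measurable A -> mu A = lebesgue_measure A.
Proof. by []. Qed.

Lemma measurable_itvL (i : interval R) : measurable ([set` i] : set lebR).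
Proof. by apply: borel_measurable; exact: measurable_itv. Qed.

Lemma mu_itv (a b : R) : a <= b -> mu `]a, b] = (b - a)%:E.
Proof.
move=> ab; rewrite completed_borelE// lebesgue_measure_itv/= lte_fin.
case: ltP => // ba; have -> : a = b by apply/eqP; rewrite eq_le ab.
by rewrite subrr.
Qed.

Lemma negligible_sub (A : set R) (N : set R) :
  A `<=` N -> measurable N -> lebesgue_measure N = 0%E -> mu.-negligible A.
Proof. by move=> AN mN N0; exists N; split => //; exact: borel_measurable. Qed.

Lemma negligible_measurable (A : set lebR) : mu.-negligible A -> measurable A.
Proof. exact: completed_lebesgue_measure_is_complete. Qed.

(** Completeness of the measure is used through this lemma: Lebesgue
    measurable sets are Borel up to a Borel null set. *)
Lemma measurable_borel_null (A : set lebR) : measurable A ->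
  exists B N : set R, [/\ measurable B, measurable N, lebesgue_measure N = 0%E &
    A `\` N = B `\` N].
Proof.
move=> mA; have : (@wlength R idfun)^*%mu.-cara.-measurable A by exact: mA.
rewrite -completed_caratheodory_measurable g_sigma_completed_algebra_genE {mA}.
move=> [B mB [M [N [mN N0 MN]] <-]]; exists B, N; split => //.
apply/seteqP; split=> [x [[//|/MN//] Nx]|x [Bx Nx]]; split => //; by left.
Qed.

Definition integrable_on (a b : R) (g : R -> R) := mu.-integrable `[a, b] (EFin \o g).

(** Half-open intervals make the integral additive without any discussion
    of end points. *)
Definition lint (g : R -> R) (a b : R) : R := \int[mu]_(t in `]a, b]) g t.

Lemma integrable_onS (a b s t : R) g : a <= s -> t <= b ->
  integrable_on a b g -> mu.-integrable `]s, t] (EFin \o g).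
Proof.
move=> as_ tb; apply: integrableS; [exact: measurable_itvL|exact: measurable_itvL|].
move=> x /=; rewrite !in_itv/= => /andP[sx xt]; apply/andP; split.
  exact: le_trans as_ (ltW sx).
exact: le_trans xt tb.
Qed.

Lemma integrable_on_sub (a b s t : R) g : a <= s -> t <= b ->
  integrable_on a b g -> integrable_on s t g.
Proof.
move=> as_ tb; apply: integrableS; [exact: measurable_itvL|exact: measurable_itvL|].
move=> x /=; rewrite !in_itv/= => /andP[sx xt]; apply/andP; split.
  exact: le_trans as_ sx.
exact: le_trans xt tb.
Qed.

Lemma lint_nil g (a b : R) : b <= a -> lint g a b = 0.
Proof. by move=> ba; rewrite /lint set_itv_ge ?Rintegral_set0// bnd_simp -leNgt. Qed.

Lemma lint_add (a b s t u : R) g : a <= s -> s <= t -> t <= u -> u <= b ->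
  integrable_on a b g -> lint g s u = lint g s t + lint g t u.
Proof.
move=> as_ st tu ub ig.
have E : `]s, u]%classic = `]s, t]%classic `|` `]t, u]%classic :> set R.
  apply/seteqP; split=> x /=; rewrite !in_itv/=.
    by move=> /andP[sx xu]; have [xt|tx] := leP x t; [left|right]; rewrite ?sx ?xt ?tx.
  case=> /andP[x1 x2]; apply/andP; split=> //.
    exact: le_trans tu.
  exact: le_lt_trans x1.
rewrite /lint E Rintegral_setU//.
- exact: measurable_itvL.
- exact: measurable_itvL.
- by rewrite -E; exact: integrable_onS ig.
- apply/disj_setPS => x [] /=; rewrite !in_itv/= => /andP[_ h] /andP[h' _].
  by move: h; rewrite leNgt h'.
Qed.

Lemma lint_norm (a b s t : R) g : a <= s -> t <= b -> integrable_on a b g ->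
  `|lint g s t| <= lint (fun r => `|g r|) s t.
Proof.
move=> as_ tb ig; apply: le_normr_Rintegral; first exact: measurable_itvL.
exact: integrable_onS ig.
Qed.

Lemma lint_le (a b s t : R) g g' : a <= s -> t <= b -> integrable_on a b g ->
  integrable_on a b g' -> (forall r, s < r -> r <= t -> g r <= g' r) -> lint g s t <= lint g' s t.
Proof.
move=> as_ tb ig ig' gg'; apply: le_Rintegral.
- exact: measurable_itvL.
- exact: integrable_onS ig.
- exact: integrable_onS ig'.
- by move=> x /=; rewrite in_itv/= => /andP[]; exact: gg'.
Qed.

Lemma lint_ge0 g (s t : R) : (forall r, s < r -> r <= t -> 0 <= g r) -> 0 <= lint g s t.
Proof. by move=> g0; apply: Rintegral_ge0 => x /=; rewrite in_itv/= => /andP[]; exact: g0. Qed.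

Lemma eq_lint g g' (s t : R) : (forall r, s < r -> r <= t -> g r = g' r) -> lint g s t = lint g' s t.
Proof.
move=> gg'; apply: eq_Rintegral => x; rewrite inE/= in_itv/= => /andP[]; exact: gg'.
Qed.

Lemma integrable_on_norm (a b : R) g : integrable_on a b g -> integrable_on a b (fun t => `|g t|).
Proof. by apply: integrable_norm; exact: measurable_itvL. Qed.

Lemma integrable_onD (a b : R) g g' : integrable_on a b g -> integrable_on a b g' ->
  integrable_on a b (fun t => g t + g' t).
Proof. by move=> ig ig'; exact: (integrableD (measurable_itvL _) ig ig'). Qed.

Lemma integrable_onZ (a b c : R) g : integrable_on a b g -> integrable_on a b (fun t => c * g t).
Proof. by move=> ig; exact: (integrableZl (measurable_itvL _) c ig). Qed.

Lemma integrable_on_cst (a b c : R) : integrable_on a b (fun=> c).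
Proof.
apply: measurable_bounded_integrable; first exact: measurable_itvL.
- suff : (@lebesgue_measure R `[a, b] < +oo)%E by [].
  by rewrite lebesgue_measure_itv/=; case: ifP => _; rewrite ?ltry.
- exact: measurable_cst.
- by exists `|c|; split => [|M cM x _]; rewrite ?num_real//= ltW.
Qed.

Lemma lint_abs_continuous (a b : R) g : integrable_on a b g -> forall e : R, 0 < e ->
  exists2 d : R, 0 < d & forall A : set lebR, measurable A -> A `<=` `[a, b] ->
    (mu A < d%:E)%E -> \int[mu]_(t in A) `|g t| < e.
Proof.
move=> ig e e0.
have mab := measurable_itvL `[a, b].
have ig' : mu.-integrable setT (EFin \o (g \_ `[a, b])).
  by rewrite -restrict_EFin; exact/(integrable_mkcond _ mab).
have [d [d0 dP]] := integral_normr_continuous ig' e0.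
exists d => // A mA Aab Ad; apply: le_lt_trans (dP A mA Ad).
rewrite le_eqVlt; apply/orP; left; apply/eqP/eq_Rintegral => x; rewrite inE => Ax.
by rewrite /patch mem_set//; exact: Aab.
Qed.

Lemma lint_small (a b : R) g : integrable_on a b g -> forall e : R, 0 < e ->
  exists2 d : R, 0 < d & forall s t, a <= s -> s <= t -> t <= b -> t - s < d ->
    lint (fun r => `|g r|) s t < e.
Proof.
move=> ig e /(lint_abs_continuous ig)[d d0 dP]; exists d => // s t as_ st tb std.
apply: dP; first exact: measurable_itvL.
- move=> x /=; rewrite !in_itv/= => /andP[sx xt].
  by rewrite (le_trans as_ (ltW sx)) (le_trans xt tb).
- by rewrite mu_itv// lte_fin.
Qed.

End lebesgue_measure_on_R.

(** * Differentiation of integrals *)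

Section borel_representative.
Context {R : realType}.
Local Notation mu := (@completed_lebesgue_measure R).
Local Notation lebR := (caratheodory_type (@wlength R idfun)^*%mu).
Local Notation leb := (@lebesgue_measure R).

Definition rational_seq (k : nat) : R := if unpickle k is Some q then ratr q else 0.

Lemma rational_seq_dense (x y : R) : x < y -> exists k, x < rational_seq k < y.
Proof.
move=> xy; have [q] := rat_in_itvoo xy; rewrite in_itv/= => qxy.
by exists (pickle q); rewrite /rational_seq pickleK.
Qed.

(** The differentiation theorem for the Borel measure requires a Borel
    integrand, hence this modification: the superlevel sets of [g] at rational heights are Borel off
    null sets, and off their countable union [g] is Borel measurable. *)
Lemma borel_representative (a b : R) (g : R -> R) : integrable_on a b g ->
  exists (h : R -> R) (N : set R), [/\ measurable N, leb N = 0%E,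
    measurable_fun (setT : set (measurableTypeR R)) h,
    (forall t, a <= t <= b -> ~ N t -> h t = g t) &
    forall t, ~ (a <= t <= b) \/ N t -> h t = 0].
Proof.
move=> ig.
have mg : measurable_fun (`[a, b] : set lebR) g.
  by apply/measurable_EFinP; exact: measurable_int ig.
pose A k : set lebR := `[a, b] `&` [set t | rational_seq k < g t].
have mA k : measurable (A k).
  rewrite /A; have := mg (measurable_itvL _) `]rational_seq k, +oo[%classic (measurable_itv _).
  by congr measurable; apply/seteqP; split => t [? /=]; rewrite ?in_itv/= ?andbT.
pose BN k := cid (measurable_borel_null (mA k)).
pose B k := sval (BN k); pose N' k := sval (cid (svalP (BN k))).
have BNP k : [/\ measurable (B k), measurable (N' k), leb (N' k) = 0%E & A k `\` N' k = B k `\` N' k].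
  by rewrite /B /N'; case: cid => /= M; case.
pose N := \bigcup_k N' k.
have mN : measurable N by apply: bigcupT_measurable => k; have [] := BNP k.
have N0 : leb N = 0%E.
  apply/eqP; rewrite eq_le measure_ge0 andbT.
  have mN' k : measurable (N' k) by have [] := BNP k.
  have := measure_sigma_subadditive leb mN' mN (@subset_refl _ N).
  by rewrite eseries0// => k _ _; have [] := BNP k.
exists (fun t => if (t \in `[a, b]%classic) && (t \notin N) then g t else 0), N.
split => //; last 2 first.
- by move=> t tab Nt; rewrite mem_set/= ?in_itv//= ifT// notin_setE.
- move=> t h; rewrite ifF//; apply/negbTE; rewrite negb_and negbK; case: h => h; apply/orP.
    by left; apply/negP; rewrite inE/= in_itv.
  by right; rewrite inE.
set h := (fun t => _).
have mab : measurable (`[a, b]%classic : set R) by exact: measurable_itv.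
have AB k : A k `\` N = B k `\` N.
  have [_ _ _ E] := BNP k; apply/seteqP; split => t [At Nt]; split => //.
    by have [] : (B k `\` N' k) t by rewrite -E; split => // Nk; apply: Nt; exists k.
  by have [] : (A k `\` N' k) t by rewrite E; split => // Nk; apply: Nt; exists k.
have hq k : measurable [set t : R | rational_seq k < h t].
  have [q0|q0] := leP 0 (rational_seq k).
    have -> : [set t : R | rational_seq k < h t] = B k `\` N.
      rewrite -AB; apply/seteqP; split=> t /=; rewrite /h.
        case: ifPn => [/andP[]|]; last by rewrite ltNge q0.
        by rewrite inE notin_setE.
      by move=> [[tab gt] Nt]; rewrite mem_set//= ifT// notin_setE.
    by apply: measurableD => //; have [] := BNP k.
  have -> : [set t : R | rational_seq k < h t] = ~` ((`[a, b]%classic `\` N) `\` (B k `\` N)).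
    rewrite -AB; apply/seteqP; split=> t /=; rewrite /h.
      move=> qt [[tab Nt]]; apply; split => //; split => //.
      by move: qt; rewrite mem_set//= ifT// notin_setE.
    move=> nt; case: ifPn => // /andP[]; rewrite inE notin_setE => tab Nt.
    by apply: contrapT => ng; apply: nt; split => // -[[_ ?]].
  apply: measurableC; apply: measurableD; first exact: measurableD.
  by apply: measurableD => //; have [] := BNP k.
apply: (measurability _ (RGenOInfty.measurableE R)) => //.
move=> _ [_ [r ->] <-]; rewrite setTI.
have -> : h @^-1` `]r, +oo[ = \bigcup_k (if r <= rational_seq k then [set t : R | rational_seq k < h t] else set0).
  apply/seteqP; split=> t /=.
    rewrite in_itv/= andbT => /rational_seq_dense[k /andP[rk kh]].
    by exists k => //; rewrite ltW.
  move=> [k _]; case: ifP => //= rk kh; rewrite in_itv/= andbT.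
  exact: le_lt_trans kh.
by apply: bigcupT_measurable => k; case: ifP => _; [exact: hq|exact: measurable0].
Qed.

End borel_representative.

Section slopes.
Context {R : realType}.

(** Differentiability as first order approximation; in this form it passes
    between a vector function and its components by taking minima of radii. *)
Lemma is_deriveP (V : normedModType R) (x : R -> V) (t : R) (v : V) :
  is_derive t (1 : R) x v <->
  forall e : R, 0 < e -> exists2 d : R, 0 < d &
    forall s, `|s - t| < d -> `|x s - x t - (s - t) *: v| <= e * `|s - t|.
Proof.
pose q (h : R) := h^-1 *: ((x \o shift t) (h *: (1 : R)) - x t).
have qE h : h != 0 -> `|x (h + t) - x t - h *: v| = `|h| * `|v - q h|.
  move=> h0; rewrite -normrZ scalerBr /q scalerA divff// scale1r/= distrC.
  by rewrite [h *: 1]mulr1 opprB.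
have cvgP : (q h @[h --> 0^'] --> v) <->
  forall e : R, 0 < e -> exists2 d : R, 0 < d &
    forall s, `|s - t| < d -> `|x s - x t - (s - t) *: v| <= e * `|s - t|.
  split.
    move=> /cvgrPdist_le qv e e0.
    have /nbhs_ballP[d d0 dP] : nbhs (0 : R) [set h : R | h != 0 -> `|v - q h| <= e] by exact: qv.
    exists d => // s sd; have [->|st] := eqVneq s t.
      by rewrite !subrr scale0r subrr !normr0 mulr0.
    have st0 : s - t != 0 by rewrite subr_eq0.
    rewrite -{1}(subrK t s) qE// mulrC ler_wpM2r//; apply: dP => //.
    by rewrite /ball/= sub0r normrN.
  move=> h; apply/cvgrPdist_le => e e0; have [d d0 dP] := h e e0.
  suff : nbhs (0 : R) [set h : R | h != 0 -> `|v - q h| <= e] by [].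
  apply/nbhs_ballP; exists d => // k; rewrite /ball/= sub0r normrN => kd k0.
  have := dP (k + t); rewrite addrK => /(_ kd); rewrite qE// mulrC.
  by rewrite ler_pM2r// normr_gt0.
split.
  by move=> [dx dE]; apply/cvgP; rewrite -dE; exact: dx.
move=> /cvgP h; split; first by apply/cvg_ex; exists v.
by apply/cvg_lim => //; exact: norm_hausdorff.
Qed.

Lemma is_derive_coord n (x : R -> 'cV[R]_n) (t : R) (v : 'cV[R]_n) :
  (forall i, is_derive t (1 : R) (fun s => x s i 0) (v i 0)) ->
  is_derive t (1 : R) x v.
Proof.
move=> dx; apply/is_deriveP => e e0.
have ex i : exists d : R, 0 < d /\ forall s, `|s - t| < d ->
    `|x s i 0 - x t i 0 - (s - t) * v i 0| <= e * `|s - t|.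
  by have /is_deriveP/(_ e e0)[d d0 dP] := dx i; exists d.
pose d i := sval (cid (ex i)).
have dP i : 0 < d i /\ forall s, `|s - t| < d i ->
    `|x s i 0 - x t i 0 - (s - t) * v i 0| <= e * `|s - t| by rewrite /d; case: cid.
exists (\big[Num.min/1]_i d i).
  by apply: lt_bigmin => // i _; have [] := dP i.
move=> s sd; apply: norm_le_coord; first by rewrite mulr_ge0// ltW.
move=> i; rewrite !mxE; apply: (dP i).2; apply: lt_le_trans sd _.
exact: bigmin_le.
Qed.

Lemma coord_is_derive n (x : R -> 'cV[R]_n) (t : R) (v : 'cV[R]_n) i :
  is_derive t (1 : R) x v -> is_derive t (1 : R) (fun s => x s i 0) (v i 0).
Proof.
move=> /is_deriveP dx; apply/is_deriveP => e /dx[d d0 dP].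
exists d => // s /dP; apply: le_trans.
by apply: le_trans (coord_le_norm _ i); rewrite !mxE.
Qed.

End slopes.

Section derivative_of_integral.
Context {R : realType}.
Local Notation mu := (@completed_lebesgue_measure R).
Local Notation lebR := (caratheodory_type (@wlength R idfun)^*%mu).
Local Notation leb := (@lebesgue_measure R).

Let id_lebR : lebR -> measurableTypeR R := fun x => x.

Lemma measurable_id_lebR : measurable_fun setT id_lebR.
Proof. by move=> _ A mA; rewrite setTI; exact: borel_measurable. Qed.

(** The Borel measure is the image of the completed measure under the identity
    map, so this is a change of variables. *)
Lemma ge0_integral_completed (D : set R) (f : R -> \bar R) :
  measurable (D : set (measurableTypeR R)) ->
  measurable_fun (D : set (measurableTypeR R)) f ->
  (forall x, D x -> (0 <= f x)%E) ->
  (\int[leb]_(x in D) f x = \int[mu]_(x in D) f x)%E.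
Proof.
move=> mD mf f0.
have := @ge0_integral_pushforward _ _ _ _ R id_lebR measurable_id_lebR mu D f mD mf.
move=> <-; last by move=> y; rewrite inE; exact: f0.
by apply: eq_measure_integral; first exact: measurable_id_lebR.
Qed.

Lemma measurable_fun_completed (h : R -> R) :
  measurable_fun (setT : set (measurableTypeR R)) h -> measurable_fun (setT : set lebR) h.
Proof. by move=> mh; exact: (measurableT_comp mh measurable_id_lebR). Qed.

Lemma integrable_completed (h : R -> R) :
  measurable_fun (setT : set (measurableTypeR R)) h ->
  mu.-integrable setT (EFin \o h) -> leb.-integrable setT (EFin \o h).
Proof.
move=> mh /integrableP[_ hoo]; apply/integrableP; split; first exact/measurable_EFinP.
rewrite ge0_integral_completed//.
by apply: measurableT_comp => //; exact/measurable_EFinP.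
Qed.

Lemma Rintegral_completed (D : set R) (h : R -> R) :
  measurable (D : set (measurableTypeR R)) ->
  measurable_fun (setT : set (measurableTypeR R)) h ->
  \int[leb]_(t in D) h t = \int[mu]_(t in D) h t.
Proof.
move=> mD mh; have mh' : measurable_fun D (EFin \o h).
  by apply/measurable_EFinP; exact: measurable_funTS.
rewrite /Rintegral; congr fine; rewrite integralE [RHS]integralE.
congr (_ - _)%E; apply: ge0_integral_completed => //.
  exact: measurable_funepos.
exact: measurable_funeneg.
Qed.

(** Lebesgue's differentiation theorem for the completed measure. *)
Lemma lint_derivative (a b : R) (g : R -> R) : integrable_on a b g ->
  {ae mu, forall t, a < t < b -> is_derive t (1 : R) (lint g a) (g t)}.
Proof.
move=> ig; have [h [N [mN N0 mh hg h0]]] := borel_representative ig.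
have ih : leb.-integrable setT (EFin \o h).
  apply: integrable_completed => //.
  have ig' : mu.-integrable setT (EFin \o (g \_ `[a, b])).
    by rewrite -restrict_EFin; exact/(integrable_mkcond _ (measurable_itvL _)).
  apply: (le_integrable measurableT _ _ ig').
    by apply/measurable_EFinP; exact: measurable_fun_completed.
  move=> t _ /=; have [tab|tab] := boolP (a <= t <= b); last first.
    by rewrite h0 ?normr0 ?lee_fin//; left; exact/negP.
  have [Nt|Nt] := pselect (N t); first by rewrite h0 ?normr0 ?lee_fin//; right.
  by rewrite hg// /patch mem_set//= in_itv.
have lintE t : a <= t <= b -> lint g a t = \int[leb]_(s in `]a, t]) h s.
  move=> /andP[at_ tb]; rewrite Rintegral_completed//; congr fine.
  apply: ae_eq_integral.
  - exact: measurable_itvL.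
  - by apply: measurable_int; exact: integrable_onS ig.
  - apply/measurable_EFinP; apply: measurable_funTS.
    exact: measurable_fun_completed.
  - exists N; split; [exact: borel_measurable|exact: N0|].
    move=> s /= /not_implyP[]; rewrite in_itv/= => /andP[as_ st] ne.
    apply: contrapT => Ns; apply: ne; rewrite /= hg//.
    by rewrite (ltW as_) (le_trans st).
have [||M [mM M0 MP]] := @FTC1 R h (BRight a).
- by move=> y; apply: integrableS ih => //; exact: measurable_itv.
- by have := integrable_locally measurableT ih; rewrite patch_setT.
exists (M `|` N); split.
- by apply: borel_measurable; exact: measurableU.
- apply/eqP; rewrite eq_le measure_ge0 andbT.
  suff : (leb (M `|` N) <= 0)%E by [].
  apply: le_trans (measureU2 leb mM mN) _.
  by rewrite [X in (X + _)%E]M0 [X in (_ + X)%E]N0 adde0.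
move=> t /= /not_implyP[/andP[at_ tb] nd].
apply: contrapT => /not_orP[nM nN]; apply: nd.
have [dF FE] : derivable (fun x => \int[leb]_(s in `]a, x]) h s) t 1 /\
    derive1 (fun x => \int[leb]_(s in `]a, x]) h s : R) t = h t.
  apply: contrapT => nh; apply: nM; apply: MP => /= h'; apply: nh; apply: h'.
  exact: at_.
have htg : h t = g t by apply: hg; [rewrite (ltW at_) (ltW tb)|].
rewrite htg in FE.
have : is_derive t (1 : R) (fun x => \int[leb]_(s in `]a, x]) h s) (g t).
  by split; [exact: dF|rewrite -derive1E; exact: FE].
move=> /is_deriveP dP; apply/is_deriveP => e /dP[d d0 {}dP].
exists (Num.min d (Num.min (t - a) (b - t))).
  by rewrite !lt_min d0 !subr_gt0 at_.
move=> s; rewrite !lt_min => /and3P[sd]; rewrite !ltr_norml => /andP[s1 s2] /andP[s3 s4].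
rewrite !lintE; first exact: dP.
  by apply/andP; split; lra.
by apply/andP; split; lra.
Qed.

End derivative_of_integral.

(** * The fundamental theorem of calculus for absolutely continuous functions *)

Section fundamental_theorem.
Context {R : realType}.
Local Notation mu := (@completed_lebesgue_measure R).
Local Notation lebR := (caratheodory_type (@wlength R idfun)^*%mu).
Local Notation leb := (@lebesgue_measure R).

(** Continuous induction on a compact interval: the supremum of the points
    that satisfy [P] cannot be passed nor missed. *)
Lemma interval_induction (a b : R) (P : R -> Prop) : a <= b -> P a ->
  (forall t, a <= t <= b -> exists2 r : R, 0 < r &
    forall u v, a <= u -> u <= t -> t <= v -> v <= b -> v - u < r -> P u -> P v) ->
  P b.
Proof.
move=> ab Pa step; pose S := [set t | a <= t <= b /\ P t].
have Sa : S a by split; rewrite ?lexx.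
have ubS : ubound S b by move=> t [/andP[]].
have supS : has_sup S by split; [exists a|exists b].
have asup : a <= sup S by apply: ub_le_sup => //; exists b.
have supb : sup S <= b by apply: ge_sup; [exists a|].
have [r r0 rP] := step (sup S) (introT andP (conj asup supb)).
have r20 : 0 < r / 3 by lra.
have [u [uab Pu] us] := sup_adherent r20 supS.
have usup : u <= sup S by apply: ub_le_sup => //; exists b.
pose v := Num.min b (sup S + r / 3).
have supv : sup S <= v by rewrite le_min supb/=; lra.
have vb : v <= b by rewrite ge_min lexx.
have vr : v <= sup S + r / 3 by rewrite ge_min lexx orbT.
have Pv : P v.
  apply: (rP u) => //; first by case/andP: uab.
  lra.
have : v <= sup S by apply: ub_le_sup; [exists b|split=> //; rewrite vb (le_trans asup)].
rewrite /v ge_min => /orP[bs|]; last by move=> ?; exfalso; lra.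
suff <- : v = b by [].
apply/eqP; rewrite eq_le vb/=; exact: le_trans bs supv.
Qed.

Lemma negligible_borel (A : set lebR) : mu.-negligible A ->
  exists N : set R, [/\ measurable N, leb N = 0%E & A `<=` N].
Proof.
move=> [A' [mA' A'0 AA']]; have [B [N [mB mN N0 E]]] := measurable_borel_null mA'.
exists ((B `\` N) `|` N); split.
- by apply: measurableU => //; exact: measurableD.
- have BN0 : leb (B `\` N) = 0%E.
    apply/eqP; rewrite eq_le measure_ge0 andbT.
    suff : (mu (B `\` N) <= 0)%E by [].
    rewrite -E -A'0; apply: le_measure; rewrite ?inE//.
    by apply: measurableD => //; exact: borel_measurable.
  apply/eqP; rewrite eq_le measure_ge0 andbT.
  have mBN : measurable (B `\` N) by exact: measurableD.
  apply: le_trans (measureU2 leb mBN mN) _.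
  by rewrite [X in (X + _)%E]BN0 [X in (_ + X)%E]N0 adde0.
- move=> x /AA' A'x; have [|Nx] := pselect (N x); [by right|left].
  by rewrite -E.
Qed.

(** [abs_continuous] for scalar functions, so that components can be treated
    separately. *)
Definition abs_cont (a b : R) (x : R -> R) : Prop :=
  forall e : R, 0 < e -> exists2 d : R, 0 < d &
    forall (N : nat) (s r : 'I_N -> R),
      (forall i, [/\ a <= s i, s i <= r i & r i <= b]) ->
      trivIset [set: 'I_N] (fun i => `]s i, r i[%classic) ->
      \sum_i (r i - s i) < d -> \sum_i `|x (r i) - x (s i)| < e.

Lemma abs_cont_lint (a b : R) (g : R -> R) : integrable_on a b g -> abs_cont a b (lint g a).
Proof.
move=> ig e e0; have [d d0 dP] := lint_abs_continuous ig e0.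
exists d => // N s r sr tr sd.
pose F i : set lebR := `]s i, r i]%classic.
have mF i : measurable (F i) by exact: measurable_itvL.
have tF : trivIset setT F.
  apply/trivIsetP => i j _ _ ij; apply/seteqP; split => // t [].
  rewrite /F/= !in_itv/= => /andP[si ri] /andP[sj rj].
  have /trivIsetP/(_ i j I I ij) := tr; move/seteqP => [+ _].
  have mt : Num.max (s i) (s j) < t by rewrite gt_max si.
  move=> /(_ ((Num.max (s i) (s j) + t) / 2)); apply; split; rewrite /= in_itv/=.
    have : s i <= Num.max (s i) (s j) by rewrite le_max lexx.
    move=> ?; apply/andP; split; lra.
  have : s j <= Num.max (s i) (s j) by rewrite le_max lexx orbT.
  move=> ?; apply/andP; split; lra.
pose D := \big[setU/set0]_(i < N) F i.
have mD : measurable D by apply: bigsetU_measurable.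
have Dab : D `<=` `[a, b].
  rewrite /D -bigcup_seq => t [i _]; rewrite /F/= !in_itv/= => /andP[si ri].
  have [h1 h2 h3] := sr i; apply/andP; split; lra.
have muD : mu D = (\sum_i (r i - s i))%:E.
  rewrite /D measure_bigsetU_ord// -sumEFin; apply: eq_bigr => i _.
  by have [_ h _] := sr i; exact: mu_itv.
have := dP D mD Dab; rewrite muD lte_fin => /(_ sd).
apply: le_lt_trans.
have igD : mu.-integrable D (EFin \o (fun t => `|g t|)).
  apply: (integrableS (measurable_itvL `[a, b])) => //.
  exact: integrable_on_norm.
have -> : \int[mu]_(t in D) `|g t| = \sum_i \int[mu]_(t in F i) `|g t|.
  have iF i : mu.-integrable (F i) (EFin \o (fun t => `|g t|)).
    have [h1 h2 h3] := sr i; apply: integrable_onS h1 h3 _.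
    exact: integrable_on_norm.
  rewrite /Rintegral /D (@ge0_integral_bigsetU _ _ _ _ _ F).
  - by rewrite /= [RHS]sum_fine// => i _; apply: integrable_fin_num (iF i).
  - exact: mF.
  - by rewrite /index_enum -enumT enum_uniq.
  - by apply: sub_trivIset tF.
  - exact: measurable_int igD.
  - by move=> t _; rewrite lee_fin.
apply: ler_sum => i _; have [h1 h2 h3] := sr i.
rewrite (lint_add (lexx a) h1 h2 h3 ig) addrC addKr.
exact: lint_norm ig.
Qed.

Lemma abs_contB (a b : R) (x y : R -> R) :
  abs_cont a b x -> abs_cont a b y -> abs_cont a b (fun t => x t - y t).
Proof.
move=> ax ay e e0; have e20 : 0 < e / 2 by lra.
have [d d0 dP] := ax _ e20; have [d' d'0 d'P] := ay _ e20.
exists (Num.min d d'); first by rewrite lt_min d0.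
move=> N s r sr tr; rewrite lt_min => /andP[sd sd'].
have h1 := dP N s r sr tr sd; have h2 := d'P N s r sr tr sd'.
apply: (@le_lt_trans _ _ (\sum_i `|x (r i) - x (s i)| + \sum_i `|y (r i) - y (s i)|)); last by lra.
rewrite -big_split/=; apply: ler_sum => i _.
rewrite (_ : _ - _ = (x (r i) - x (s i)) - (y (r i) - y (s i))); last by ring.
exact: ler_normB.
Qed.

(** The exceptional null set lies in an open set [O] of measure less than
    the modulus [d] of absolute continuity.  Subdivide [[a, b]] into intervals
    contained in [O], on which the total variation of [z] is less than [e], and
    intervals around points where the derivative vanishes, on which [z]
    increases at most with slope [e].  Interval induction builds the
    subdivision. *)
Lemma abs_cont_constant (a b : R) (z : R -> R) : a <= b -> abs_cont a b z ->
  {ae mu, forall t, a < t < b -> is_derive t (1 : R) z 0} -> z b = z a.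
Proof.
move=> ab az dz.
suff small e : 0 < e -> `|z b - z a| <= e * (b - a) + e.
  apply/eqP; rewrite -subr_eq0 -normr_le0 leNgt; apply/negP => h.
  have c0 : 0 < b - a + 1 by lra.
  have e0 : 0 < `|z b - z a| / (2 * (b - a + 1)) by rewrite divr_gt0// mulr_gt0.
  have := small _ e0; rewrite -{2}[`|z b - z a| / _]mulr1 -mulrDr.
  have -> : `|z b - z a| / (2 * (b - a + 1)) * (b - a + 1) = `|z b - z a| / 2.
    by field; rewrite gt_eqF.
  move=> *; lra.
move=> e0; have [d d0 dP] := az e e0.
have [N [mN N0 NP]] := negligible_borel dz.
pose N' := N `|` ([set a] `|` [set b]).
have mab : measurable ([set a] `|` [set b] : set R) by apply: measurableU; exact: measurable_set1.
have mN' : measurable N' by exact: measurableU.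
have N'0 : leb N' = 0%E.
  apply/eqP; rewrite eq_le measure_ge0 andbT.
  apply: le_trans (measureU2 leb mN mab) _.
  rewrite [X in (X + _)%E]N0 add0e.
  apply: le_trans (measureU2 leb (measurable_set1 a) (measurable_set1 b)) _.
  by rewrite [X in (X + _)%E]lebesgue_measure_set1 [X in (_ + X)%E]lebesgue_measure_set1 adde0.
have [|O [oO NO Od]] := lebesgue_regularity_outer mN' _ d0; first by rewrite [X in (X < _)%E]N'0.
have mO : measurable O by exact: open_measurable.
have {}Od : (leb O < d%:E)%E.
  have : (leb O <= leb (O `\` N') + leb N')%E.
    have mD : measurable (O `\` N') by exact: measurableD.
    apply: le_trans (measureU2 leb mD mN'); apply: le_measure; rewrite ?inE//.
      exact: measurableU.
    by move=> t Ot; have [|] := pselect (N' t); [right|left].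
  by rewrite [X in (_ + X)%E]N'0 adde0 => /le_lt_trans; apply.
(* L lists, from right to left, the intervals of the subdivision of [a, t] contained in O *)
pose P t := exists L : seq (R * R),
  [/\ all (fun p => [&& a <= p.1, p.1 <= p.2 & p.2 <= t]) L,
      pairwise (fun p q => q.2 <= p.1) L,
      `|z t - z a| <= e * (t - a) + \sum_(p <- L) `|z p.2 - z p.1| &
      ((\sum_(p <- L) (p.2 - p.1))%:E <= leb (O `&` `]a, t]))%E].
have : P b.
  apply: (interval_induction ab).
    exists [::]; split => //; first by rewrite !subrr normr0 mulr0 big_nil addr0.
    by rewrite big_nil measure_ge0.
  have good t : a <= t <= b -> ~ O t -> exists2 r, 0 < r & forall s, `|s - t| < r -> `|z s - z t| <= e * `|s - t|.
    move=> /andP[at_ tb] Ot.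
    have ta : t <> a by move=> ta; apply: Ot; apply: NO; right; left.
    have tb' : t <> b by move=> tb'; apply: Ot; apply: NO; right; right.
    have Nt : ~ N t by move=> Nt; apply: Ot; apply: NO; left.
    have /is_deriveP/(_ e e0)[r r0 rP] : is_derive t (1 : R) z 0.
      apply: contrapT => nd; apply: Nt; apply: NP => /= h; apply: nd; apply: h.
      by rewrite !lt_neqAle at_ tb !andbT; apply/andP; split; apply/eqP => // /esym.
    by exists r => // s /rP; rewrite scaler0 subr0.
  move=> t tab; have [Ot|Ot] := pselect (O t); last first.
    have [r r0 rP] := good t tab Ot; exists r => // u v au ut tv vb uvr.
    move=> [L [allL pL zL muL]]; exists L; split => //.
    - by apply: sub_all allL => p /and3P[-> ->/= /le_trans]; apply; exact: le_trans tv.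
    - have hu : `|u - t| < r by clear - r0 ut tv uvr; rewrite ltr_norml; apply/andP; split; lra.
      have hv : `|v - t| < r by clear - r0 ut tv uvr; rewrite ltr_norml; apply/andP; split; lra.
      have h1 := rP u hu; have h2 := rP v hv.
      have n1 : `|u - t| = - (u - t) by rewrite ler0_norm// subr_le0.
      have n2 : `|v - t| = v - t by rewrite ger0_norm// subr_ge0.
      rewrite n1 in h1; rewrite n2 in h2.
      have h3 := ler_distD (z t) (z v) (z u); have h4 := ler_distD (z u) (z v) (z a).
      rewrite (distrC (z t) (z u)) in h3; move: (\sum_(_ <- _) _) zL => q zL.
      have h5 : e * (v - a) = e * (u - a) + e * - (u - t) + e * (v - t) by ring.
      by clear - h1 h2 h3 h4 h5 zL; lra.
    - apply: le_trans muL _; apply: le_measure; rewrite ?inE.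
      + by apply: measurableI => //; exact: measurable_itv.
      + by apply: measurableI => //; exact: measurable_itv.
      + move=> s [Os]; rewrite /= !in_itv/= => /andP[as_ su]; split => //.
        by rewrite /= ?in_itv/= as_/=; exact: le_trans (le_trans su ut) tv.
  have /nbhs_ballP[r /= r0 rO] : nbhs t O by exact: open_nbhs_nbhs.
  exists r => // u v au ut tv vb uvr [L [allL pL zL muL]].
  exists ((u, v) :: L); split => /=.
  - rewrite au (le_trans ut tv) lexx/=.
    by apply: sub_all allL => p /and3P[-> ->/= /le_trans]; apply; exact: le_trans tv.
  - by rewrite pL andbT; apply: sub_all allL => p /and3P[].
  - rewrite big_cons/=.
    have h4 := ler_distD (z u) (z v) (z a); move: (\sum_(_ <- _) _) zL => q zL.
    have h5 : e * (u - a) <= e * (v - a) by rewrite ler_pM2l// lerD2r (le_trans ut).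
    by clear - h4 h5 zL; lra.
  - rewrite big_cons/= EFinD addeC.
    have uv : u <= v := le_trans ut tv.
    have mOu : measurable (O `&` `]a, u]) by apply: measurableI => //; exact: measurable_itv.
    have muv : measurable (`]u, v]%classic : set R) by exact: measurable_itv.
    have disj : (O `&` `]a, u]) `&` `]u, v] = set0 :> set R.
      apply/seteqP; split => // s [[_ /=]]; rewrite !in_itv/= => /andP[_ su] /andP[us _].
      by move: us; rewrite ltNge su.
    apply: (@le_trans _ _ (leb ((O `&` `]a, u]) `|` `]u, v]))).
      rewrite measureU// leeD//.
      suff : ((v - u)%:E <= mu `]u, v])%E by [].
      by rewrite mu_itv.
    apply: le_measure; rewrite ?inE.
    + exact: measurableU.
    + by apply: measurableI => //; exact: measurable_itv.
    + move=> s [[Os]|]; rewrite /= !in_itv/= => /andP[s1 s2].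
        by split; [exact: Os|rewrite /= ?in_itv/= s1/=; exact: le_trans uv].
      split; last by rewrite /= ?in_itv/= s2 andbT; exact: le_lt_trans s1.
      apply: rO; rewrite /ball/= ltr_norml; clear - ut tv uvr s1 s2.
      by apply/andP; split; lra.
move=> [L [allL pL zL muL]].
have sumL : \sum_(p <- L) (p.2 - p.1) < d.
  rewrite -lte_fin; apply: le_lt_trans muL _; apply: le_lt_trans Od.
  apply: le_measure; rewrite ?inE//.
  by apply: measurableI => //; exact: measurable_itv.
apply: le_trans zL _; rewrite lerD2l.
have pr (i : 'I_(size L)) : [&& a <= (nth (0, 0) L i).1, (nth (0, 0) L i).1 <= (nth (0, 0) L i).2
    & (nth (0, 0) L i).2 <= b] by move/(all_nthP (0, 0)): allL; exact.
rewrite !(big_nth (0, 0)) !big_mkord in sumL *.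
apply/ltW/dP => //; first by move=> i; have /and3P[] := pr i.
have dis (i j : 'I_(size L)) : (i < j)%N -> (nth (0, 0) L j).2 <= (nth (0, 0) L i).1.
  by move=> ij; move/(pairwiseP (0, 0)): pL; apply; rewrite ?inE.
apply/trivIsetP => i j _ _; rewrite -val_eqE/= neq_ltn => ij.
apply/seteqP; split => // t []; rewrite /= !in_itv/= => /andP[i1 i2] /andP[j1 j2].
have st : (nth (0, 0) L i).2 <= (nth (0, 0) L j).1 \/ (nth (0, 0) L j).2 <= (nth (0, 0) L i).1.
  by case/orP: ij => /dis; [right|left].
by clear - i1 i2 j1 j2 st; case: st; lra.
Qed.

(** The difference between [x] and the integral of [w] is absolutely
    continuous with derivative zero. *)
Theorem ftc_abs_cont (a b : R) (x w : R -> R) : a <= b -> abs_cont a b x ->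
  integrable_on a b w ->
  {ae mu, forall t, a < t < b -> is_derive t (1 : R) x (w t)} ->
  x b = x a + lint w a b.
Proof.
move=> ab ax iw dx.
have : x b - lint w a b = x a - lint w a a.
  apply: (abs_cont_constant (z := fun t => x t - lint w a t)) => //.
    exact: abs_contB (abs_cont_lint iw).
  have FF := ae_filter_ringOfSetsType mu.
  apply: (@filterS2 _ (almost_everywhere mu) FF _ _ _ _ dx (lint_derivative iw)).
  move=> t dxt dwt tab.
  have := is_deriveB (dxt tab) (dwt tab); rewrite subrr; exact.
by rewrite (lint_nil _ (lexx a)) subr0 => <-; rewrite subrK.
Qed.

End fundamental_theorem.

(** * The Arzela-Ascoli theorem *)

Section compactness.
Context {R : realType}.

(** Tychonoff's theorem for a product of segments, read on finitely many
    coordinates at a time. *)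
Lemma pointwise_cluster (I : eqType) (u : nat -> I -> R) (B : I -> R) :
  (forall k i, `|u k i| <= B i) ->
  exists l : I -> R, forall (P : seq I) (e : R) (N : nat), 0 < e ->
    exists2 k, (N <= k)%N & forall i, i \in P -> `|u k i - l i| < e.
Proof.
move=> uB; pose A (i : I) := `[- B i, B i]%classic : set R.
have cA : @compact (prod_topology (fun _ : I => R)) [set f | forall i, A i (f i)].
  by apply: tychonoff => i; exact: segment_compact.
pose F : set_system (I -> R) := u @ \oo.
have FA : F [set f | forall i, A i (f i)].
  by exists 0%N => // k _ i; rewrite /A/= in_itv/= -ler_norml.
have [l [_ lF]] := cA F (fmap_proper_filter _ _) FA.
exists l => P e N e0.
pose X : topologicalType := prod_topology (fun _ : I => R).
have nP : @nbhs _ X (l : X) [set f : X | forall i, i \in P -> `|f i - l i| < e].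
  have FX : Filter (@nbhs _ X (l : X)) by exact: nbhs_filter.
  elim: P => [|p P IH].
    have -> : [set f : X | forall i, i \in [::] -> `|f i - l i| < e] = setT.
      by apply/seteqP; split => // f _ i; rewrite in_nil.
    exact: (@filterT _ _ FX).
  have np : @nbhs _ X (l : X) [set f : X | `|f p - l p| < e].
    have np : nbhs (l p : R) [set z : R | `|z - l p| < e].
      by apply/nbhs_ballP; exists e => // z; rewrite /ball/= distrC.
    exact: (@proj_continuous I (fun _ => R) p l _ np).
  have -> : [set f : X | forall i, i \in p :: P -> `|f i - l i| < e] =
      [set f : X | `|f p - l p| < e] `&` [set f : X | forall i, i \in P -> `|f i - l i| < e].
    apply/seteqP; split => [f fP|f [fp fP] i].
      by split => [|i iP]; apply: fP; rewrite in_cons ?eqxx// iP orbT.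
    by rewrite in_cons => /predU1P[->//|]; exact: fP.
  exact: (@filterI _ _ FX _ _ np IH).
have FN : F [set u k | k in [set k | (N <= k)%N]] by exists N => // k /= Nk; exists k.
have [v [[k /= Nk <-] kP]] := lF _ _ FN nP.
by exists k => // i iP; exact: kP.
Qed.

(** Take a cluster point [y] of the sequence for pointwise convergence.  It is
    as equicontinuous as the sequence, so closeness to [y] on the finite grid
    of a compact interval gives uniform closeness there; choosing the indices
    diagonally yields a subsequence converging on the whole half-line. *)
Lemma arzela_ascoli n (x : nat -> R -> 'cV[R]_n) (t0 : R) :
  (forall t, t0 <= t -> exists C : R, forall k, `|x k t| <= C) ->
  (forall T e : R, 0 < e -> exists2 d : R, 0 < d & forall k s t,
    t0 <= s <= T -> t0 <= t <= T -> `|s - t| < d -> `|x k s - x k t| <= e) ->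
  exists (phi : nat -> nat) (y : R -> 'cV[R]_n), (forall j, (j <= phi j)%N) /\
    forall t, t0 <= t -> forall e : R, 0 < e -> exists J, forall j, (J <= j)%N ->
      `|x (phi j) t - y t| < e.
Proof.
move=> bdd equi.
pose c t := Num.max t0 t.
have ct t : t0 <= t -> c t = t by move=> h; rewrite /c max_r.
have c0 t : t0 <= c t by rewrite /c le_max lexx.
pose B (p : R * 'I_n) := sval (cid (bdd (c p.1) (c0 _))).
have BP (p : R * 'I_n) : forall k, `|x k (c p.1)| <= B p by rewrite /B; case: cid.
pose u k (p : R * 'I_n) := x k (c p.1) p.2 0.
have uB k p : `|u k p| <= B p.
  by apply: le_trans (BP p k); exact: coord_le_norm.
have [l lP] := pointwise_cluster uB.
pose y t : 'cV[R]_n := \col_i l (t, i).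
have yP (Q : seq R) (e : R) N : 0 < e -> exists2 k, (N <= k)%N &
    forall t, t \in Q -> t0 <= t -> `|x k t - y t| < e.
  move=> e0; have [k Nk kP] := lP [seq (t, i) | t <- Q, i <- enum 'I_n] e N e0.
  exists k => // t tQ tt; apply: norm_lt_coord => // i; rewrite !mxE.
  have := kP (t, i); rewrite /u/= ct//; apply.
  by apply/allpairsP; exists (t, i); split => //=; rewrite mem_enum.
have yequi T e : 0 < e -> exists2 d : R, 0 < d & (forall k s t,
    t0 <= s <= T -> t0 <= t <= T -> `|s - t| < d -> `|x k s - x k t| <= e) /\
    forall s t, t0 <= s <= T -> t0 <= t <= T -> `|s - t| < d -> `|y s - y t| <= 3 * e.
  move=> e0; have [d d0 dP] := equi T e e0; exists d => //; split => // s t sT tT st.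
  have [k _ kP] := yP [:: s; t] e 0%N e0.
  have h := dP k s t sT tT st.
  have hs : `|x k s - y s| < e by apply: kP; [rewrite inE eqxx|case/andP: sT].
  have ht : `|x k t - y t| < e by apply: kP; [rewrite !inE eqxx orbT|case/andP: tT].
  have := cdist_triangle (x k s) (y s) (y t).
  have := cdist_triangle (x k t) (x k s) (y t).
  rewrite (cdistC (y s) (x k s)) => *; lra.
(* uniform closeness on the interval of length j, with tolerance tied to j *)
have ex j : exists k, (j <= k)%N /\ forall t, t0 <= t <= t0 + j%:R -> `|x k t - y t| <= 5 * recip j.
  have e0 := @recip_gt0 R j.
  have [d d0 [dx dy]] := yequi (t0 + j%:R) _ e0.
  pose del := d / 2; have del0 : 0 < del by rewrite /del; lra.
  pose M := (Num.trunc (j%:R / del)).+1.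
  have [k jk kP] := yP [seq t0 + m%:R * del | m <- iota 0 M] _ j e0.
  exists k; split => // t /andP[t1 t2].
  have tt0 : 0 <= (t - t0) / del by rewrite divr_ge0 ?subr_ge0// ltW.
  have /andP[m1 m2] := truncn_itv tt0; set m := Num.trunc _ in m1 m2.
  rewrite ler_pdivlMr// in m1; rewrite ltr_pdivrMr// -natr1 mulrDl mul1r in m2.
  set p := t0 + m%:R * del.
  have p0 : t0 <= p by rewrite /p lerDl mulr_ge0// ltW.
  have pt : p <= t by rewrite /p; lra.
  have tp : `|t - p| < d.
    by rewrite ger0_norm ?subr_ge0//; move: m2; rewrite /p /del => *; lra.
  have pin : p \in [seq t0 + m%:R * del | m <- iota 0 M].
    apply/mapP; exists m => //; rewrite mem_iota/= add0n ltnS.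
    by apply: le_truncn; rewrite ler_pM2r ?invr_gt0//; lra.
  have tI : t0 <= t <= t0 + j%:R by rewrite t1.
  have pI : t0 <= p <= t0 + j%:R by rewrite p0 (le_trans pt).
  have h1 := dx k t p tI pI tp; have h2 := dy t p tI pI tp; have h3 := kP p pin p0.
  have := cdist_triangle (x k p) (x k t) (y t).
  have := cdist_triangle (y p) (x k p) (y t).
  rewrite (cdistC (y p) (y t)) => *; lra.
exists (fun j => sval (cid (ex j))), y; split => [j|t tt e e0]; first by case: cid => k [].
have e50 : 0 < e / 5 by lra.
have [N NP] := recip_lt e50.
exists (maxn N (Num.trunc (t - t0)).+1) => j; rewrite geq_max => /andP[Nj tj].
case: cid => k /= [jk kP].
apply: (@le_lt_trans _ _ (5 * recip j)); last by have := NP j Nj; lra.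
apply: kP; rewrite tt/= -lerBlDl.
have : 0 <= t - t0 by rewrite subr_ge0.
move=> /truncn_itv/andP[_ h]; apply/ltW/(lt_le_trans h).
by rewrite ler_nat.
Qed.

End compactness.

(** * Caratheodory's existence theorem *)

Section vector_integral.
Context {R : realType}.
Local Notation mu := (@completed_lebesgue_measure R).
Local Notation lebR := (caratheodory_type (@wlength R idfun)^*%mu).

Lemma integrable_dominated (a b : R) (g beta : R -> R) :
  measurable_fun (`[a, b] : set lebR) g -> integrable_on a b beta ->
  (forall t, a <= t <= b -> `|g t| <= beta t) -> integrable_on a b g.
Proof.
move=> mg ib gb; apply: (le_integrable (measurable_itvL _) _ _ ib).
  exact/measurable_EFinP.
move=> t /=; rewrite in_itv/= => tab; rewrite lee_fin.
exact: le_trans (gb t tab) (ler_norm _).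
Qed.

Definition vint n (g : R -> 'cV[R]_n) (s t : R) : 'cV[R]_n :=
  \col_i lint (fun r => g r i 0) s t.

Lemma vint_norm n (g : R -> 'cV[R]_n) (a b s t : R) (beta : R -> R) :
  a <= s -> s <= t -> t <= b -> (forall i, integrable_on a b (fun r => g r i 0)) ->
  integrable_on a b beta -> (forall r, s < r -> r <= t -> `|g r| <= beta r) ->
  `|vint g s t| <= lint beta s t.
Proof.
move=> as_ st tb ig ib gb; apply: norm_le_coord => [|i].
  by apply: lint_ge0 => r sr rt; apply: le_trans (gb r sr rt).
rewrite mxE; apply: le_trans (lint_norm as_ tb (ig i)) _.
apply: (lint_le as_ tb) => //; first exact: integrable_on_norm.
by move=> r sr rt; apply: le_trans (gb r sr rt); exact: coord_le_norm.
Qed.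

Lemma vint_add n (g : R -> 'cV[R]_n) (a b s t u : R) :
  a <= s -> s <= t -> t <= u -> u <= b -> (forall i, integrable_on a b (fun r => g r i 0)) ->
  vint g s u = vint g s t + vint g t u.
Proof.
by move=> as_ st tu ub ig; apply/colP => i; rewrite !mxE; apply: lint_add ub (ig i).
Qed.

Lemma eq_vint n (g g' : R -> 'cV[R]_n) (s t : R) :
  (forall r, s < r -> r <= t -> g r = g' r) -> vint g s t = vint g' s t.
Proof.
by move=> gg'; apply/colP => i; rewrite !mxE; apply: eq_lint => r sr rt; rewrite gg'.
Qed.

Lemma vint_nil n (g : R -> 'cV[R]_n) (a b : R) : b <= a -> vint g a b = 0.
Proof. by move=> ba; apply/colP => i; rewrite !mxE lint_nil. Qed.

Lemma integrable_onZr (a b c : R) g : integrable_on a b g ->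
  integrable_on a b (fun t => g t * c).
Proof.
move=> /(integrable_onZ c); rewrite /integrable_on; congr (_.-integrable _ _).
by apply/funext => t /=; rewrite mulrC.
Qed.

Lemma lintZ (a b s t c : R) g : a <= s -> t <= b -> integrable_on a b g ->
  lint (fun r => g r * c) s t = lint g s t * c.
Proof.
move=> as_ tb ig; apply: RintegralZr; first exact: measurable_itvL.
exact: integrable_onS ig.
Qed.

End vector_integral.

Section euler_scheme.
Context {R : realType} {n : nat}.
Local Notation mu := (@completed_lebesgue_measure R).
Local Notation lebR := (caratheodory_type (@wlength R idfun)^*%mu).
Variables (h : R -> 'cV[R]_n -> 'cV[R]_n) (t0 : R) (x0 : 'cV[R]_n).
Hypothesis h_measurable : forall xi i,
  measurable_fun (`[t0, +oo[ : set lebR) (fun t => h t xi i 0).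

Definition growth_bound (T : R) (alpha : R -> R) : Prop :=
  integrable_on t0 T alpha /\ forall t, t0 <= t <= T ->
    0 <= alpha t /\ forall xi, `|h t xi| <= alpha t * (1 + `|xi|).

Hypothesis h_bounded : forall T, exists alpha, growth_bound T alpha.

Definition state_bound (alpha : R -> R) (t : R) : R := (1 + `|x0|) * expR (lint alpha t0 t).

Lemma state_bound_mono T alpha s t : growth_bound T alpha -> t0 <= s -> s <= t -> t <= T ->
  state_bound alpha s <= state_bound alpha t.
Proof.
move=> [ia a0] ts st tT; rewrite /state_bound ler_pM2l; last exact: ltr_wpDr.
rewrite ler_expR (lint_add (lexx t0) ts st tT ia) lerDl.
by apply: lint_ge0 => r sr rt; apply: (a0 r _).1; apply/andP; split; lra.
Qed.

Section step.
Variable k : nat.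
Let w : R := recip k.
Let w0 : 0 < w. Proof. exact: recip_gt0. Qed.
Definition grid (i : nat) : R := t0 + i%:R * w.

(** The value of the scheme at a grid point.  The step integrates
    the right-hand side in time with the state frozen at the last grid point,
    as no regularity in time is available. *)
Fixpoint euler_node (i : nat) : 'cV[R]_n :=
  if i is j.+1 then euler_node j + vint (fun s => h s (euler_node j)) (grid j) (grid j.+1)
  else x0.

Let ex_cell (s : R) : exists i, s <= grid i.+1.
Proof.
exists (Num.trunc (`|s - t0| / w)); rewrite -lerBlDl -ler_pdivrMr//.
have : 0 <= `|s - t0| / w by rewrite divr_ge0// ltW.
move=> /truncn_itv/andP[_ /ltW]; apply: le_trans.
by rewrite ler_pM2r ?invr_gt0// ler_norm.
Qed.

Definition cell (s : R) : nat := ex_minn (ex_cell s).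

Lemma gridS i : grid i.+1 = grid i + w.
Proof. by rewrite /grid -natr1 mulrDl mul1r addrA. Qed.

Lemma grid0 : grid 0 = t0. Proof. by rewrite /grid mul0r addr0. Qed.

Lemma grid_ge i : t0 <= grid i.
Proof. by rewrite /grid lerDl mulr_ge0// ltW. Qed.

Lemma grid_le i j : (i <= j)%N -> grid i <= grid j.
Proof. by move=> ij; rewrite /grid lerD2l ler_pM2r// ler_nat. Qed.

Lemma cell_le s : s <= grid (cell s).+1.
Proof. by rewrite /cell; case: ex_minnP. Qed.

Lemma cell_lt s i : cell s = i.+1 -> grid i.+1 < s.
Proof.
rewrite /cell; case: ex_minnP => m _ mP mi; rewrite ltNge; apply/negP => /mP.
by rewrite mi ltnn.
Qed.

Lemma cellP s i : grid i < s -> s <= grid i.+1 -> cell s = i.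
Proof.
move=> si si1; rewrite /cell; case: ex_minnP => m sm mP.
apply/eqP; rewrite eqn_leq mP//= -ltnS ltnNge; apply/negP => mi.
by have := le_trans sm (grid_le mi); rewrite leNgt si.
Qed.

Definition euler_piecewise (s : R) : 'cV[R]_n := euler_node (cell s).

(** The continuous interpolation of the scheme, written as an integral so
    that dominated convergence applies to it directly. *)
Definition euler_polygon (t : R) : 'cV[R]_n :=
  x0 + vint (fun s => h s (euler_piecewise s)) t0 t.

Lemma grid_cell_le s : t0 <= s -> grid (cell s) <= s.
Proof.
move=> ts; case E : (cell s) => [|i]; first by rewrite grid0.
exact/ltW/cell_lt.
Qed.

(** Discrete Gronwall inequality, with [1 + q <= expR q] at each step. *)
Lemma euler_node_bound T alpha i : growth_bound T alpha -> grid i <= T ->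
  1 + `|euler_node i| <= state_bound alpha (grid i).
Proof.
move=> ha; elim: i => [_|i IH iT].
  by rewrite grid0 /state_bound lint_nil// expR0 mulr1.
have [ia a0] := ha.
have iT' : grid i <= T := le_trans (grid_le (leqnSn i)) iT.
have IHi := IH iT'; have gg := grid_le (leqnSn i); have g0 := grid_ge i.
have ba : integrable_on t0 T (fun r => alpha r * (1 + `|euler_node i|)).
  exact: integrable_onZr.
have := vint_norm (g := fun s => h s (euler_node i)) g0 gg iT _ ba.
have ih j : integrable_on t0 T (fun r => h r (euler_node i) j 0).
  apply: integrable_dominated ba _.
    apply: (measurable_funS (measurable_itvL `[t0, +oo[) _ (h_measurable _ _)).
    by move=> t /=; rewrite !in_itv/= => /andP[->].
  by move=> t /a0[_ h1]; apply: le_trans (h1 _); exact: coord_le_norm.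
move=> /(_ ih) h1; have {}h1 : `|vint (fun s => h s (euler_node i)) (grid i) (grid i.+1)| <=
    lint alpha (grid i) (grid i.+1) * (1 + `|euler_node i|).
  rewrite -(lintZ _ g0 iT ia); apply: h1 => r ir ri.
  by apply: (a0 r _).2; apply/andP; split; lra.
rewrite /= /state_bound (lint_add (lexx t0) g0 gg iT ia) expRD mulrA.
set v := vint _ _ _ in h1 *; set q := lint alpha (grid i) _ in h1 *.
apply: (@le_trans _ _ ((1 + `|euler_node i|) * (1 + q))).
  have := ler_normD (euler_node i) v => h2.
  apply: (@le_trans _ _ (1 + (`|euler_node i| + `|v|))); first by rewrite lerD2l.
  lra.
have e1 := expR_ge1Dx q.
apply: (@le_trans _ _ ((1 + `|euler_node i|) * expR q)).
  by rewrite ler_pM2l// ltr_wpDr.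
by rewrite ler_pM2r ?expR_gt0.
Qed.

Lemma euler_piecewise_bound T alpha s : growth_bound T alpha -> t0 <= s <= T ->
  1 + `|euler_piecewise s| <= state_bound alpha T.
Proof.
move=> ha /andP[ts sT]; have gs := grid_cell_le ts.
apply: le_trans (euler_node_bound ha (le_trans gs sT)) _.
by apply: (state_bound_mono ha) => //; [exact: grid_ge|exact: le_trans sT].
Qed.

Lemma euler_rhs_measurable i :
  measurable_fun (`[t0, +oo[ : set lebR) (fun s => h s (euler_piecewise s) i 0).
Proof.
pose E j : set lebR := if j is _.+1 then `]grid j, grid j.+1]%classic else `[t0, grid 1]%classic.
have mE j : measurable (E j) by case: j => [|j]; exact: measurable_itvL.
have -> : `[t0, +oo[%classic = \bigcup_j E j.
  apply/seteqP; split => s /=.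
    rewrite in_itv/= andbT => ts; exists (cell s) => //.
    have sc := cell_le s; case E1 : (cell s) sc => [|j] sc; rewrite /E/= in_itv/=.
      by rewrite ts.
    by rewrite (cell_lt E1).
  move=> [[|j] _]; rewrite /E/= !in_itv/= andbT => /andP[]//.
  by move=> /ltW/(le_trans (grid_ge _)).
apply/measurable_fun_bigcup; [exact: mE|move=> j].
have mj : measurable_fun (E j) (fun s : lebR => h s (euler_node j) i 0).
  apply: (measurable_funS (measurable_itvL `[t0, +oo[) _ (h_measurable _ _)).
  move=> s; case: j => [|j]; rewrite /E/= !in_itv/= andbT => /andP[]//.
  by move=> /ltW/(le_trans (grid_ge _)).
apply: eq_measurable_fun mj => s; rewrite inE /euler_piecewise => Es.
suff -> : cell s = j by [].
case: j Es => [|j]; rewrite /E/= in_itv/= => /andP[s1 s2]; last exact: cellP.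
by rewrite /cell; case: ex_minnP => m _ /(_ 0%N s2); rewrite leqn0 => /eqP.
Qed.

Lemma euler_rhs_bound T alpha s : growth_bound T alpha -> t0 <= s <= T ->
  `|h s (euler_piecewise s)| <= alpha s * state_bound alpha T.
Proof.
move=> ha sT; have [ia a0] := ha; have [as0 hs] := a0 s sT.
by apply: le_trans (hs _) _; rewrite ler_wpM2l//; exact: euler_piecewise_bound.
Qed.

Lemma integrable_rhs_bound T alpha : growth_bound T alpha ->
  integrable_on t0 T (fun s => alpha s * state_bound alpha T).
Proof.
by move=> [ia _]; exact: integrable_onZr.
Qed.

Lemma euler_rhs_integrable T i :
  integrable_on t0 T (fun s => h s (euler_piecewise s) i 0).
Proof.
have [alpha ha] := h_bounded T.
apply: integrable_dominated (integrable_rhs_bound ha) _.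
  apply: (measurable_funS (measurable_itvL `[t0, +oo[) _ (euler_rhs_measurable _)).
  by move=> t /=; rewrite !in_itv/= => /andP[->].
move=> t tT; apply: le_trans (euler_rhs_bound ha tT); exact: coord_le_norm.
Qed.

Lemma euler_polygon_grid i : euler_polygon (grid i) = euler_node i.
Proof.
elim: i => [|i IH]; first by rewrite /euler_polygon grid0 vint_nil ?addr0.
have gg := grid_le (leqnSn i).
rewrite /euler_polygon (vint_add (lexx t0) (grid_ge i) gg (lexx _)); last first.
  by move=> j; exact: euler_rhs_integrable.
rewrite addrA -/(euler_polygon (grid i)) IH /=; congr (_ + _).
by apply: eq_vint => r ir ri; rewrite /euler_piecewise (cellP ir ri).
Qed.

Lemma euler_piecewiseE s : t0 <= s -> exists s', [/\ t0 <= s', s' <= s, s - s' <= recip k &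
  euler_piecewise s = euler_polygon s'].
Proof.
move=> ts; exists (grid (cell s)); split; [exact: grid_ge|exact: grid_cell_le| |].
  have := cell_le s; rewrite gridS /w => *; lra.
by rewrite euler_polygon_grid.
Qed.

Lemma euler_polygon_dist T alpha s t : growth_bound T alpha -> t0 <= s -> s <= t -> t <= T ->
  `|euler_polygon t - euler_polygon s| <= lint alpha s t * state_bound alpha T.
Proof.
move=> ha ts st tT; have [ia _] := ha.
have irhs j := @euler_rhs_integrable T j.
rewrite /euler_polygon (vint_add (lexx t0) ts st tT irhs).
rewrite opprD addrACA subrr add0r [X in X - _]addrC addrK.
rewrite -(lintZ _ ts tT ia).
apply: (vint_norm ts st tT irhs (integrable_rhs_bound ha)) => r sr rt.
by apply: euler_rhs_bound; [|apply/andP; split; lra].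
Qed.

End step.
End euler_scheme.

Section existence.
Context {R : realType} {n : nat}.
Local Notation mu := (@completed_lebesgue_measure R).
Local Notation lebR := (caratheodory_type (@wlength R idfun)^*%mu).

Lemma dominated_Rintegral (D : set lebR) (f_ : nat -> R -> R) (f g : R -> R) :
  measurable D -> (forall k, measurable_fun D (f_ k)) ->
  (forall t, D t -> (f_ k t @[k --> \oo] --> f t)) ->
  mu.-integrable D (EFin \o g) -> (forall k t, D t -> `|f_ k t| <= g t) ->
  mu.-integrable D (EFin \o f) /\
  (\int[mu]_(t in D) f_ k t @[k --> \oo] --> \int[mu]_(t in D) f t).
Proof.
move=> mD mf cf ig fg.
have mfE k : measurable_fun D (EFin \o f_ k) by exact/measurable_EFinP.
have mfl : measurable_fun D (EFin \o f).
  by apply/measurable_EFinP; exact: measurable_fun_cvg mf cf.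
have cfE : {ae mu, forall t, D t -> ((EFin \o f_ k) t @[k --> \oo] --> (EFin \o f) t)}.
  apply: aeW => t Dt; apply: cvg_EFin; first by near=> k.
  exact: cf.
have fgE : {ae mu, forall t, forall k, D t -> (`|(EFin \o f_ k) t| <= (EFin \o g) t)%E}.
  by apply: aeW => t k Dt; rewrite lee_fin; exact: fg.
have [i1 _ i3] := dominated_convergence mD mfE mfl cfE ig fgE.
split => //; apply: fine_cvg; rewrite /Rintegral fineK//.
exact: integrable_fin_num.
Unshelve. all: by end_near. Qed.

Section limit_of_euler_scheme.
Variables (h : R -> 'cV[R]_n -> 'cV[R]_n) (t0 : R) (x0 : 'cV[R]_n).
Hypothesis h_measurable : forall xi i,
  measurable_fun (`[t0, +oo[ : set lebR) (fun t => h t xi i 0).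
Hypothesis h_continuous : forall t, t0 <= t -> continuous (h t).
Hypothesis h_bounded : forall T, exists alpha, growth_bound h t0 T alpha.

(** All polygons have increments bounded by the integral of one function. *)
Lemma euler_equicontinuous (T e : R) : 0 < e -> exists2 d : R, 0 < d & forall k s t,
    t0 <= s <= T -> t0 <= t <= T -> `|s - t| < d ->
    `|euler_polygon h t0 x0 k s - euler_polygon h t0 x0 k t| <= e.
Proof.
move=> e0; have [alpha ha] := h_bounded T; have [ia a0] := ha.
have S0 : 0 < state_bound t0 x0 alpha T by rewrite mulr_gt0 ?expR_gt0// ltr_wpDr.
have eS : 0 < e / state_bound t0 x0 alpha T by rewrite divr_gt0.
have [d d0 dP] := lint_small ia eS; exists d => // k.
suff half s t : t0 <= s -> s <= t -> t <= T -> `|s - t| < d ->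
    `|euler_polygon h t0 x0 k t - euler_polygon h t0 x0 k s| <= e.
  move=> s t /andP[ts sT] /andP[tt tT] st; have [h'|h'] := leP s t.
    by rewrite cdistC half.
  by apply: half => //; [exact: ltW|rewrite distrC].
move=> ts st tT std.
have hd := euler_polygon_dist x0 h_measurable h_bounded k ha ts st tT.
apply: le_trans hd _.
rewrite -ler_pdivlMr//.
have tsd : t - s < d by move: std; rewrite distrC ger0_norm// subr_ge0.
apply: le_trans (ltW (dP s t ts st tT tsd)).
apply: (lint_le ts tT ia (integrable_on_norm ia)) => r _ _; exact: ler_norm.
Qed.

Lemma euler_pointwise_bounded t : t0 <= t -> exists C : R, forall k, `|euler_polygon h t0 x0 k t| <= C.
Proof.
move=> tt; have [alpha ha] := h_bounded t.
exists (lint alpha t0 t * state_bound t0 x0 alpha t + `|x0|) => k.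
have := euler_polygon_dist x0 h_measurable h_bounded k ha (lexx t0) tt (lexx t).
rewrite {2}/euler_polygon vint_nil// addr0 => h1.
have := cnorm_sub (euler_polygon h t0 x0 k t) x0 => *; lra.
Qed.

(** Peano's argument: the Euler polygons are equicontinuous and bounded, so
    a subsequence converges locally uniformly; the frozen states converge to
    the same limit, and dominated convergence passes to the limit in the
    integral equation. *)
Theorem caratheodory_existence : exists x : R -> 'cV[R]_n,
  (forall T i, integrable_on t0 T (fun s => h s (x s) i 0)) /\
  forall t, t0 <= t -> x t = x0 + vint (fun s => h s (x s)) t0 t.
Proof.
have [phi [y [phij yP]]] := arzela_ascoli euler_pointwise_bounded euler_equicontinuous.
pose u j s := euler_piecewise h t0 x0 (phi j) s.
have cu s i : t0 <= s -> h s (u j s) i 0 @[j --> \oo] --> h s (y s) i 0.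
  move=> ts; apply/cvgrPdist_lt => e e0.
  have /ccontinuousP/(_ e e0)[d d0 dP] := @h_continuous s ts (y s).
  have d20 : 0 < d / 2 by lra.
  have [J JP] := yP s ts (d / 2) d20.
  have [d1 d10 d1P] := euler_equicontinuous s d20.
  have [N NP] := recip_lt d10.
  exists (maxn J N) => // j /=; rewrite geq_max => /andP[Jj Nj].
  have hd : `|y s - u j s| < d.
    have [s' [ts' s's ss' us]] := euler_piecewiseE x0 h_measurable h_bounded (phi j) ts.
    have h1 := JP j Jj.
    have h2 := NP _ (leq_trans Nj (phij j)).
    have h3 : `|euler_polygon h t0 x0 (phi j) s - euler_polygon h t0 x0 (phi j) s'| <= d / 2.
      apply: d1P; rewrite ?ts ?ts' ?lexx ?s's//.
      by rewrite ger0_norm ?subr_ge0//; exact: le_lt_trans h2.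
    rewrite /u us; apply: le_lt_trans (cdist_triangle (euler_polygon h t0 x0 (phi j) s) _ _) _.
    by rewrite cdistC; clear - h1 h3; lra.
  have := le_lt_trans (coord_le_norm _ i) (dP _ hd); by rewrite !mxE.
have mu_ D j i : measurable (D : set lebR) -> D `<=` `[t0, +oo[ ->
    measurable_fun D (fun s => h s (u j s) i 0).
  move=> mD Dt; apply: (measurable_funS (measurable_itvL `[t0, +oo[) Dt).
  exact: euler_rhs_measurable.
have main T D i : measurable (D : set lebR) -> D `<=` `[t0, T] ->
    mu.-integrable D (EFin \o (fun s => h s (y s) i 0)) /\
    (\int[mu]_(s in D) h s (u j s) i 0 @[j --> \oo] --> \int[mu]_(s in D) h s (y s) i 0).
  move=> mD DT; have [alpha ha] := h_bounded T.
  have Dt : D `<=` `[t0, +oo[.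
    by move=> s /DT; rewrite /= !in_itv/= => /andP[->].
  apply: (dominated_Rintegral (g := fun s => alpha s * state_bound t0 x0 alpha T)).
  - exact: mD.
  - by move=> j; exact: mu_.
  - by move=> t /Dt /=; rewrite in_itv/= andbT; exact: cu.
  - apply: (integrableS (measurable_itvL `[t0, T])) => //.
    exact: integrable_rhs_bound ha.
  - move=> j t /DT /=; rewrite in_itv/= => tT.
    apply: le_trans (euler_rhs_bound x0 h_measurable (phi j) ha tT).
    exact: coord_le_norm.
exists y; split => [T i|t tt].
  by have [] := main T _ i (measurable_itvL `[t0, T]) (@subset_refl _ _).
apply/colP => i; rewrite !mxE.
have sub : (`]t0, t]%classic : set R) `<=` `[t0, t].
  by move=> s /=; rewrite !in_itv/= => /andP[/ltW-> ->].
have [_ cI] := main t _ i (measurable_itvL `]t0, t]) sub.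
have c1 : euler_polygon h t0 x0 (phi j) t i 0 @[j --> \oo] --> x0 i 0 + lint (fun s => h s (y s) i 0) t0 t.
  have -> : (fun j => euler_polygon h t0 x0 (phi j) t i 0) =
      (fun j => x0 i 0 + \int[mu]_(s in `]t0, t]) h s (u j s) i 0).
    by apply/funext => j; rewrite /euler_polygon !mxE.
  by apply: cvgD => //; exact: cvg_cst.
have c2 : euler_polygon h t0 x0 (phi j) t i 0 @[j --> \oo] --> y t i 0.
  apply/cvgrPdist_lt => e e0; have [J JP] := yP t tt e e0.
  exists J => // j /= Jj; have := le_lt_trans (coord_le_norm _ i) (JP j Jj).
  by rewrite !mxE distrC.
exact: (cvg_unique _ c2 c1).
Qed.

End limit_of_euler_scheme.
End existence.

(** * The Euclidean norm *)

Section euclidean_norm.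
Context {R : realType}.

Lemma sum_sqr_ge0 n (u : 'cV[R]_n) : 0 <= \sum_i (u i 0) ^+ 2.
Proof. by apply: sumr_ge0 => i _; exact: sqr_ge0. Qed.

Lemma enorm_ge0 n (u : 'cV[R]_n) : 0 <= enorm u.
Proof. exact: sqrtr_ge0. Qed.

Lemma sqr_enorm n (u : 'cV[R]_n) : enorm u ^+ 2 = \sum_i (u i 0) ^+ 2.
Proof. by rewrite sqr_sqrtr// sum_sqr_ge0. Qed.

Lemma norm_le_enorm n (u : 'cV[R]_n) : `|u| <= enorm u.
Proof.
apply: norm_le_coord => [|i]; first exact: enorm_ge0.
rewrite -sqrtr_sqr ler_sqrt ?sum_sqr_ge0// (bigD1 i)//= lerDl.
by apply: sumr_ge0 => j _; exact: sqr_ge0.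
Qed.

Lemma enorm_le_sum n (u : 'cV[R]_n) : enorm u <= \sum_i `|u i 0|.
Proof.
have S0 : 0 <= \sum_i `|u i 0| by apply: sumr_ge0.
rewrite -(ger0_norm S0) -sqrtr_sqr ler_sqrt ?sqr_ge0//.
rewrite expr2 mulr_suml; apply: ler_sum => i _.
rewrite -real_normK ?num_real// expr2 ler_wpM2l//.
by rewrite (bigD1 i)//= lerDl; apply: sumr_ge0.
Qed.

Lemma enorm_le_norm n (u : 'cV[R]_n) : enorm u <= n%:R * `|u|.
Proof.
apply: le_trans (enorm_le_sum u) _.
apply: (@le_trans _ _ (\sum_(i < n) `|u|)).
  by apply: ler_sum => i _; exact: coord_le_norm.
by rewrite sumr_const card_ord -[leLHS]mulr_natl.
Qed.

Lemma enormZ n (c : R) (u : 'cV[R]_n) : enorm (c *: u) = `|c| * enorm u.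
Proof.
rewrite /enorm -sqrtr_sqr -sqrtrM ?sqr_ge0// mulr_sumr; congr Num.sqrt.
by apply: eq_bigr => i _; rewrite mxE exprMn.
Qed.

Lemma opnorm_has_sup k l (M : 'M[R]_(k, l)) :
  has_sup [set enorm (M *m u) | u in [set u : 'cV[R]_l | enorm u <= 1]].
Proof.
have e0 : enorm (0 : 'cV[R]_l) = 0 by rewrite -[X in enorm X](scale0r 0) enormZ normr0 mul0r.
split; first by exists (enorm (M *m 0)); exists 0 => //=; rewrite e0 ler01.
have [C C0 MC] := mulmx_bounded M.
exists (k%:R * C) => _ [u /= u1 <-].
apply: le_trans (enorm_le_norm _) _; rewrite ler_wpM2l//.
apply: le_trans (MC u) _; rewrite -[leRHS]mulr1 ler_pM2l//.
exact: le_trans (norm_le_enorm u) u1.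
Qed.

Lemma enorm_mulmx k l (M : 'M[R]_(k, l)) u : enorm (M *m u) <= opnorm M * enorm u.
Proof.
have [u0|u0] := eqVneq (enorm u) 0.
  have : u = 0.
    by apply/eqP; rewrite -normr_le0 -u0; exact: norm_le_enorm.
  move=> ->; rewrite mulmx0 -[X in enorm X](scale0r 0) enormZ normr0 mul0r.
  by rewrite -[X in enorm X](scale0r 0) enormZ normr0 mul0r mulr0.
have up : 0 < enorm u by rewrite lt_neqAle eq_sym u0 enorm_ge0.
rewrite -ler_pdivrMr// -[X in _ / X]ger0_norm ?enorm_ge0// mulrC -normfV -enormZ scalemxAr.
apply: ub_le_sup; first exact: (opnorm_has_sup M).2.
exists ((enorm u)^-1 *: u) => //=.
by rewrite enormZ normfV ger0_norm ?enorm_ge0// mulVf.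
Qed.

Lemma opnorm_ge0 k l (M : 'M[R]_(k, l)) : 0 <= opnorm M.
Proof.
apply: le_trans (enorm_ge0 (M *m 0)) _; apply: ub_le_sup.
  exact: (opnorm_has_sup M).2.
by exists 0 => //=; rewrite -[X in enorm X](scale0r 0) enormZ normr0 mul0r ler01.
Qed.

(** The triangle inequality [|z + w| <= |z| + |w|] in disguise, in the form
    needed for coercivity.  Squaring it and using Young's inequality with
    weights [q] and [1 - q] in each coordinate avoids Cauchy-Schwarz. *)
Lemma enorm_le_contraction n (z w : 'cV[R]_n) (q : R) : 0 <= q -> q < 1 ->
  enorm w <= q * enorm (z + w) -> (1 - q) * enorm (z + w) <= enorm z.
Proof.
move=> q0 q1 wq; have [q00|qp] := eqVneq q 0.
  have w0 : w = 0.
    by apply/eqP; rewrite -normr_le0; apply: le_trans (norm_le_enorm w) _; move: wq; rewrite q00 mul0r.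
  by rewrite w0 addr0 q00 subr0 mul1r.
have {}q0 : 0 < q by rewrite lt_neqAle eq_sym qp.
have q1' : 0 < 1 - q by lra.
suff sq : ((1 - q) * enorm (z + w)) ^+ 2 <= enorm z ^+ 2.
  have n1 : 0 <= (1 - q) * enorm (z + w) by rewrite mulr_ge0 ?enorm_ge0// ltW.
  by rewrite -(@ler_pXn2r _ 2) ?nnegrE ?enorm_ge0.
have young : q * (1 - q) * enorm (z + w) ^+ 2 <= q * enorm z ^+ 2 + (1 - q) * enorm w ^+ 2.
  rewrite !sqr_enorm !mulr_sumr -big_split/=; apply: ler_sum => i _.
  rewrite mxE; move: (z i 0) (w i 0) => a b.
  have := sqr_ge0 (q * a - (1 - q) * b) => h.
  have : q * a ^+ 2 + (1 - q) * b ^+ 2 - q * (1 - q) * (a + b) ^+ 2 = (q * a - (1 - q) * b) ^+ 2 by ring.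
  move=> *; lra.
have w2 : enorm w ^+ 2 <= q ^+ 2 * enorm (z + w) ^+ 2.
  have n1 : 0 <= q * enorm (z + w) by rewrite mulr_ge0 ?enorm_ge0// ltW.
  by rewrite -exprMn ler_pXn2r ?nnegrE ?enorm_ge0.
rewrite exprMn -(ler_pM2l q0).
move: (enorm (z + w) ^+ 2) (enorm z ^+ 2) (enorm w ^+ 2) young w2 => X Z W h1 h2.
have : (1 - q) * W <= (1 - q) * (q ^+ 2 * X) by rewrite ler_pM2l.
have : q * (1 - q) * X - (1 - q) * (q ^+ 2 * X) = q * ((1 - q) ^+ 2 * X) by ring.
move=> *; lra.
Qed.

End euclidean_norm.

(** * Linear growth of the system *)

Section lure_growth.
Context {R : realType} {n m me p : nat} (sys : lure R n m me p).
Local Notation mu := (@completed_lebesgue_measure R).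
Local Notation lebR := (caratheodory_type (@wlength R idfun)^*%mu).
Local Notation f := (nonlin sys).

Hypothesis f_locally_bounded : forall K : set 'cV[R]_p, compact K ->
  exists phi : R -> R,
    [/\ L1_loc nonneg phi,
        (forall t : R, 0 <= t -> 0 <= phi t) &
        forall t : R, 0 <= t ->
          (ereal_sup [set (enorm (f t xi))%:E | xi in K] <= (phi t)%:E)%E].
Hypothesis f_growth : forall T : set R, compact T -> T `<=` nonneg ->
  exists rho c : R,
    [/\ 0 < rho, 0 < c, c * opnorm (matD sys) < 1 &
        ae_on T (fun t =>
          (ereal_sup [set (enorm (f t xi) / enorm xi)%:E
                     | xi in [set xi : 'cV[R]_p | (rho <= enorm xi)%R]]
           <= c%:E)%E)].

(** An affine bound, more than properness, because it also makes the output grow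
    at most linearly with the state. *)
Definition coercive (F : 'cV[R]_p -> 'cV[R]_p) : Prop :=
  exists A B : R, 0 <= B /\ forall xi, `|xi| <= A + B * `|F xi|.

(** Inside the ball of radius [rho] the nonlinearity is bounded by [phi t];
    outside it has slope at most [c].  Since
    [c * opnorm D < 1], the term [D f (t, xi)] cannot compensate [xi] in
    [F_t xi] outside the ball, which gives coercivity with constants
    independent of [t]. *)
Lemma nonlin_growth (T : R) : exists (phi : R -> R) (A B c : R),
  [/\ integrable_on 0 T phi, 0 <= B, 0 <= c & ae_on `[0, T] (fun t =>
    [/\ 0 <= phi t, forall xi, `|f t xi| <= phi t + c * `|xi| &
        forall xi, `|xi| <= A + B * `|Fmap sys t xi|])].
Proof.
have sub : (`[0, T]%classic : set R) `<=` nonneg.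
  by move=> t; rewrite /nonneg/= !in_itv/= andbT => /andP[].
have [rho [c [rho0 c0 cD aeg]]] := f_growth (@segment_compact R 0 T) sub.
have [phi [phi1 phi0 phib]] := f_locally_bounded (@closed_ball_compact_cV R p rho).
set q := c * opnorm (matD sys) in cD.
have q0 : 0 <= q by rewrite mulr_ge0 ?opnorm_ge0// ltW.
have q1 : 0 < 1 - q by lra.
(* the factors p compare the Euclidean norm with the sup norm *)
exists phi, rho, (p%:R / (1 - q)), (c * p%:R); split.
- exact: phi1.
- by rewrite divr_ge0// ltW.
- by rewrite mulr_ge0// ltW.
have FF := ae_filter_ringOfSetsType mu.
apply: (@filterS _ (almost_everywhere mu) FF _ _ _ aeg) => t ht tT.
have t0 : 0 <= t by move: tT; rewrite /= in_itv/= => /andP[].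
have far xi : rho <= enorm xi -> enorm (f t xi) <= c * enorm xi.
  move=> rxi; have e0 : 0 < enorm xi := lt_le_trans rho0 rxi.
  rewrite -ler_pdivrMr// -lee_fin; apply: le_trans (ht tT).
  by apply: ereal_sup_ubound; exists xi.
have close xi : `|xi| <= rho -> enorm (f t xi) <= phi t.
  move=> rxi; rewrite -lee_fin; apply: le_trans (phib t t0).
  by apply: ereal_sup_ubound; exists xi.
split; first exact: phi0.
- move=> xi; apply: le_trans (norm_le_enorm _) _.
  have [rxi|rxi] := leP rho (enorm xi).
    apply: le_trans (far xi rxi) _; apply: (@le_trans _ _ (c * (p%:R * `|xi|))).
      by rewrite ler_pM2l// enorm_le_norm.
    by rewrite mulrA lerDr phi0.
  apply: le_trans (close xi (le_trans (norm_le_enorm _) (ltW rxi))) _.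
  by rewrite lerDl !mulr_ge0// ltW.
- move=> xi; have [rxi|rxi] := leP rho (enorm xi); last first.
    apply: le_trans (norm_le_enorm _) (le_trans (ltW rxi) _).
    by rewrite lerDl mulr_ge0// divr_ge0// ltW.
  have E : xi = Fmap sys t xi + matD sys *m f t xi by rewrite /Fmap subrK.
  have h : enorm (matD sys *m f t xi) <= q * enorm (Fmap sys t xi + matD sys *m f t xi).
    rewrite -E; apply: le_trans (enorm_mulmx _ _) _.
    by rewrite /q (mulrC c) -mulrA ler_wpM2l ?opnorm_ge0//; exact: far.
  have q1' : q < 1 by lra.
  have := enorm_le_contraction q0 q1' h; rewrite -E => h2.
  apply: le_trans (norm_le_enorm xi) _.
  have h3 : (1 - q) * enorm xi <= p%:R * `|Fmap sys t xi| := le_trans h2 (enorm_le_norm _).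
  apply: (@le_trans _ _ (p%:R / (1 - q) * `|Fmap sys t xi|)); last by rewrite lerDr ltW.
  by rewrite mulrAC ler_pdivlMr// mulrC.
Qed.

Definition output_eq (v : R -> 'cV[R]_me) t (x : 'cV[R]_n) (y : 'cV[R]_p) : Prop :=
  y = matC sys *m x + matD sys *m f t y + matDe sys *m v t.

Definition rhs (v : R -> 'cV[R]_me) t (x : 'cV[R]_n) (y : 'cV[R]_p) : 'cV[R]_n :=
  matA sys *m x + matB sys *m f t y + matBe sys *m v t.

Lemma output_eqP v t x y :
  output_eq v t x y <-> Fmap sys t y = matC sys *m x + matDe sys *m v t.
Proof.
rewrite /output_eq /Fmap; set a := matC sys *m x; set b := _ *m f t y; set c := _ *m v t.
split => [E|h]; last by rewrite addrAC -h subrK.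
by rewrite [X in X - _]E addrAC addrK.
Qed.

(** What is needed of the system at one time [t]; it holds at almost every
    time with [alpha] locally integrable. *)
Definition growth_at (v : R -> 'cV[R]_me) (alpha : R -> R) (K : R) t : Prop :=
  [/\ 0 <= alpha t, coercive (Fmap sys t) &
    forall x y, output_eq v t x y -> [/\ `|y| <= K * (1 + `|x|),
      `|f t y| <= alpha t * (1 + `|x|) & `|rhs v t x y| <= alpha t * (1 + `|x|)]].

(** Coercivity bounds the output affinely by the state and the input, the
    growth of the nonlinearity then bounds the feedback, and the input is
    essentially bounded on compact intervals. *)
Lemma rhs_growth (v : R -> 'cV[R]_me) (T : R) : vLinfty_loc nonneg v ->
  exists (alpha : R -> R) (K : R), [/\ integrable_on 0 T alpha, 0 <= K &
    ae_on `[0, T] (growth_at v alpha K)].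
Proof.
move=> vloc; have [phi [A [B [c [iphi B0 c0 aeg]]]]] := nonlin_growth T.
have sub : (`[0, T]%classic : set R) `<=` nonneg.
  by move=> t; rewrite /nonneg/= !in_itv/= andbT => /andP[].
have [_ [M aeM]] := vloc 0 T sub.
have [cA cA0 hA] := mulmx_bounded (matA sys).
have [cB cB0 hB] := mulmx_bounded (matB sys).
have [cE cE0 hE] := mulmx_bounded (matBe sys).
have [cC cC0 hC] := mulmx_bounded (matC sys).
have [cG cG0 hG] := mulmx_bounded (matDe sys).
pose K := `|A| + B * cC + B * (cG * `|M|).
have K0 : 0 <= K by rewrite /K !addr_ge0 ?mulr_ge0// ltW.
pose q := c * K + cA + cB * (c * K) + cE * `|M|.
pose alpha t := (1 + cB) * phi t + q.
exists alpha, K; split => //.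
  by apply: integrable_onD; [exact: integrable_onZ|exact: integrable_on_cst].
have FF := ae_filter_ringOfSetsType mu.
apply: (@filterS2 _ (almost_everywhere mu) FF _ _ _ _ aeg aeM) => t ht hM tT.
have [phi0 fle Fco] := ht tT; have {hM}vM : `|v t| <= `|M|.
  exact: le_trans (norm_le_enorm _) (le_trans (hM tT) (ler_norm _)).
have q0 : 0 <= q by rewrite /q !addr_ge0 ?mulr_ge0// ltW.
split; first by rewrite /alpha addr_ge0// mulr_ge0// addr_ge0// ltW.
  by exists A, B.
move=> x y /output_eqP Fy.
have X0 : 0 <= `|x| by exact: normr_ge0.
have Fb : `|Fmap sys t y| <= cC * `|x| + cG * `|M|.
  rewrite Fy; apply: le_trans (ler_normD _ _) _; apply: lerD; first exact: hC.
  by apply: le_trans (hG _) _; rewrite ler_pM2l.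
have yK : `|y| <= K * (1 + `|x|).
  apply: le_trans (Fco y) _.
  have h1 : B * `|Fmap sys t y| <= B * (cC * `|x| + cG * `|M|) by rewrite ler_wpM2l.
  have h2 := ler_norm A.
  have h3 : 0 <= `|A| * `|x| by rewrite mulr_ge0.
  have h4 : 0 <= B * cC by rewrite mulr_ge0// ltW.
  have h5 : 0 <= B * (cG * `|M|) * `|x| by rewrite !mulr_ge0// ltW.
  have -> : K * (1 + `|x|) = `|A| + `|A| * `|x| + B * cC + B * (cC * `|x| + cG * `|M|) +
     B * (cG * `|M|) * `|x| by rewrite /K; ring.
  lra.
have fK : `|f t y| <= (phi t + c * K) * (1 + `|x|).
  apply: le_trans (fle y) _; rewrite mulrDl; apply: lerD.
    by rewrite ler_peMr//; lra.
  by rewrite -mulrA ler_wpM2l.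
have cK0 : 0 <= c * K by rewrite mulr_ge0.
split => //.
  apply: le_trans fK _; rewrite ler_wpM2r//.
  have : 0 <= cB * phi t by rewrite mulr_ge0// ltW.
  have : 0 <= cB * (c * K) by rewrite mulr_ge0// ltW.
  have : 0 <= cE * `|M| by rewrite mulr_ge0// ltW.
  rewrite /alpha /q => *; lra.
rewrite /rhs; apply: le_trans (ler_normD _ _) _.
apply: (@le_trans _ _ ((cA * `|x| + cB * ((phi t + c * K) * (1 + `|x|))) + cE * `|M|)).
  apply: lerD.
    apply: le_trans (ler_normD _ _) _; apply: lerD; first exact: hA.
    by apply: le_trans (hB _) _; rewrite ler_pM2l.
  by apply: le_trans (hE _) _; rewrite ler_pM2l.
have h1 : 0 <= phi t * (1 + `|x|) by rewrite mulr_ge0//; lra.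
have h2 : 0 <= c * K * (1 + `|x|) by rewrite mulr_ge0//; lra.
have h3 : 0 <= cE * `|M| * `|x| by rewrite !mulr_ge0// ltW.
have -> : alpha t * (1 + `|x|) = phi t * (1 + `|x|) + cB * ((phi t + c * K) * (1 + `|x|)) +
  c * K * (1 + `|x|) + cA + cA * `|x| + cE * `|M| + cE * `|M| * `|x|.
  by rewrite /alpha /q; ring.
lra.
Qed.

End lure_growth.

(** * Measurable dependence of an inverse map on a parameter *)

Section dense_sequence.
Context {R : realType} {p : nat}.

Definition rational_vector (j : nat) : 'cV[R]_p :=
  if unpickle j is Some u then \col_i ratr ((u : {ffun 'I_p -> rat}) i) else 0.

Lemma rational_vector_dense (x : 'cV[R]_p) (e : R) : 0 < e ->
  exists j, `|rational_vector j - x| < e.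
Proof.
move=> e0; have ex i : exists r : rat, `|ratr r - x i 0| < e.
  have xx : x i 0 - e < x i 0 + e by lra.
  have [r] := rat_in_itvoo xx; rewrite in_itv/= => /andP[r1 r2]; exists r.
  by rewrite ltr_norml; apply/andP; split; lra.
pose u : {ffun 'I_p -> rat} := [ffun i => sval (cid (ex i))].
exists (pickle u); apply: norm_lt_coord => // i.
rewrite /rational_vector pickleK !mxE ffunE; by case: cid.
Qed.

End dense_sequence.

Section measurable_inverse.
Context {R : realType} {p : nat}.
Local Notation mu := (@completed_lebesgue_measure R).
Local Notation lebR := (caratheodory_type (@wlength R idfun)^*%mu).
Local Notation V := 'cV[R]_p.+1.

Section inverse_at.
Variable F : V -> V.
Hypotheses (cF : continuous F) (iF : locally_injective F) (coF : coercive F).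

Definition inverse (F : V -> V) (z : V) : V :=
  if pselect (exists xi, F xi = z) is left h then sval (cid h) else 0.

Lemma inverseK z : F (inverse F z) = z.
Proof.
rewrite /inverse; case: pselect => [h|[]]; first by case: cid.
exact: coercive_onto cF iF coF z.
Qed.

Lemma inverseE xi z : F xi = z -> inverse F z = xi.
Proof. by move=> Fxi; apply: (coercive_injective cF iF coF); rewrite inverseK. Qed.

(** Coercivity confines the preimages of a neighbourhood to a ball, on which
    the inverse is continuous by compactness. *)
Lemma inverse_continuous : continuous (inverse F).
Proof.
move=> z; apply/ccontinuousP => e e0.
have [A [B [B0 AB]]] := coF.
pose x := inverse F z; pose r := `|A| + B * (`|z| + 1) + `|x|.
have near z' : `|z - z'| < 1 -> `|inverse F z' - x| <= r.
  move=> zz'; apply: le_trans (ler_normB _ _) _; rewrite lerD2r.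
  apply: le_trans (AB _) _; rewrite inverseK; apply: lerD; first exact: ler_norm.
  rewrite ler_wpM2l//; have := cnorm_sub z' z; rewrite cdistC => *; lra.
have xr : `|x - x| <= r by rewrite subrr normr0 !addr_ge0// mulr_ge0// addr_ge0.
have inj : forall a b, `|a - x| <= r -> `|b - x| <= r -> F a = F b -> a = b.
  by move=> a b _ _; exact: (coercive_injective cF iF coF).
have [d d0 dP] := inverse_continuous_on_ball cF inj xr e0.
exists (Num.min d 1); first by rewrite lt_min d0 ltr01.
move=> z'; rewrite lt_min => /andP[z'd z'1].
by apply: dP; [exact: near|rewrite !inverseK].
Qed.

End inverse_at.

Variables (F : R -> V -> V) (S : set lebR).
Hypothesis mS : measurable S.
Hypothesis cF : forall t, S t -> continuous (F t).
Hypothesis iF : forall t, S t -> locally_injective (F t).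
Hypothesis coF : forall t, S t -> coercive (F t).
Hypothesis mF : forall xi i, measurable_fun S (fun t => F t xi i 0).

(** Approximate [F_t^-1 (z t)] by the first rational vector [q] with
    [|F_t q - z t| < 1 / (k + 1)] in the l1 norm.  This choice is measurable
    in [t], as it takes countably many values on measurable pieces; continuity
    of the inverse makes it converge to [F_t^-1 (z t)] for every [t]. *)
Lemma measurable_inverse_selection (G : R -> V -> R) (z : R -> V) :
  (forall xi, measurable_fun S (fun t => G t xi)) ->
  (forall t, S t -> continuous (G t)) ->
  (forall i, measurable_fun S (fun t => z t i 0)) ->
  measurable_fun S (fun t => G t (inverse (F t) (z t))).
Proof.
move=> mG cG mz.
pose N1 j t : R := \sum_i `|F t (rational_vector j) i 0 - z t i 0|.
have mN1 j : measurable_fun S (N1 j).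
  apply: measurable_sum => i; apply: measurableT_comp; first exact: normr_measurable.
  exact: measurable_funB.
pose A k j : set lebR := S `&` [set t | N1 j t < recip k].
have mA k j : measurable (A k j).
  have := mN1 j mS `]-oo, recip k[%classic (measurable_itv _).
  by congr measurable; apply/seteqP; split => t [St]; rewrite /= ?in_itv/=.
have exA k t : S t -> exists j, A k j t.
  move=> St; pose x := inverse (F t) (z t).
  have Fx : F t x = z t by apply: inverseK; [exact: cF|exact: iF|exact: coF].
  have e0 : 0 < @recip R k / p.+1%:R by rewrite divr_gt0 ?recip_gt0// ltr0n.
  have /ccontinuousP/(_ _ e0)[d d0 dP] := @cF t St x.
  have [j jd] := rational_vector_dense x d0; rewrite cdistC in jd.
  exists j; split => //=; have := dP _ jd; rewrite Fx => h.
  apply: (@lt_le_trans _ _ (\sum_(i < p.+1) (recip k / p.+1%:R))).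
    apply: ltr_sum => [|i _]; first by apply/hasP; exists ord0 => //; rewrite mem_index_enum.
    by apply: le_lt_trans h; rewrite cdistC; have := coord_le_norm (F t (rational_vector j) - z t) i; rewrite !mxE.
  by rewrite sumr_const card_ord -[leLHS]mulr_natl mulrC divfK// pnatr_eq0.
pose Q k t : V := rational_vector (xget 0%N [set j | seqDU (A k) j t]).
have Qj k j t : seqDU (A k) j t -> Q k t = rational_vector j.
  move=> tj; congr rational_vector; apply: xget_unique => // i ti.
  have /trivIsetP/(_ i j I I) := trivIset_seqDU (A k).
  have [//|ij /(_ isT)/seteqP[/(_ t) h _]] := eqVneq i j.
  by exfalso; apply: h.
have SE k : S = \bigcup_j seqDU (A k) j.
  rewrite -seqDU_bigcup_eq; apply/seteqP; split => t.
    by move=> /(exA k)[j Aj]; exists j.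
  by move=> [j _ []].
have mD k j : measurable (seqDU (A k) j).
  by apply: measurableD => //; apply: bigsetU_measurable.
have mQ k : measurable_fun S (fun t => G t (Q k t)).
  rewrite (SE k); apply/measurable_fun_bigcup; [exact: mD|move=> j].
  have Dj : seqDU (A k) j `<=` S by move=> t [[]].
  have mj : measurable_fun (seqDU (A k) j) (fun t : lebR => G t (rational_vector j)).
    exact: measurable_funS Dj (mG _).
  by apply: eq_measurable_fun mj => t; rewrite inE => /Qj ->.
apply: (measurable_fun_cvg mQ) => t St.
have iK w : F t (inverse (F t) w) = w by apply: inverseK; [exact: cF|exact: iF|exact: coF].
have iE xi w : F t xi = w -> inverse (F t) w = xi by apply: inverseE; [exact: cF|exact: iF|exact: coF].
set x := inverse (F t) (z t).
apply/cvgrPdist_lt => e e0.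
have /cvgrPdist_lt/(_ e e0)/cnbhsP[d d0 dP] := @cG t St x.
have ci : continuous (inverse (F t)).
  by apply: inverse_continuous; [exact: cF|exact: iF|exact: coF].
have /ccontinuousP/(_ _ d0)[d1 d10 d1P] := @ci (z t).
have [N NP] := recip_lt d10.
exists N => // k /= Nk; apply: dP.
have [j Aj] : exists j, seqDU (A k) j t by move: St; rewrite {1}(SE k) => -[j _]; exists j.
rewrite (Qj _ _ _ Aj) -(iE _ _ (erefl (F t (rational_vector j)))); apply: d1P.
have [[_ /= NA] _] := Aj.
apply: le_lt_trans (NP k Nk); apply: le_trans (ltW NA).
apply: norm_le_coord => [|i]; first by apply: sumr_ge0.
by rewrite !mxE distrC /N1 (bigD1 i)//= lerDl sumr_ge0.
Qed.

End measurable_inverse.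

(** * Almost everywhere arguments *)

Section almost_everywhere.
Context {R : realType}.
Local Notation mu := (@completed_lebesgue_measure R).
Local Notation lebR := (caratheodory_type (@wlength R idfun)^*%mu).

Lemma ae_on_bigcup (J : set R) (I : nat -> set R) (P : R -> Prop) :
  J `<=` \bigcup_k I k -> (forall k, ae_on (I k) P) -> ae_on J P.
Proof.
move=> JI aeI; have : mu.-negligible (\bigcup_k ~` [set t | I k t -> P t]).
  by apply: negligible_bigcup => k; exact: aeI.
apply: negligibleS => t /= /not_implyP[/JI[k _ Ik] nP]; exists k => //=; exact/not_implyP.
Qed.

Lemma ae_onS (J I : set R) (P : R -> Prop) : J `<=` I -> ae_on I P -> ae_on J P.
Proof.
move=> JI; apply: negligibleS => t /= /not_implyP[/JI It nP]; exact/not_implyP.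
Qed.

Lemma ae_on_and (J : set R) (P Q : R -> Prop) :
  ae_on J P -> ae_on J Q -> ae_on J (fun t => P t /\ Q t).
Proof.
move=> aP aQ; have FF := ae_filter_ringOfSetsType mu.
apply: (@filterS2 _ (almost_everywhere mu) FF _ _ _ _ aP aQ) => t hP hQ Jt.
by split; [exact: hP|exact: hQ].
Qed.

Lemma ae_on_forall (I : finType) (J : set R) (P : I -> R -> Prop) :
  (forall i, ae_on J (P i)) -> ae_on J (fun t => forall i, P i t).
Proof.
move=> aP; have FF := ae_filter_ringOfSetsType mu.
have H := @filter_forall _ I (fun i t => J t -> P i t) (almost_everywhere mu) FF aP.
by apply: (@filterS _ (almost_everywhere mu) FF _ _ _ H) => t h Jt i; exact: h.
Qed.

Lemma ae_on_imply (J : set R) (P Q : R -> Prop) :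
  (forall t, J t -> P t -> Q t) -> ae_on J P -> ae_on J Q.
Proof.
move=> PQ; apply: negligibleS => t /= /not_implyP[Jt nQ].
by apply/not_implyP; split => // Pt; apply: nQ; exact: PQ.
Qed.

Lemma ae_on_neq (J : set R) (a : R) : ae_on J (fun t => t <> a).
Proof.
apply: (negligible_sub (N := [set a])).
- by move=> t /= /not_implyP[_ /contrapT].
- exact: measurable_set1.
- exact: lebesgue_measure_set1.
Qed.

Lemma measurable_fun_negligible (N : set lebR) (g : R -> R) :
  mu.-negligible N -> measurable_fun N g.
Proof.
by move=> nN mN A mA; apply: negligible_measurable; apply: negligibleS nN => t [].
Qed.

(** Stated with an almost everywhere bound, because the growth estimates hold
    only at almost every time. *)
Lemma integrable_dominated_ae (D : set lebR) (g beta : R -> R) : measurable D ->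
  measurable_fun D g -> mu.-integrable D (EFin \o beta) ->
  ae_on D (fun t => `|g t| <= beta t) -> mu.-integrable D (EFin \o g).
Proof.
move=> mD mg ib gb; apply/integrableP; split; first exact/measurable_EFinP.
have /integrableP[mb boo] := ib.
apply: le_lt_trans boo; apply: ae_ge0_le_integral.
- exact: mD.
- by move=> t _; rewrite lee_fin.
- by apply: measurableT_comp; [exact: abse_measurable|exact/measurable_EFinP].
- by move=> t _; rewrite lee_fin.
- by apply: measurableT_comp; [exact: abse_measurable|exact: mb].
- apply: ae_on_imply gb => t Dt /= gbt; rewrite lee_fin.
  exact: le_trans gbt (ler_norm _).
Qed.

Lemma lint_norm_le_ae (a b s t : R) (g beta : R -> R) : a <= s -> t <= b ->
  integrable_on a b g -> integrable_on a b beta ->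
  ae_on `[a, b] (fun r => `|g r| <= beta r) ->
  `|lint g s t| <= lint (fun r => `|beta r|) s t.
Proof.
move=> as_ tb ig ib gb; apply: le_trans (lint_norm as_ tb ig) _.
have iS := integrable_onS as_ tb.
have ign := iS _ (integrable_on_norm ig); have ibn := iS _ (integrable_on_norm ib).
have mD := measurable_itvL `]s, t].
rewrite /lint /Rintegral fine_le//; [exact: integrable_fin_num|exact: integrable_fin_num|].
apply: ae_ge0_le_integral.
- exact: mD.
- by move=> r _; rewrite lee_fin.
- exact: measurable_int ign.
- by move=> r _; rewrite lee_fin.
- exact: measurable_int ibn.
- have sub : (`]s, t]%classic : set R) `<=` `[a, b].
    by move=> r /=; rewrite !in_itv/= => /andP[r1 r2]; apply/andP; split; lra.
  apply: ae_on_imply (ae_onS sub gb) => r _ /= h; rewrite lee_fin.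
  exact: le_trans h (ler_norm _).
Qed.

Lemma measurable_fun_ray (a : R) (g : R -> R) :
  (forall b, measurable_fun (`[a, b] : set lebR) g) -> measurable_fun (`[a, +oo[ : set lebR) g.
Proof.
move=> mg; have -> : `[a, +oo[%classic = \bigcup_k (`[a, a + k%:R]%classic : set lebR).
  apply/seteqP; split => t /=; last by move=> [k _] /=; rewrite !in_itv/= andbT => /andP[].
  rewrite in_itv/= andbT => at_; exists (Num.trunc (t - a)).+1 => //=.
  have : 0 <= t - a by rewrite subr_ge0.
  by move=> /truncn_itv/andP[_ h]; rewrite in_itv/= at_/=; lra.
by apply/measurable_fun_bigcup => // k; exact: measurable_itvL.
Qed.

Lemma measurable_mulmx k l (M : 'M[R]_(k, l)) (D : set lebR) (g : R -> 'cV[R]_l) :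
  (forall j, measurable_fun D (fun t => g t j 0)) ->
  forall i, measurable_fun D (fun t => (M *m g t) i 0).
Proof.
move=> mg i; rewrite (_ : (fun _ => _) = fun t : lebR => \sum_j M i j * g t j 0); last first.
  by apply/funext => t; rewrite mxE.
by apply: measurable_sum => j; apply: measurable_funM => //; exact: measurable_cst.
Qed.

Lemma measurable_cD k (D : set lebR) (g g' : R -> 'cV[R]_k) :
  (forall j, measurable_fun D (fun t => g t j 0)) ->
  (forall j, measurable_fun D (fun t => g' t j 0)) ->
  forall i, measurable_fun D (fun t => (g t + g' t) i 0).
Proof.
move=> mg mg' i; rewrite (_ : (fun _ => _) = fun t : lebR => g t i 0 + g' t i 0); last first.
  by apply/funext => t; rewrite mxE.
exact: measurable_funD.
Qed.

End almost_everywhere.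

Section absolutely_continuous.
Context {R : realType}.
Local Notation mu := (@completed_lebesgue_measure R).
Local Notation lebR := (caratheodory_type (@wlength R idfun)^*%mu).

Lemma abs_continuous_coord n (a b : R) (x : R -> 'cV[R]_n) i :
  abs_continuous a b x -> abs_cont a b (fun t => x t i 0).
Proof.
move=> ax e /ax[d d0 dP]; exists d => // N s r sr tr sd.
apply: le_lt_trans (dP N s r sr tr sd); apply: ler_sum => j _.
apply: le_trans (norm_le_enorm _); apply: le_trans (coord_le_norm _ i).
by rewrite !mxE.
Qed.

Lemma coord_abs_continuous n (a b : R) (x : R -> 'cV[R]_n) :
  (forall i, abs_cont a b (fun t => x t i 0)) -> abs_continuous a b x.
Proof.
move=> ax e e0.
have en : 0 < e / n.+1%:R by rewrite divr_gt0// ltr0n.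
have ex i : exists d : R, 0 < d /\ forall (N : nat) (s r : 'I_N -> R),
      (forall i, [/\ a <= s i, s i <= r i & r i <= b]) ->
      trivIset [set: 'I_N] (fun i => `]s i, r i[%classic) ->
      \sum_i (r i - s i) < d -> \sum_j `|x (r j) i 0 - x (s j) i 0| < e / n.+1%:R.
  by have [d d0 dP] := ax i _ en; exists d.
pose d i := sval (cid (ex i)).
have dP i : 0 < d i /\ forall (N : nat) (s r : 'I_N -> R),
      (forall i, [/\ a <= s i, s i <= r i & r i <= b]) ->
      trivIset [set: 'I_N] (fun i => `]s i, r i[%classic) ->
      \sum_i (r i - s i) < d i -> \sum_j `|x (r j) i 0 - x (s j) i 0| < e / n.+1%:R.
  by rewrite /d; case: cid.
exists (\big[Num.min/1]_i d i).
  by apply: lt_bigmin => // i _; have [] := dP i.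
move=> N s r sr tr sd.
apply: (@le_lt_trans _ _ (\sum_(j < N) \sum_(i < n) `|x (r j) i 0 - x (s j) i 0|)).
  apply: ler_sum => j _; apply: le_trans (enorm_le_sum _) _.
  by apply: ler_sum => i _; rewrite !mxE.
rewrite exchange_big/=.
apply: (@le_lt_trans _ _ (\sum_(i < n) e / n.+1%:R)).
  apply: ler_sum => i _; apply/ltW/(dP i).2 => //.
  apply: lt_le_trans sd _; exact: bigmin_le.
rewrite sumr_const card_ord -[ltLHS]mulr_natl mulrCA.
by rewrite gtr_pMr// ltr_pdivrMr ?ltr0n// mul1r ltr_nat.
Qed.

Lemma abs_cont_uniform (a b : R) (x : R -> R) : abs_cont a b x ->
  forall e : R, 0 < e -> exists2 d : R, 0 < d & forall s t, a <= s <= b -> a <= t <= b ->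
    `|s - t| < d -> `|x s - x t| < e.
Proof.
move=> ax e e0; have [d d0 dP] := ax e e0; exists d => //.
suff half s t : a <= s -> s <= t -> t <= b -> t - s < d -> `|x t - x s| < e.
  move=> s t /andP[as_ sb] /andP[at_ tb] st; have [h|h] := leP s t.
    by rewrite distrC half//; move: st; rewrite distrC ger0_norm// subr_ge0.
  by apply: half => //; [exact: ltW|move: st; rewrite ger0_norm// subr_ge0 ltW].
move=> as_ st tb tsd; have := dP 1%N (fun=> s) (fun=> t).
rewrite !big_ord1; apply => //.
by apply/trivIsetP => i j _ _; rewrite (ord1 i) (ord1 j) eqxx.
Qed.

Lemma abs_cont_within_continuous (a b : R) (x : R -> R) :
  abs_cont a b x -> {within `[a, b], continuous x}.
Proof.
move=> ax; apply/subspace_continuousP => s; rewrite /= in_itv/= => sab.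
apply/cvgrPdist_lt => e e0; rewrite near_withinE.
have [d d0 dP] := abs_cont_uniform ax e0.
apply/nbhs_ballP; exists d => // t; rewrite /ball/= => st; rewrite in_itv/= => tab.
exact: dP.
Qed.

Lemma abs_cont_measurable (a b : R) (x : R -> R) :
  abs_cont a b x -> measurable_fun (`[a, b] : set lebR) x.
Proof.
move=> /abs_cont_within_continuous cx.
have mx := subspace_continuous_measurable_fun (measurable_itv `[a, b]) cx.
move=> _ A mA; apply: borel_measurable; exact: mx (measurable_itv _) _ mA.
Qed.

(** A uniformly continuous function on a compact interval is bounded, by
    interval induction with the modulus for 1. *)
Lemma abs_cont_bounded (a b : R) (x : R -> R) : a <= b -> abs_cont a b x ->
  exists M : R, forall t, a <= t <= b -> `|x t| <= M.
Proof.
move=> ab ax; have [d d0 dP] := abs_cont_uniform ax ltr01.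
have := @interval_induction R a b (fun t => exists M : R, forall s, a <= s <= t -> `|x s| <= M) ab.
apply.
  exists `|x a| => s; rewrite -eq_le => /eqP <-//.
move=> t tab; exists d => // u v au ut tv vb uvd [M MP].
exists (M + 1) => s /andP[as_ sv]; have [su|us] := leP s u.
  by apply: le_trans (MP s _) _; [rewrite as_|rewrite lerDl].
have := MP u; rewrite au lexx => /(_ isT).
have : `|x s - x u| < 1.
  apply: dP; [apply/andP; split; lra|apply/andP; split; lra|].
  by rewrite ger0_norm ?subr_ge0 ?ltW//; lra.
have := ler_distD (x u) (x s) 0; rewrite !subr0 => *; lra.
Qed.

End absolutely_continuous.

Section concatenation.
Context {R : realType}.
Local Notation mu := (@completed_lebesgue_measure R).
Local Notation lebR := (caratheodory_type (@wlength R idfun)^*%mu).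

(** The value at [tau] belongs to the left part, in accordance with integrals
    over half-open intervals [`]s, t]]. *)
Definition concat (T : Type) (tau : R) (g1 g2 : R -> T) (t : R) : T :=
  if t <= tau then g1 t else g2 t.

Lemma concat_left (T : Type) tau (g1 g2 : R -> T) t : t <= tau -> concat tau g1 g2 t = g1 t.
Proof. by rewrite /concat => ->. Qed.

Lemma concat_right (T : Type) tau (g1 g2 : R -> T) t : tau < t -> concat tau g1 g2 t = g2 t.
Proof. by rewrite /concat leNgt => ->. Qed.

Lemma concat_app (T U : Type) (h : R -> T -> U) tau (g1 g2 : R -> T) :
  (fun t => h t (concat tau g1 g2 t)) = concat tau (fun t => h t (g1 t)) (fun t => h t (g2 t)).
Proof. by apply/funext => t; rewrite /concat; case: ifP. Qed.

(** Pre-trajectories are controlled only on intervals [[a, b]] with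
    [b < tau]. *)
Lemma measurable_fun_exhaustion (a tau : R) (g : R -> R) : 
  (forall b, b < tau -> measurable_fun (`[a, b] : set lebR) g) ->
  measurable_fun (`[a, tau] : set lebR) g.
Proof.
move=> mg; pose E k : set lebR := `[a, tau - recip k]%classic.
have mE k : measurable (E k) by exact: measurable_itvL.
have mpt : measurable ([set tau] `&` `[a, tau] : set lebR).
  apply: measurableI; last exact: measurable_itvL.
  exact: negligible_measurable (negligible_sub (fun _ h => h) (measurable_set1 tau)
    (lebesgue_measure_set1 tau)).
rewrite (_ : `[a, tau]%classic = (\bigcup_k E k) `|` ([set tau] `&` `[a, tau])); last first.
  apply/seteqP; split => t /=; last first.
    move=> [[k _]|[]//]; rewrite /E/= !in_itv/= => /andP[-> tk]/=.
    by have := @recip_gt0 R k; lra.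
  rewrite in_itv/= => /andP[at_ tt]; have [tt'|tt'] := ltP t tau; last first.
    right; split; last by rewrite at_.
    by apply/eqP; rewrite eq_le tt.
  left; have t0 : 0 < tau - t by rewrite subr_gt0.
  have [k kP] := recip_lt t0; exists k => //; rewrite /E/= in_itv/= at_/=.
  by have := kP k (leqnn _); lra.
apply/measurable_funU => //; first exact: bigcup_measurable.
split; last first.
  apply: measurable_fun_negligible.
  apply: (negligible_sub (N := [set tau])); [by move=> t []|exact: measurable_set1|].
  exact: lebesgue_measure_set1.
apply/measurable_fun_bigcup => // k; apply: mg.
by have := @recip_gt0 R k; lra.
Qed.

Lemma measurable_concat (a tau : R) (g1 g2 : R -> R) : a <= tau ->
  measurable_fun (`[a, tau] : set lebR) g1 ->
  measurable_fun (`[tau, +oo[ : set lebR) g2 ->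
  measurable_fun (`[a, +oo[ : set lebR) (concat tau g1 g2).
Proof.
move=> at_ m1 m2.
rewrite (_ : `[a, +oo[%classic = `[a, tau]%classic `|` `]tau, +oo[%classic); last first.
  apply/seteqP; split => t /=; rewrite !in_itv/= !andbT.
    by move=> h; have [tt|tt] := leP t tau; [left; rewrite h|right].
  by case=> [/andP[]//|/ltW]; exact: le_trans.
apply/measurable_funU; [exact: measurable_itvL|exact: measurable_itvL|split].
  apply: eq_measurable_fun m1 => t; rewrite inE/= in_itv/= => /andP[_ h].
  by rewrite concat_left.
have m2' : measurable_fun (`]tau, +oo[ : set lebR) g2.
  apply: (measurable_funS (measurable_itvL `[tau, +oo[) _ m2).
  by move=> t /=; rewrite !in_itv/= !andbT; exact: ltW.
apply: eq_measurable_fun m2' => t; rewrite inE/= in_itv/= andbT => h.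
by rewrite concat_right.
Qed.

(** The concatenation is the sum of two functions extended by zero. *)
Lemma integrable_concat (a tau T : R) (g1 g2 : R -> R) :
  integrable_on a tau g1 -> integrable_on tau T g2 ->
  integrable_on a T (concat tau g1 g2).
Proof.
move=> i1 i2.
have i1' : mu.-integrable setT (EFin \o (g1 \_ `[a, tau])).
  by rewrite -restrict_EFin; exact/(integrable_mkcond _ (measurable_itvL _)).
have i2' : mu.-integrable setT (EFin \o (g2 \_ `]tau, T])).
  rewrite -restrict_EFin; apply/(integrable_mkcond _ (measurable_itvL _)).
  exact: integrable_onS i2.
have iD : integrable_on a T (fun t => (g1 \_ `[a, tau]) t + (g2 \_ `]tau, T]) t).
  by apply: integrable_onD; apply: (integrableS measurableT (measurable_itvL _) _).
apply: (eq_integrable (measurable_itvL _) _ _ _ iD) => t; rewrite inE/= in_itv/= => /andP[at_ tT].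
congr EFin; rewrite /patch !mem_setE !in_itv/= at_ tT/= andbT /concat ltNge.
by case: ifP; rewrite ?addr0 ?add0r.
Qed.

Lemma abs_continuous_bounded n (a b : R) (x : R -> 'cV[R]_n) : a <= b ->
  (forall i, abs_cont a b (fun t => x t i 0)) ->
  exists X : R, 0 <= X /\ forall t, a <= t <= b -> `|x t| <= X.
Proof.
move=> ab ax; pose M i := sval (cid (abs_cont_bounded ab (ax i))).
have MP i t : a <= t <= b -> `|x t i 0| <= M i.
  by rewrite /M; case: cid => /= N NP; exact: NP.
have pos : 0 <= \sum_i `|M i| by rewrite sumr_ge0.
exists (\sum_i `|M i|); split => // t tab; apply: norm_le_coord => // i.
apply: le_trans (MP i t tab) _; apply: le_trans (ler_norm _) _.
by rewrite (bigD1 i)//= lerDl sumr_ge0.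
Qed.

End concatenation.

(** * Global solutions of the system *)

Section lure_existence.
Context {R : realType} {n m me p' : nat} (sys : lure R n m me p'.+1).
Local Notation p := p'.+1.
Local Notation mu := (@completed_lebesgue_measure R).
Local Notation lebR := (caratheodory_type (@wlength R idfun)^*%mu).
Local Notation f := (nonlin sys).

Hypothesis f_caratheodory : caratheodory f.
Hypothesis F_locally_injective : forall t : R, 0 <= t -> locally_injective (Fmap sys t).
Hypothesis growth : forall (v : R -> 'cV[R]_me) (T : R), vLinfty_loc nonneg v ->
  exists (alpha : R -> R) (K : R), [/\ integrable_on 0 T alpha, 0 <= K &
    ae_on `[0, T] (growth_at sys v alpha K)].

Lemma ray_sub_nonneg (t0 : R) : 0 <= t0 -> (`[t0, +oo[%classic : set R) `<=` nonneg.
Proof. by move=> h t; rewrite /nonneg/= !in_itv/= !andbT; exact: le_trans. Qed.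

Lemma vLinfty_measurable (v : R -> 'cV[R]_me) (t0 : R) : 0 <= t0 -> vLinfty_loc nonneg v ->
  forall i, measurable_fun (`[t0, +oo[ : set lebR) (fun t => v t i 0).
Proof.
move=> t00 vloc i; apply: measurable_fun_ray => b.
have sub : (`[t0, b]%classic : set R) `<=` nonneg.
  by move=> t; rewrite /nonneg/= !in_itv/= andbT => /andP[/(le_trans t00)].
by have [mv _] := vloc t0 b sub.
Qed.

Lemma nonlin_measurable (t0 : R) xi i : 0 <= t0 ->
  measurable_fun (`[t0, +oo[ : set lebR) (fun t => f t xi i 0).
Proof.
move=> t00; have [_ mf] := f_caratheodory.
exact: (measurable_funS (measurable_itvL `[0, +oo[) (ray_sub_nonneg t00) (mf xi i)).
Qed.

Lemma Fmap_continuous t : 0 <= t -> continuous (Fmap sys t).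
Proof.
move=> t0 xi; have [cf _] := f_caratheodory.
apply: (@ccontinuousB _ _ _ id (fun xi => matD sys *m f t xi)); first exact: cvg_id.
apply: (@continuous_comp _ _ _ (f t) (fun u => matD sys *m u)); first exact: cf.
exact: mulmx_continuous.
Qed.

Section from_integral_equation.
Variables (t0 : R) (v : R -> 'cV[R]_me) (x w : R -> 'cV[R]_n) (y : R -> 'cV[R]_p).
Hypothesis t00 : 0 <= t0.
Hypothesis vloc : vLinfty_loc nonneg v.
Hypothesis iw : forall T i, integrable_on t0 T (fun t => w t i 0).
Hypothesis xE : forall t, t0 <= t -> x t = x t0 + vint w t0 t.
Hypothesis eqs : ae_on `[t0, +oo[ (fun t => output_eq sys v t (x t) (y t) /\
  w t = rhs sys v t (x t) (y t)).
Hypothesis my : forall i, measurable_fun (`[t0, +oo[ : set lebR) (fun t => y t i 0).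
Hypothesis mfy : forall i, measurable_fun (`[t0, +oo[ : set lebR) (fun t => f t (y t) i 0).

(** The integral equation bounds the state in terms of the integrable
    function [w] alone, independently of any growth estimate. *)
Lemma state_bounded T : exists X : R, 0 <= X /\ forall t, t0 <= t <= T -> `|x t| <= X.
Proof.
pose X := `|x t0| + \sum_i lint (fun t => `|w t i 0|) t0 T.
have pos i s : 0 <= lint (fun t => `|w t i 0|) t0 s by apply: lint_ge0.
exists X; split=> [|t /andP[tt tT]]; first by rewrite addr_ge0// sumr_ge0.
rewrite xE//; apply: le_trans (ler_normD _ _) _; rewrite lerD2l.
apply: norm_le_coord => [|i]; first by rewrite sumr_ge0.
rewrite mxE; apply: le_trans (lint_norm (lexx t0) tT (iw T i)) _.
rewrite (bigD1 i)//=; apply: (@le_trans _ _ (lint (fun t => `|w t i 0|) t0 T)).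
  rewrite (lint_add (lexx t0) tt tT (lexx T) (integrable_on_norm (iw T i))) lerDl.
  exact: lint_ge0.
by rewrite lerDl sumr_ge0.
Qed.

Lemma state_coordB i s t : t0 <= s -> t0 <= t ->
  x t i 0 - x s i 0 = lint (fun r => w r i 0) t0 t - lint (fun r => w r i 0) t0 s.
Proof. by move=> ts tt; rewrite (xE ts) (xE tt) !mxE opprD addrACA subrr add0r. Qed.

Lemma horizon_itvE : horizon_itv t0 +oo%E = `[t0, +oo[%classic.
Proof.
by apply/seteqP; split => t; rewrite /horizon_itv/= in_itv/= andbT ltry; [case|].
Qed.

Lemma output_integrable (z : R -> R) (T : R) :
  measurable_fun (`[t0, +oo[ : set lebR) z ->
  (exists2 beta : R -> R, integrable_on t0 T beta & ae_on `[t0, T] (fun t => `|z t| <= beta t)) ->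
  integrable_on t0 T z.
Proof.
move=> mz [beta ib zb].
apply: integrable_dominated_ae ib zb; first exact: measurable_itvL.
apply: (measurable_funS (measurable_itvL `[t0, +oo[) _ mz).
by move=> t /=; rewrite !in_itv/= => /andP[->].
Qed.

Lemma output_L1 T : (forall i, integrable_on t0 T (fun t => y t i 0)) /\
  (forall i, integrable_on t0 T (fun t => f t (y t) i 0)).
Proof.
have [alpha [K [ia K0 aeg]]] := growth T vloc.
have [X [X0 xX]] := state_bounded T.
have sub : (`[t0, T]%classic : set R) `<=` `[0, T].
  by move=> t /=; rewrite !in_itv/= => /andP[/(le_trans t00)-> ->].
have sub' : (`[t0, T]%classic : set R) `<=` `[t0, +oo[.
  by move=> t /=; rewrite !in_itv/= => /andP[->].
have ae := ae_on_and (ae_onS sub aeg) (ae_onS sub' eqs).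
split=> i; apply: output_integrable; [exact: my| |exact: mfy|].
  exists (fun=> K * (1 + X)); first exact: integrable_on_cst.
  apply: ae_on_imply ae => t; rewrite /= in_itv/= => tT [[a0 _ ga] [oe _]].
  have [yK _ _] := ga _ _ oe; apply: le_trans (coord_le_norm _ _) (le_trans yK _).
  by rewrite ler_wpM2l// lerD2l xX.
exists (fun t => alpha t * (1 + X)).
  by apply: integrable_onZr; exact: integrable_on_sub ia.
apply: ae_on_imply ae => t; rewrite /= in_itv/= => tT [[a0 _ ga] [oe _]].
have [_ fK _] := ga _ _ oe; apply: le_trans (coord_le_norm _ _) (le_trans fK _).
by rewrite ler_wpM2l// lerD2l xX.
Qed.

(** Integral solutions are trajectories: the integral is absolutely
    continuous with derivative [w] almost everywhere, and the growth estimate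
    makes the output and the feedback locally integrable.  Also used for the
    extension of pre-trajectories, hence the data [w] and [y] are arbitrary
    rather than produced by the existence theorem. *)
Lemma pretrajectory_of_integral_equation :
  pretrajectory sys t0 (Signal +oo%E v x y).
Proof.
have L1 (z : R -> R) : (forall T, integrable_on t0 T z) -> L1_loc `[t0, +oo[ z.
  move=> iz a b sub; have [ab|ba] := leP a b; last first.
    rewrite set_itv_ge; first exact: integrable_set0.
    by rewrite bnd_simp -ltNge.
  have : a \in `[t0, +oo[ by apply: sub; rewrite /= in_itv/= lexx.
  by rewrite in_itv/= andbT => t0a; exact: integrable_on_sub (iz b).
rewrite /pretrajectory /= horizon_itvE; split; first by rewrite ltry.
- split => //.
  + move=> a b ab sub; have : a \in `[t0, +oo[ by apply: sub; rewrite /= in_itv/= lexx.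
    rewrite in_itv/= andbT => t0a; apply: coord_abs_continuous => i e e0.
    have [d d0 dP] := abs_cont_lint (iw b i) e0; exists d => // N s r sr tr sd.
    apply: le_lt_trans (dP N s r _ tr sd).
      apply: ler_sum => j _; have [h1 h2 h3] := sr j.
      by rewrite state_coordB//; lra.
    by move=> j; have [h1 h2 h3] := sr j; split => //; lra.
  + by move=> i; apply: L1 => T; exact: (output_L1 T).1.
  + by move=> i; apply: L1 => T; exact: (output_L1 T).2.
- have der : ae_on `[t0, +oo[ (fun t => is_derive t (1 : R) x (w t)).
    have sub : (`[t0, +oo[%classic : set R) `<=` \bigcup_k `[t0, t0 + k%:R]%classic.
      move=> t; rewrite /= in_itv/= andbT => tt; exists (Num.trunc (t - t0)).+1 => //=.
      have : 0 <= t - t0 by rewrite subr_ge0.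
      by move=> /truncn_itv/andP[_ h]; rewrite in_itv/= tt/=; lra.
    apply: (ae_on_bigcup sub) => k.
    suff : ae_on `[t0, t0 + k%:R] (fun t => forall i,
        is_derive t (1 : R) (fun s => x s i 0) (w t i 0)).
      by apply: ae_on_imply => t _; exact: is_derive_coord.
    apply: ae_on_forall => i.
    have ld : ae_on `[t0, t0 + k%:R] (fun t => t0 < t < t0 + k%:R ->
        is_derive t (1 : R) (lint (fun t => w t i 0) t0) (w t i 0)).
      by apply: negligibleS (lint_derivative (iw (t0 + k%:R) i)) => t /= /not_implyP[_].
    apply: ae_on_imply (ae_on_and (ae_on_and (ae_on_neq _ t0) (ae_on_neq _ (t0 + k%:R))) ld).
    move=> t; rewrite /= in_itv/= => /andP[tt tk] [[/eqP nt /eqP nk] d].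
    have tlt : t0 < t by rewrite lt_neqAle eq_sym nt.
    have tlk : t < t0 + k%:R by rewrite lt_neqAle nk.
    have := d; rewrite tlt tlk => /(_ isT)/is_deriveP dP.
    apply/is_deriveP => e /dP[r r0 rP]; exists (Num.min r (t - t0)).
      by rewrite lt_min r0 subr_gt0.
    move=> s; rewrite lt_min => /andP[sr]; rewrite ltr_norml => /andP[s1 _].
    have ts : t0 <= s by lra.
    by rewrite state_coordB//; exact: rP.
  apply: ae_on_imply (ae_on_and der eqs) => t _ [d [_ E]].
  by rewrite -/(rhs sys v t (x t) (y t)) -E.
- by apply: ae_on_imply eqs => t _ [].
Qed.

End from_integral_equation.
Section output_elimination.
Variables (v : R -> 'cV[R]_me) (t0 : R) (S : set lebR).
Hypothesis t00 : 0 <= t0.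
Hypothesis vloc : vLinfty_loc nonneg v.
Hypothesis S_ray : S `<=` `[t0, +oo[.
Hypothesis S_conull : mu.-negligible (`[t0, +oo[ `\` S : set lebR).
Hypothesis S_coercive : forall t, S t -> coercive (Fmap sys t).

Definition solved_output (t : R) (x : 'cV[R]_n) : 'cV[R]_p :=
  inverse (Fmap sys t) (matC sys *m x + matDe sys *m v t).

Lemma S_ge0 t : S t -> 0 <= t.
Proof. by move=> /S_ray; rewrite /= in_itv/= andbT; exact: le_trans. Qed.

Lemma solved_outputP t x : S t -> output_eq sys v t x (solved_output t x).
Proof.
move=> St; apply/output_eqP/inverseK; last exact: S_coercive.
  by apply: Fmap_continuous; exact: S_ge0.
by apply: F_locally_injective; exact: S_ge0.
Qed.

Lemma solved_output_continuous t : S t -> continuous (solved_output t).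
Proof.
move=> St x.
apply: (@continuous_comp _ _ _ (fun x => matC sys *m x + matDe sys *m v t) (inverse (Fmap sys t))).
  by apply: ccontinuousD; [exact: mulmx_continuous|exact: cst_continuous].
apply: inverse_continuous; last exact: S_coercive.
  by apply: Fmap_continuous; exact: S_ge0.
by apply: F_locally_injective; exact: S_ge0.
Qed.

(** By completeness of the measure nothing has to be checked off the set
    [S] of good times. *)
Lemma measurable_on_conull (g : R -> R) : measurable S -> measurable_fun S g ->
  measurable_fun (`[t0, +oo[ : set lebR) g.
Proof.
move=> mS mg; rewrite -(setUIDK `[t0, +oo[ S) (_ : `[t0, +oo[ `&` S = S); last first.
  by apply/seteqP; split => t; [case|split => //; exact: S_ray].
apply/measurable_funU => //; first exact: negligible_measurable.
by split => //; exact: measurable_fun_negligible.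
Qed.

Lemma S_measurable : measurable S.
Proof.
rewrite (_ : S = `[t0, +oo[ `\` (`[t0, +oo[ `\` S)); last first.
  apply/seteqP; split => [t St|t [tt /not_andP[//|/contrapT//]]].
  by split; [exact: S_ray|case].
by apply: measurableD; [exact: measurable_itvL|exact: negligible_measurable].
Qed.

Lemma Fmap_measurable xi i : measurable_fun S (fun t => Fmap sys t xi i 0).
Proof.
have mf j : measurable_fun S (fun t => f t xi j 0).
  exact: (measurable_funS (measurable_itvL `[t0, +oo[) S_ray (nonlin_measurable _ _ t00)).
have -> : (fun t => Fmap sys t xi i 0) = fun t => xi i 0 - (matD sys *m f t xi) i 0.
  by apply/funext => t; rewrite /Fmap !mxE.
by apply: measurable_funB; [exact: measurable_cst|exact: measurable_mulmx].
Qed.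

Lemma measurable_solved_output (G : R -> 'cV[R]_p -> R) (x : R -> 'cV[R]_n) :
  (forall xi, measurable_fun (`[t0, +oo[ : set lebR) (fun t => G t xi)) ->
  (forall t, 0 <= t -> continuous (G t)) ->
  (forall i, measurable_fun (`[t0, +oo[ : set lebR) (fun t => x t i 0)) ->
  measurable_fun (`[t0, +oo[ : set lebR) (fun t => G t (solved_output t (x t))).
Proof.
move=> mG cG mx; have mS := S_measurable; apply: (measurable_on_conull mS).
apply: (measurable_inverse_selection (F := Fmap sys) mS).
- by move=> t St; apply: Fmap_continuous; exact: S_ge0.
- by move=> t St; apply: F_locally_injective; exact: S_ge0.
- exact: S_coercive.
- exact: Fmap_measurable.
- by move=> xi; exact: (measurable_funS (measurable_itvL `[t0, +oo[) S_ray (mG xi)).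
- by move=> t St; apply: cG; exact: S_ge0.
- apply: measurable_cD; apply: measurable_mulmx => j.
  exact: (measurable_funS (measurable_itvL `[t0, +oo[) S_ray (mx j)).
exact: (measurable_funS (measurable_itvL `[t0, +oo[) S_ray (vLinfty_measurable t00 vloc j)).
Qed.

End output_elimination.

Lemma continuous_coord k l (g : 'cV[R]_k -> 'cV[R]_l) i : continuous g ->
  continuous (fun x => g x i 0).
Proof.
by move=> cg x; apply: (@continuous_comp _ _ _ g (fun u => u i 0)); [exact: cg|exact: coord_continuous].
Qed.

(** [S] collects the times at which the growth estimates for all horizons
    [k] hold.  At these times the output is eliminated; at the others the
    right-hand side is set to zero, so that the hypotheses of the existence
    theorem hold at every time. *)
Lemma integral_equation_solvable (v : R -> 'cV[R]_me) (t0 : R) (x0 : 'cV[R]_n) :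
  0 <= t0 -> vLinfty_loc nonneg v ->
  exists x w y, [/\ forall t, t0 <= t -> x t = x0 + vint w t0 t,
    forall T i, integrable_on t0 T (fun t => w t i 0),
    ae_on `[t0, +oo[ (fun t => output_eq sys v t (x t) (y t) /\ w t = rhs sys v t (x t) (y t)),
    forall i, measurable_fun (`[t0, +oo[ : set lebR) (fun t => y t i 0) &
    forall i, measurable_fun (`[t0, +oo[ : set lebR) (fun t => f t (y t) i 0)].
Proof.
move=> t00 vloc.
have ex (k : nat) : exists aK : (R -> R) * R, [/\ integrable_on 0 k%:R aK.1, 0 <= aK.2 &
    ae_on `[0, k%:R] (growth_at sys v aK.1 aK.2)].
  by have [a [K aK]] := growth k%:R vloc; exists (a, K).
pose aK k := sval (cid (ex k)).
have aKP k : [/\ integrable_on 0 k%:R (aK k).1, 0 <= (aK k).2 &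
    ae_on `[0, k%:R] (growth_at sys v (aK k).1 (aK k).2)] by rewrite /aK; case: cid.
pose S : set lebR := [set t | t0 <= t /\
  forall k : nat, t <= k%:R -> growth_at sys v (aK k).1 (aK k).2 t].
have above (t : R) : exists k : nat, t <= k%:R.
  exists (Num.trunc `|t|).+1; apply: le_trans (ler_norm _) _.
  by have /andP[_ /ltW] := truncn_itv (normr_ge0 t).
have S_ray : S `<=` `[t0, +oo[ by move=> t [tt _]; rewrite /= in_itv/= tt.
have S_conull : mu.-negligible (`[t0, +oo[ `\` S : set lebR).
  have : mu.-negligible (\bigcup_k ~` [set t : R | t \in `[0, k%:R] ->
      growth_at sys v (aK k).1 (aK k).2 t]).
    by apply: negligible_bigcup => k; have [_ _] := aKP k.
  apply: negligibleS => t [] /=; rewrite in_itv/= andbT => tt /not_andP[//|].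
  move=> /existsNP[k /not_implyP[tk ng]]; exists k => //=; apply/not_implyP; split => //.
  by rewrite in_itv/= tk (le_trans t00 tt).
have S_coercive t : S t -> coercive (Fmap sys t).
  by move=> [_ St]; have [k tk] := above t; have [] := St k tk.
pose h t (x : 'cV[R]_n) := if pselect (S t) then rhs sys v t x (solved_output v t x) else 0.
have hS t x : S t -> h t x = rhs sys v t x (solved_output v t x).
  by rewrite /h; case: pselect.
have mS := S_measurable S_ray S_conull.
have rhs_measurable xi z i :
    measurable_fun (`[t0, +oo[ : set lebR) (fun t => rhs sys v t xi z i 0).
  apply: measurable_cD; last by apply: measurable_mulmx; exact: vLinfty_measurable.
  apply: measurable_cD; first by move=> j; exact: measurable_cst.
  by apply: measurable_mulmx => j; exact: nonlin_measurable.
have rhs_continuous t k (g1 : 'cV[R]_k -> 'cV[R]_n) (g2 : 'cV[R]_k -> 'cV[R]_p) : 0 <= t ->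
    continuous g1 -> continuous g2 -> continuous (fun x => rhs sys v t (g1 x) (g2 x)).
  move=> tge0 cg1 cg2 xi; have [cf _] := f_caratheodory.
  apply: (@ccontinuousD _ _ _ (fun x => matA sys *m g1 x + matB sys *m f t (g2 x)) (fun=> _));
    last exact: cst_continuous.
  apply: (@ccontinuousD _ _ _ (fun x => matA sys *m g1 x)).
    apply: (@continuous_comp _ _ _ g1 (fun u => matA sys *m u)); first exact: cg1.
    exact: mulmx_continuous.
  apply: (@continuous_comp _ _ _ (fun x => f t (g2 x)) (fun u => matB sys *m u)).
    by apply: continuous_comp; [exact: cg2|exact: cf].
  exact: mulmx_continuous.
have [x [iw xE]] : exists x : R -> 'cV[R]_n,
    (forall T i, integrable_on t0 T (fun s => h s (x s) i 0)) /\
    forall t, t0 <= t -> x t = x0 + vint (fun s => h s (x s)) t0 t.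
  apply: caratheodory_existence => [xi i|t tt|T].
  - apply: (measurable_on_conull S_ray S_conull mS).
    have mr : measurable_fun S (fun t => rhs sys v t xi (solved_output v t xi) i 0).
      apply: (measurable_funS (measurable_itvL `[t0, +oo[) S_ray).
      apply: (measurable_solved_output t00 vloc S_ray S_conull S_coercive
        (G := fun t z => rhs sys v t xi z i 0) (x := fun=> xi)).
      - by move=> z; exact: rhs_measurable.
      - move=> t tge0; apply: continuous_coord; apply: rhs_continuous => //; first exact: cst_continuous.
        by move=> z; exact: cvg_id.
      - by move=> j; exact: measurable_cst.
    by apply: eq_measurable_fun mr => t; rewrite inE => St; rewrite hS.
  - have [St|nSt] := pselect (S t); last first.
      rewrite (_ : h t = fun=> 0); first exact: cst_continuous.
      by apply/funext => z; rewrite /h; case: pselect.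
    rewrite (_ : h t = fun z => rhs sys v t z (solved_output v t z)); last first.
      by apply/funext => z; rewrite hS.
    apply: rhs_continuous; [exact: le_trans tt| |exact: (solved_output_continuous t00 S_ray S_coercive St)].
    by move=> z; exact: cvg_id.
  - have [k Tk] := above T; have [ia _ _] := aKP k.
    exists (fun t => `|(aK k).1 t|); split.
      by apply: integrable_on_norm; exact: integrable_on_sub ia.
    move=> t /andP[tt tT]; split => // xi; have [St|nSt] := pselect (S t); last first.
      rewrite (_ : h t xi = 0) ?normr0 ?mulr_ge0 ?addr_ge0//.
      by rewrite /h; case: pselect.
    rewrite hS//.
    have [_ St'] := St; have [a0 _ ga] := St' k (le_trans tT Tk).
    have [_ _] := ga _ _ (solved_outputP v t00 S_ray S_coercive xi St).
    by rewrite ger0_norm.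
have mx i : measurable_fun (`[t0, +oo[ : set lebR) (fun t => x t i 0).
  apply: measurable_fun_ray => b.
  have ml : measurable_fun (`[t0, b] : set lebR)
      (fun t => x0 i 0 + lint (fun s => h s (x s) i 0) t0 t).
    apply: measurable_funD; first exact: measurable_cst.
    by apply: abs_cont_measurable; exact: abs_cont_lint.
  by apply: eq_measurable_fun ml => t; rewrite inE/= in_itv/= => /andP[tt _]; rewrite xE// !mxE.
exists x, (fun t => h t (x t)), (fun t => solved_output v t (x t)); split.
- exact: xE.
- exact: iw.
- apply: (negligibleS _ S_conull) => t /= /not_implyP[tt ne]; split; first exact: tt.
  move=> St; apply: ne; split; last exact: hS.
  exact: (solved_outputP v t00 S_ray S_coercive).
- move=> i; apply: (measurable_solved_output t00 vloc S_ray S_conull S_coercive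
      (G := fun t z => z i 0)).
  + by move=> z; exact: measurable_cst.
  + by move=> t _; apply: continuous_coord => z; exact: cvg_id.
  + exact: mx.
- move=> i; apply: (measurable_solved_output t00 vloc S_ray S_conull S_coercive
      (G := fun t z => f t z i 0)).
  + by move=> z; exact: nonlin_measurable.
  + by move=> t tge0; apply: continuous_coord; exact: f_caratheodory.1.
  + exact: mx.
Qed.
(** * Extension of pre-trajectories *)

Section extension.
Variables (t0 tau : R) (v : R -> 'cV[R]_me) (x : R -> 'cV[R]_n) (y : R -> 'cV[R]_p).
Hypothesis t00 : 0 <= t0.
Hypothesis pre : pretrajectory sys t0 (Signal tau%:E v x y).

Let g t := rhs sys v t (x t) (y t).
Let J : set R := [set t | t0 <= t < tau].

Lemma horizon_itv_fin : horizon_itv t0 tau%:E = J.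
Proof. by apply/seteqP; split => t; rewrite /J/horizon_itv/= lte_fin => /andP. Qed.

Lemma t0_lt : t0 < tau.
Proof. by have [] := pre; rewrite lte_fin. Qed.

Lemma itv_sub_J b : b < tau -> (`[t0, b]%classic : set R) `<=` J.
Proof. by move=> bt t; rewrite /J/= in_itv/= => /andP[-> /le_lt_trans]; exact. Qed.

Lemma pre_vloc : vLinfty_loc nonneg v.
Proof. by have [_ []] := pre. Qed.

Lemma pre_abs_cont b i : t0 <= b -> b < tau -> abs_cont t0 b (fun t => x t i 0).
Proof.
move=> tb bt; have [_ [_ ax _ _] _ _] := pre; apply: abs_continuous_coord; apply: ax => //.
by rewrite /= horizon_itv_fin; exact: itv_sub_J.
Qed.

Lemma pre_ae : ae_on J (fun t => is_derive t (1 : R) x (g t) /\ output_eq sys v t (x t) (y t)).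
Proof. by have [_ _] := pre; rewrite /= horizon_itv_fin; exact: ae_on_and. Qed.

Lemma pre_measurable_state i : measurable_fun (`[t0, tau] : set lebR) (fun t => x t i 0).
Proof.
apply: measurable_fun_exhaustion => b bt; have [tb|bt0] := leP t0 b.
  exact: abs_cont_measurable (pre_abs_cont i tb bt).
rewrite set_itv_ge; first exact: measurable_fun_set0.
by rewrite bnd_simp -ltNge.
Qed.

Lemma pre_measurable_output i : measurable_fun (`[t0, tau] : set lebR) (fun t => y t i 0).
Proof.
apply: measurable_fun_exhaustion => b bt; have [_ [_ _ ly _] _ _] := pre.
apply/measurable_EFinP; apply: measurable_int (ly i t0 b _).
by rewrite /= horizon_itv_fin; exact: itv_sub_J.
Qed.

Lemma pre_measurable_feedback i :
  measurable_fun (`[t0, tau] : set lebR) (fun t => f t (y t) i 0).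
Proof.
apply: measurable_fun_exhaustion => b bt; have [_ [_ _ _ lf] _ _] := pre.
apply/measurable_EFinP; apply: measurable_int (lf i t0 b _).
by rewrite /= horizon_itv_fin; exact: itv_sub_J.
Qed.

Lemma pre_measurable_rhs i : measurable_fun (`[t0, tau] : set lebR) (fun t => g t i 0).
Proof.
apply: measurable_cD; last first.
  apply: measurable_mulmx => j.
  apply: (measurable_funS (measurable_itvL `[t0, +oo[) _ (vLinfty_measurable t00 pre_vloc j)).
  by move=> t /=; rewrite !in_itv/= => /andP[->].
apply: measurable_cD; apply: measurable_mulmx; first exact: pre_measurable_state.
exact: pre_measurable_feedback.
Qed.

Lemma pre_rhs_bound : exists2 alpha : R -> R, integrable_on t0 tau alpha &
  ae_on J (fun t => 0 <= alpha t /\ `|g t| <= alpha t * (1 + `|x t|)).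
Proof.
have [alpha [K [ia K0 aeg]]] := growth tau pre_vloc.
exists alpha; first exact: integrable_on_sub ia.
have sub : J `<=` `[0, tau].
  by move=> t /andP[tt h]; rewrite /= in_itv/= (ltW h) (le_trans t00 tt).
apply: ae_on_imply (ae_on_and (ae_onS sub aeg) pre_ae) => t _ [[a0 _ ga] [_ oe]].
by split => //; have [] := ga _ _ oe.
Qed.

(** Wherever the state is bounded, the right-hand side is dominated by a
    multiple of [alpha], which is integrable up to [tau]. *)
Lemma pre_rhs_integrable s b X i : t0 <= s -> b <= tau ->
  (forall t, J t -> s <= t <= b -> `|x t| <= X) -> integrable_on s b (fun t => g t i 0).
Proof.
move=> ts bt xX; have [alpha ia ga] := pre_rhs_bound.
apply: (integrable_dominated_ae (measurable_itvL _) _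
    (beta := fun t => alpha t * (1 + X))).
- apply: (measurable_funS (measurable_itvL `[t0, tau]) _ (pre_measurable_rhs i)).
  move=> t /=; rewrite !in_itv/= => /andP[h1 h2].
  by rewrite (le_trans ts h1) (le_trans h2 bt).
- by apply: integrable_onZr; exact: integrable_on_sub ia.
have nt := ae_on_neq `[s, b] tau.
have FF := ae_filter_ringOfSetsType mu.
apply: (@filterS2 _ (almost_everywhere mu) FF _ _ _ _ nt ga) => t hn hg stb.
move: (stb); rewrite /= in_itv/= => /andP[st tb].
have Jt : J t.
  rewrite /J/= (le_trans ts st)/= lt_neqAle (le_trans tb bt) andbT.
  by apply/eqP; exact: hn stb.
have [a0 hgt] := hg Jt; apply: le_trans (coord_le_norm _ i) (le_trans hgt _).
by rewrite ler_wpM2l// lerD2l; apply: xX => //; rewrite st.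
Qed.

Lemma pre_integral_equation i s t : t0 <= s -> s <= t -> t < tau ->
  x t i 0 = x s i 0 + lint (fun r => g r i 0) s t.
Proof.
move=> ts st tt; have [X [X0 xX]] := abs_continuous_bounded (le_trans ts st)
  (fun i => pre_abs_cont i (le_trans ts st) tt).
have it : integrable_on s t (fun r => g r i 0).
  apply: (@pre_rhs_integrable _ _ X) => //; first exact: ltW.
  by move=> r /andP[tr _] /andP[_ rt]; apply: xX; rewrite tr.
have ax : abs_cont s t (fun t => x t i 0).
  move=> e e0; have [d d0 dP] := pre_abs_cont i (le_trans ts st) tt e0.
  exists d => // N a b ab; apply: dP => j; have [h1 h2 h3] := ab j; split => //; lra.
apply: ftc_abs_cont st ax it _.
have FF := ae_filter_ringOfSetsType mu.
apply: (@filterS _ (almost_everywhere mu) FF _ _ _ pre_ae) => r hr /andP[sr rt].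
have [d _] : is_derive r (1 : R) x (g r) /\ output_eq sys v r (x r) (y r).
  by apply: hr; rewrite /J/=; apply/andP; split; lra.
exact: coord_is_derive.
Qed.

(** Choose [s < tau] such that the integral of [alpha] over [[s, tau]] is less
    than 1/2.  If [M] is the supremum of [|x|] over [[s, t]], then
    [M <= |x s| + (1 + M) / 2], so [M <= 2 * |x s| + 1] whatever [t < tau]. *)
Lemma pre_bounded : exists X : R, 0 <= X /\ forall t, J t -> `|x t| <= X.
Proof.
have [alpha ia ga] := pre_rhs_bound.
have half0 : 0 < 1 / 2 :> R by lra.
have [d d0 dP] := lint_small ia half0.
have t0t := t0_lt.
pose s := Num.max t0 (tau - d / 2).
have s_ge : t0 <= s by rewrite /s le_max lexx.
have s_ge' : tau - d / 2 <= s by rewrite /s le_max lexx orbT.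
have s_lt : s < tau by rewrite /s gt_max t0t/=; lra.
have late t : s <= t -> t < tau -> `|x t| <= 2 * `|x s| + 1.
  move=> st tt; have ax i := pre_abs_cont i (le_trans s_ge st) tt.
  have [X [X0 xX]] := abs_continuous_bounded (le_trans s_ge st) ax.
  pose E := [set `|x r| | r in `[s, t]%classic].
  have Es : E `|x t| by exists t => //; rewrite /= in_itv/= st lexx.
  have supE : has_sup E.
    split; first by exists `|x t|.
    exists X => _ [r + <-]; rewrite /= in_itv/= => /andP[sr rt].
    by apply: xX; rewrite (le_trans s_ge sr).
  have ubE r : s <= r <= t -> `|x r| <= sup E.
    by move=> srt; apply: sup_upper_bound => //; exists r.
  have M0 : 0 <= sup E by apply: le_trans (ubE t _); rewrite // st lexx.
  suff : sup E <= `|x s| + 1 / 2 * (1 + sup E).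
    by have := ubE t; rewrite st lexx => /(_ isT) *; lra.
  apply: ge_sup; first by exists `|x t|.
  move=> _ [r + <-]; rewrite /= in_itv/= => /andP[sr rt].
  have rtau := le_lt_trans rt tt.
  have half : lint (fun r => `|alpha r|) s r < 1 / 2.
    by apply: dP => //; lra.
  suff incr : `|x r - x s| <= lint (fun r => `|alpha r|) s r * (1 + sup E).
    have := cnorm_sub (x r) (x s).
    have : lint (fun r => `|alpha r|) s r * (1 + sup E) <= 1 / 2 * (1 + sup E).
      by rewrite ler_wpM2r ?addr_ge0// ltW.
    move=> *; lra.
  have ias : integrable_on s r alpha by apply: integrable_on_sub ia => //; exact: ltW.
  have l0 : 0 <= lint (fun r => `|alpha r|) s r by exact: lint_ge0.
  apply: norm_le_coord => [|i]; first by rewrite mulr_ge0// addr_ge0.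
  rewrite !mxE (pre_integral_equation i s_ge sr rtau) addrAC subrr add0r.
  have ig : integrable_on s r (fun t => g t i 0).
    apply: (@pre_rhs_integrable _ _ (sup E)) => //; first exact: ltW.
    move=> q _ /andP[sq qr]; apply: ubE; rewrite sq; exact: le_trans rt.
  have ib : integrable_on s r (fun q => alpha q * (1 + sup E)) by exact: integrable_onZr.
  have gb : ae_on `[s, r] (fun q => `|g q i 0| <= alpha q * (1 + sup E)).
    have sub : (`[s, r]%classic : set R) `<=` J.
      move=> q; rewrite /J/= in_itv/= => /andP[sq qr].
      by rewrite (le_trans s_ge sq)/=; exact: le_lt_trans rtau.
    apply: ae_on_imply (ae_onS sub ga) => q; rewrite /= in_itv/= => /andP[sq qr] [a0 gq].
    apply: le_trans (coord_le_norm _ i) (le_trans gq _).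
    rewrite ler_wpM2l// lerD2l; apply: ubE; rewrite sq; exact: le_trans rt.
  apply: le_trans (lint_norm_le_ae (lexx s) (lexx r) ig ib gb) _.
  rewrite -(lintZ _ (lexx s) (lexx r) (integrable_on_norm ias)).
  rewrite le_eqVlt; apply/orP; left; apply/eqP; apply: eq_lint => q _ _.
  by rewrite normrM [`|1 + _|]ger0_norm// addr_ge0.
have [X [X0 xX]] := abs_continuous_bounded s_ge (fun i => pre_abs_cont i s_ge s_lt).
exists (X + (2 * `|x s| + 1)); split; first by rewrite !addr_ge0// mulr_ge0.
move=> t /andP[tt tlt]; have [ts|st] := leP t s.
  by apply: le_trans (xX t _) _; rewrite ?tt// lerDl addr_ge0// mulr_ge0.
by apply: le_trans (late t (ltW st) tlt) _; rewrite lerDr.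
Qed.

(** The right-hand side is integrable on [[t0, tau]], so the state has a limit
    at [tau]; a global solution starting there is glued on. *)
Lemma pretrajectory_extension :
  exists2 w', pretrajectory sys t0 w' & extends t0 (Signal tau%:E v x y) w'.
Proof.
have [X [X0 xX]] := pre_bounded; have t0t := t0_lt.
have ig i : integrable_on t0 tau (fun t => g t i 0).
  by apply: (@pre_rhs_integrable _ _ X) => // t Jt _; exact: xX.
pose xl t := x t0 + vint g t0 t.
have xlE t : J t -> xl t = x t.
  move=> /andP[tt tlt]; apply/colP => i; rewrite !mxE.
  by rewrite (pre_integral_equation i (lexx t0) tt tlt).
have tau0 : 0 <= tau by rewrite (le_trans t00)// ltW.
have [x2 [w2 [y2 [x2E iw2 eqs2 my2 mfy2]]]] := integral_equation_solvable (xl tau) tau0 pre_vloc.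
(* the left part is the integral xl rather than x, so that the value at tau is the limit *)
pose x3 := concat tau xl x2; pose y3 := concat tau y y2; pose w3 := concat tau g w2.
have xl0 : xl t0 = x t0 by rewrite /xl vint_nil// addr0.
have iw3 T i : integrable_on t0 T (fun t => w3 t i 0).
  rewrite (concat_app (fun (_ : R) (u : 'cV[R]_n) => u i 0) tau g w2).
  apply: integrable_concat; first exact: ig.
  exact: iw2.
exists (Signal +oo%E v x3 y3); last first.
  split; rewrite /= ?ltry// horizon_itv_fin.
    move=> t Jt; have /andP[_ /ltW tt] := Jt.
    by rewrite /x3 concat_left// xlE.
  apply: aeW => t /andP[_ /ltW tt]; by rewrite /y3 concat_left.
apply: (pretrajectory_of_integral_equation t00 pre_vloc iw3).
- move=> t tt; rewrite [x3 t0]concat_left ?xl0; last exact: ltW.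
  have [tt'|tt'] := leP t tau.
    rewrite /x3 concat_left//; congr (_ + _); apply: eq_vint => r _ rt.
    by rewrite /w3 concat_left//; exact: le_trans tt'.
  rewrite /x3 concat_right// x2E ?ltW// /xl -addrA; congr (_ + _).
  rewrite (vint_add (lexx t0) (ltW t0t) (ltW tt') (lexx t) (iw3 t)); congr (_ + _).
    by apply: eq_vint => r _ rt; rewrite /w3 concat_left.
  by apply: eq_vint => r rt _; rewrite /w3 concat_right.
- have sub : (`[t0, +oo[ : set R) `<=` J `|` `[tau, +oo[.
    move=> t; rewrite /J/= !in_itv/= !andbT => tt.
    by have [h|h] := ltP t tau; [left; rewrite tt|right].
  have FF := ae_filter_ringOfSetsType mu.
  have nt : ae_on setT (fun t => t <> tau) by exact: ae_on_neq.
  have aeJ := ae_on_and (ae_onS (@subsetT _ _) nt : ae_on J _) pre_ae.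
  have aeR := ae_on_and (ae_onS (@subsetT _ _) nt : ae_on `[tau, +oo[ _) eqs2.
  apply: (@filterS2 _ (almost_everywhere mu) FF _ _ _ _ aeJ aeR) => t hJ hR tt.
  have [Jt|Rt] := sub t tt.
    have [_ [_ oe]] := hJ Jt; have /andP[_ /ltW tlt] := Jt.
    by rewrite /x3 /y3 /w3 !concat_left// xlE.
  have [/eqP tne [oe wE]] := hR Rt.
  have tlt : tau < t by move: Rt; rewrite /= in_itv/= andbT lt_neqAle eq_sym tne.
  by rewrite /x3 /y3 /w3 !concat_right.
- move=> i; rewrite (concat_app (fun (_ : R) (u : 'cV[R]_p) => u i 0) tau y y2).
  apply: measurable_concat; [exact: ltW|exact: pre_measurable_output|exact: my2].
- move=> i; rewrite (concat_app (fun t (u : 'cV[R]_p) => f t u i 0) tau y y2).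
  apply: measurable_concat; [exact: ltW|exact: pre_measurable_feedback|exact: mfy2].
Qed.

End extension.

End lure_existence.

(** * Forward completeness *)

Unset Implicit Arguments.
Theorem corollary4p3 (R : realType) (n m me p : nat)
    (n_gt0 : (0 < n)%N) (m_gt0 : (0 < m)%N)
    (me_gt0 : (0 < me)%N) (p_gt0 : (0 < p)%N)
    (sys : lure R n m me p)
    (f_caratheodory : caratheodory (nonlin sys))
    (F_locally_injective : forall t : R, 0 <= t -> locally_injective (Fmap sys t))
    (f_locally_bounded : forall K : set 'cV[R]_p, compact K ->
       exists phi : R -> R,
         [/\ L1_loc nonneg phi,
             (forall t : R, 0 <= t -> 0 <= phi t) &
             forall t : R, 0 <= t ->
               (ereal_sup [set (enorm (nonlin sys t xi))%:E | xi in K] <= (phi t)%:E)%E])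
    (f_growth : forall T : set R, compact T -> T `<=` nonneg ->
       exists rho c : R,
         [/\ 0 < rho, 0 < c, c * opnorm (matD sys) < 1 &
             ae_on T (fun t =>
               (ereal_sup [set (enorm (nonlin sys t xi) / enorm xi)%:E
                          | xi in [set xi : 'cV[R]_p | (rho <= enorm xi)%R]]
                <= c%:E)%E)]) :
  forward_complete sys /\
  (forall (v : R -> 'cV[R]_me) (t0 : R) (x0 : 'cV[R]_n),
     vLinfty_loc nonneg v -> 0 <= t0 ->
     exists (x : R -> 'cV[R]_n) (y : R -> 'cV[R]_p),
       trajectories sys t0 (Signal +oo%E v x y) /\ x t0 = x0).
Proof.
case: p p_gt0 sys f_caratheodory F_locally_injective f_locally_bounded f_growth
  => [//|p'] _ sys cf lf fb fg.
have growth v T : vLinfty_loc nonneg v -> exists alpha K,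
    [/\ integrable_on 0 T alpha, 0 <= K & ae_on `[0, T] (growth_at sys v alpha K)].
  exact: rhs_growth.
split => [t0 t00|v t0 x0 vloc t00].
  apply/seteqP; split => w [pre max]; split => //; last first.
    by move=> [w' _ [+ _ _ _]]; rewrite max ltNge leey.
  case: w pre max => -[tau| |] v x y pre max //=; last by have [] := pre.
  by case: max; exact: pretrajectory_extension.
have [x [w [y [xE iw eqs my mfy]]]] := integral_equation_solvable cf lf growth x0 t00 vloc.
have xt0 : x t0 = x0 by rewrite xE// vint_nil// addr0.
exists x, y; split => //; split => //.
apply: (pretrajectory_of_integral_equation growth t00 vloc iw) => //.
by move=> t tt; rewrite xt0; exact: xE.
Qed.
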